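(* Let $\{B_t^H\}_{t\in\mathbb{R}}$ be a fractional Brownian motion with $H\in(\frac12,1)$ and let $\{\xi_t\}_{t\in\mathbb{R}}$ be a two-sided Lévy process independent of $B^H$. For $t\ge0$ let $$Z_t^n=\sum_{i=1}^n e^{-\xi_t+\xi_{u_{i-1}^n}}\big(B^H_{u_i^n}-B^H_{u_{i-1}^n}\big),$$ where $-N_n=u_0^n<u_1^n<\dots<u_n^n=t$ are deterministic points with $\max_i(u_i^n-u_{i-1}^n)\downarrow0$ and $N_n\uparrow\infty$ as $n\to\infty$. If $\lim_{t\to\infty}\xi_t=+\infty$ almost surely, then for each $t\ge0$ the sequence $Z_t^n$ converges in probability, as $n\to\infty$, to a limit, denoted $\overline Y_t=\int_{-\infty}^t e^{-(\xi_t-\xi_{u-})}\,dB_u^H$, which does not depend on the choice of the points $u_i^n$. If further $E[e^{-2\xi_1}]<1$, then $Z_t^n$ converges to $\overline Y_t$ in $L^2(\Omega)$, and $$E[\overline Y_t]=E\left[\int_{-\infty}^t e^{-(\xi_t-\xi_{u-})}\,dB_u^H\right]=0,$$ and for $0<s\le t$, $$E[\overline Y_s\overline Y_t]=c_H\int_{-\infty}^s\int_{-\infty}^t E_\xi\big[e^{-\xi_s+\xi_{u-}-\xi_t+\xi_{v-}}\big]\,|u-v|^{2H-2}\,dv\,du,\qquad c_H:=H(2H-1).$$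
   Context: A fractional Brownian motion (FBM) with index $H$ is a centered Gaussian process $\{B^H_t\}_{t\in\mathbb{R}}$ with $B_0^H=0$ and $\mathrm{Cov}(B_t^H,B_s^H)=\frac12(|t|^{2H}+|s|^{2H}-|t-s|^{2H})$, taken with continuous paths. A two-sided Lévy process is $\xi_t=\xi^1_t$ for $t\ge0$ and $\xi_t=-\xi^2_{-t-}$ for $t<0$, where $\{\xi^1_t\}_{t\ge0}$ and $\{\xi^2_t\}_{t\ge0}$ are independent copies of a real-valued Lévy process. The processes live on a complete product space $(\Omega,\mathscr F,P)=(\Omega_1\times\Omega_2,\mathscr F_1\otimes\mathscr F_2,P_1\otimes P_2)$, with $\xi$ defined on $\Omega_1$ and $B^H$ on $\Omega_2$. $E_\xi$ denotes expectation with respect to $\xi$ only. *)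

(* Defs.v *)
From HB Require Import structures.
From mathcomp Require Import all_boot all_order all_algebra.
From mathcomp Require Import all_classical all_reals all_analysis.

Set Implicit Arguments.
Unset Strict Implicit.
Unset Printing Implicit Defensive.

Import Order.TTheory GRing.Theory Num.Theory.
Import numFieldNormedType.Exports.

Local Open Scope classical_set_scope.
Local Open Scope ring_scope.

(** Completion of a probability space. The completed sigma-algebra is that of
    the Caratheodory measurable sets of the outer measure [P^*]; as [P] is
    finite, these are the measurable sets up to [P]-null sets. *)

Section completion.
Context {d : measure_display} {T : measurableType d} {R : realType}.
Variable P : probability T R.

Definition completed_space := caratheodory_type (P^*)%mu.

HB.instance Definition _ := Measurable.on completed_space.

Definition completed_prob : set completed_space -> \bar R :=
  @completed_measure_extension _ _ _ P.

HB.instance Definition _ := Measure.on completed_prob.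

Let completed_prob_setT : completed_prob setT = 1%E.
Proof.
rewrite -(probability_setT P); exact: (measurable_mu_extE P measurableT).
Qed.

HB.instance Definition _ :=
  Measure_isProbability.Build _ _ _ completed_prob completed_prob_setT.

Lemma completed_prob_is_complete : measure_is_complete completed_prob.
Proof. exact: measure_is_complete_caratheodory. Qed.

End completion.

Section completed_product.
Context {d1 d2 : measure_display} {T1 : measurableType d1}
  {T2 : measurableType d2} {R : realType}.

(** The underlying type is [T1 * T2]. *)
Definition product_space (P1 : probability T1 R) (P2 : probability T2 R) :=
  completed_space (P1 \x P2)%E.

Definition product_prob (P1 : probability T1 R) (P2 : probability T2 R) :
  probability (product_space P1 P2) R :=
  @completed_prob _ _ _ (P1 \x P2)%E.

End completed_product.

Section processes.
Context {d : measure_display} {T : measurableType d} {R : realType}.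
Variable P : probability T R.

(** Mutual independence of [X 0, ..., X n.-1]; the product rule for
    subfamilies is the case where some of the [A i] are [setT]. *)
Definition mutually_independent (n : nat) (X : nat -> T -> R) : Prop :=
  forall A : nat -> set R, (forall i, measurable (A i)) ->
    fine (P (\bigcap_(i in `I_n) (X i @^-1` A i))) =
    \prod_(i < n) fine (P (X i @^-1` A i)).

(** Processes indexed by [[0, +oo[] are functions on [R] of which only the
    values at nonnegative times matter. *)

Definition process_sigma_algebra (X : R -> T -> R) : set (set T) :=
  <<s [set A | exists t B, [/\ 0 <= t, measurable B & A = X t @^-1` B]] >>.

Definition independent_processes (X Y : R -> T -> R) : Prop :=
  forall A B, process_sigma_algebra X A -> process_sigma_algebra Y B ->
    P (A `&` B) = (P A * P B)%E.

Definition same_law (X Y : R -> T -> R) : Prop :=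
  forall (n : nat) (t : nat -> R) (A : nat -> set R),
    (forall i, 0 <= t i) -> (forall i, measurable (A i)) ->
    P (\bigcap_(i in `I_n) (X (t i) @^-1` A i)) =
    P (\bigcap_(i in `I_n) (Y (t i) @^-1` A i)).

Definition left_limit (f : R -> R) (t : R) : R := lim (f x @[x --> t^'-]).

Definition cadlag (f : R -> R) : Prop :=
  (forall t, 0 <= t -> f x @[x --> t^'+] --> f t) /\
  (forall t, 0 < t -> cvg (f x @[x --> t^'-])).

Record levy_process (X : R -> {RV P >-> R}) : Prop := LevyProcess {
  levy_start : {ae P, forall w, X 0 w = 0} ;
  levy_indep_increments : forall (n : nat) (t : nat -> R), 0 <= t 0%N ->
    (forall i, (i < n)%N -> t i < t i.+1) ->
    mutually_independent n (fun i w => X (t i.+1) w - X (t i) w) ;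
  levy_stationary_increments : forall s t (A : set R), 0 <= s -> 0 <= t ->
    measurable A ->
    P [set w | A (X (s + t) w - X s w)] = P [set w | A (X t w)] ;
  levy_stochastic_continuity : forall t e, 0 <= t -> 0 < e ->
    P [set w | e < `|X s w - X t w|]
      @[s --> within [set s | 0 <= s] (nbhs t)] --> 0%E ;
  levy_cadlag : {ae P, forall w, cadlag (fun t => X t w)} }.

Record two_sided_levy_process (xi : R -> T -> R) (X1 X2 : R -> {RV P >-> R}) :
    Prop := TwoSidedLevyProcess {
  two_sided_levy1 : levy_process X1 ;
  two_sided_levy2 : levy_process X2 ;
  two_sided_same_law : same_law (fun t => X1 t) (fun t => X2 t) ;
  two_sided_independent :
    independent_processes (fun t => X1 t) (fun t => X2 t) ;
  two_sided_nonneg : forall t w, 0 <= t -> xi t w = X1 t w ;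
  two_sided_neg : forall t w, t < 0 ->
    xi t w = - left_limit (fun s => X2 s w) (- t) }.

(** Normal law of mean [m] and standard deviation [s]; the degenerate case is
    treated apart because [normal_prob m 0] is a uniform law. *)
Definition gaussian (X : T -> R) : Prop :=
  exists m s : R, forall A : set R, measurable A ->
    P (X @^-1` A) = if s == 0 then dirac m A else normal_prob m s A.

Definition gaussian_process (X : R -> T -> R) : Prop :=
  forall (n : nat) (t a : nat -> R),
    gaussian (fun w => \sum_(i < n) a i * X (t i) w).

Record fractional_brownian_motion (H : R) (B : R -> {RV P >-> R}) : Prop :=
    FractionalBrownianMotion {
  fbm_gaussian : gaussian_process (fun t => B t) ;
  fbm_centered : forall t, 'E_P[B t]%E = 0%E ;
  fbm_start : {ae P, forall w, B 0 w = 0} ;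
  fbm_covariance : forall t s, covariance P (B t) (B s) =
    (2^-1 * (`|t| `^ (2 * H) + `|s| `^ (2 * H) - `|t - s| `^ (2 * H)))%:E ;
  fbm_continuous : {ae P, forall w, continuous (fun t => B t w)} }.

Definition cvg_in_probability (X : nat -> T -> R) (Y : T -> R) : Prop :=
  forall e : R, 0 < e ->
    P [set w | e < `|X n w - Y w|] @[n --> \oo] --> 0%E.

End processes.

Section partitions.
Context {R : realType}.

Definition mesh (u : nat -> nat -> R) (n : nat) : R :=
  \big[Num.max/0]_(i < n) (u n i.+1 - u n i).

(** [u n i] is the point of index [i] of the [n]-th subdivision of
    [[- N n, t]]; only [0 < n] and [i <= n] matter. *)
Record partition_sequence (t : R) (N : nat -> R) (u : nat -> nat -> R) :
    Prop := PartitionSequence {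
  partition_first : forall n, (0 < n)%N -> u n 0%N = - N n ;
  partition_last : forall n, (0 < n)%N -> u n n = t ;
  partition_increasing : forall n i, (i < n)%N -> u n i < u n i.+1 ;
  partition_mesh_nonincreasing : forall m n, (0 < m <= n)%N ->
    mesh u n <= mesh u m ;
  partition_mesh_cvg0 : mesh u n @[n --> \oo] --> 0 ;
  partition_bound_nondecreasing : forall m n, (0 < m <= n)%N -> N m <= N n ;
  partition_bound_cvgy : N n @[n --> \oo] --> +oo }.

End partitions.

Section fractional_OU.
Context {d1 d2 : measure_display} {T1 : measurableType d1}
  {T2 : measurableType d2} {R : realType}.
Variables (P1 : probability T1 R) (P2 : probability T2 R).
Variables (xi : R -> T1 -> R) (B : R -> T2 -> R).

Definition riemann_sum (t : R) (u : nat -> nat -> R) (n : nat)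
    (w : product_space P1 P2) : R :=
  \sum_(i < n) expR (- xi t w.1 + xi (u n i) w.1) *
               (B (u n i.+1) w.2 - B (u n i) w.2).

(** [Y] is (a version of) the integral
    [\int_(-oo)^t expR (- (xi_t - xi_(u-))) dB_u]: the limit in probability of
    the sums above, the same for all choices of the points. *)
Definition is_backward_integral (t : R) (Y : product_space P1 P2 -> R) : Prop :=
  forall (N : nat -> R) (u : nat -> nat -> R), partition_sequence t N u ->
    cvg_in_probability (product_prob P1 P2) (riemann_sum t u) Y.

End fractional_OU.

Arguments riemann_sum {d1 d2 T1 T2 R} P1 P2 xi B t u n w.
Arguments is_backward_integral {d1 d2 T1 T2 R} P1 P2 xi B t Y.

(* Main.v *)
Require Import Defs.
From HB Require Import structures.
From mathcomp Require Import all_boot all_order all_algebra.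
From mathcomp Require Import all_classical all_reals all_analysis.
From mathcomp Require Import measurable_realfun.
From mathcomp Require Import ring lra zify.
Import Order.TTheory GRing.Theory Num.Theory.
Import numFieldNormedType.Exports.
Local Open Scope classical_set_scope.
Local Open Scope ring_scope.
Set Implicit Arguments.
Unset Strict Implicit.
Unset Printing Implicit Defensive.

(** When the path of [xi] is fixed, the Riemann sums are linear combinations of
    increments of [B], and everything about them follows from the covariances
    of these increments. As [1/2 < H], the covariance of the increments over
    two intervals is the integral over their product of the kernel
    [H (2 H - 1) |u - v|^(2 H - 2)] ([integral_hkernel_rect]), which is
    integrable near the diagonal and bounded far from it. Hence a quadratic
    form in the increments is an integral of a step function against the
    kernel, and it is at most [2 |p|_1 (|q|_oo + |q|_1)] if that step function
    is dominated by [p(u) q(v)] ([icov_form_bound]).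

    For the convergence in probability, the difference of two Riemann sums has
    a conditional variance given [xi] of this kind: its coefficients form the
    difference of two step functions which, as the meshes tend to [0], converge
    pointwise to the left limits of [exp (- xi_t + xi_u)]. Under a bounded
    integrable majorant they converge in [L^1], so the conditional variance
    tends to [0] ([pathwise_form_small]), and Chebyshev's inequality makes the
    sums close in probability for any two sequences of partitions
    ([rsum_close]). The sums are thus Cauchy in probability, with the same limit
    for all partitions ([backward_integral_exists]).

    The majorant requires that the maxima of [exp (- X2)] over windows of
    length two form a summable sequence ([ae_levy_exp_dominated]). No moment is
    available, so no law of large numbers; a renewal argument replaces it. As
    [X1], which has the law of [X2], tends to infinity, there is a [K] such
    that with probability at least [1/2] the walk [X2 0, X2 1, ...] stays above
    [1] from the time [K] on. After a visit to an interval of length one, by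
    the Markov property, there is thus probability at least [1/2] of no further
    visit from [K] steps later on, so that the expected number of visits is at
    most [2 K], whatever the interval ([renewal_count]). The minimum of the path
    over a window is its value at the start plus an independent variable, so
    the expectation of the sum of the exponentials, restricted to the paths
    above [- M], is at most [2 K] times a geometric series
    ([ae_path_min_sum_bounded]); and almost every path is above some [- M].

    If [E exp (- 2 xi_1) < 1], the same quadratic forms are bounded in the mean,
    with norms in [L^2(P1)] in the place of absolute values. The Laplace
    transform of a Levy process is exponential in time ([exp_momentE]), so the
    integrand at time [r] has norm [exp ((t - r) rho / 2)] with [rho < 0]
    ([discount_sqr]) and a modulus of continuity in [L^2] ([discount_diff]).
    The sums are then Cauchy in [L^2] ([rsum_L2_cauchy]), and their covariances
    converge to the double integral by dominated convergence against the kernel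
    ([rsum_cov_cvg]). *)

(** * Integrals of powers of the distance to a point *)

Lemma measurable_superlevel d (T : measurableType d) (R : realType) (f : T -> R) (a : R) :
  measurable_fun setT f -> measurable [set w | a < f w].
Proof.
move=> mf; rewrite (_ : [set w | _] = f @^-1` `]a, +oo[).
  by rewrite -[X in measurable X]setTI; apply: mf.
by apply/seteqP; split => w /=; rewrite in_itv/= andbT.
Qed.

Lemma integral_prob_cst d (T : measurableType d) (R : realType) (P : probability T R)
  (c : \bar R) : (\int[P]_w c = c)%E.
Proof. by rewrite integral_cst// [X in (_ * X)%E](@probability_setT _ _ _ P) mule1. Qed.

Lemma integrable_fin_integral d (T : measurableType d) (R : realType)
    (m : {measure set T -> \bar R}) (D : set T) (f : T -> R) (c : R) :
  measurable D -> measurable_fun D f ->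
  (\int[m]_(x in D) (f x)%:E = c%:E)%E -> m.-integrable D (EFin \o f).
Proof.
move=> mD mf fc; apply/integrableP; split; first exact/measurable_EFinP.
by have := @integral_fin_num_abs _ _ _ m D f mD mf; rewrite fc => /= ->.
Qed.

Section kernel.
Context {R : realType}.
Local Notation mu := (@lebesgue_measure R).

(** The derivative may be unbounded at both ends, so the formula is taken on
    [[a + e_n, b - e_n]]; as the derivative is nonnegative, the integrals pass
    to the limit by monotone convergence. *)
Lemma FTC2_ge0_oc (f F : R -> R) (a b : R) : a < b ->
  measurable_fun setT f ->
  {in `]a, b[, continuous f} -> (forall x, 0 <= f x) ->
  derivable_oo_LRcontinuous F a b -> {in `]a, b[, (F^`())%classic =1 f} ->
  (\int[mu]_(x in `]a, b]) (f x)%:E = (F b - F a)%:E)%E.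
Proof.
move=> ab mf cf f0 dF F'f.
rewrite integral_itv_bndoo//; last first.
  by apply/measurable_EFinP; apply: measurable_funTS.
pose e n : R := (b - a) / 2 / n.+2%:R.
have e0 n : 0 < e n by rewrite /e !divr_gt0// subr_gt0.
have eab n : a + e n < b - e n.
  have h2 : (b-a)/2/n.+2%:R < (b-a)/2.
    by rewrite gtr_pMr ?divr_gt0 ?subr_gt0// invf_lt1// ltr1n.
  by rewrite /e; move: h2; set z := _ / n.+2%:R; lra.
pose A n := `[a + e n, b - e n]%classic : set R.
have nde m n : (m <= n)%N -> e n <= e m.
  move=> mn; rewrite /e ler_wpM2l ?divr_ge0 ?subr_ge0 ?(ltW ab)//.
  by rewrite lef_pV2 ?posrE// ler_nat.
have ecvg : e n @[n --> \oo] --> 0.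
  have : ((b - a) / 2) * (harmonic n.+1) @[n --> \oo] --> ((b - a) / 2) * 0.
    apply: cvgMr; have := @cvg_harmonic R.
    by rewrite -(cvg_shiftS (@harmonic R)).
  by rewrite mulr0.
have bigA : `]a, b[%classic = \bigcup_n A n.
  apply/seteqP; split => [x|x [n _]]; rewrite /A /= !in_itv/=; last first.
    move=> /andP[h1 h2]; have := e0 n => h3.
    by apply/andP; split; lra.
  move=> /andP[ax xb].
  have : \forall n \near \oo, e n < Num.min (x - a) (b - x).
    apply: (cvgr_lt 0) => //.
    by rewrite lt_min !subr_gt0 ax xb.
  case=> N _ /(_ N (leqnn _)) /=; rewrite lt_min => /andP[h1 h2].
  exists N => //=; rewrite in_itv/=; apply/andP; split; lra.
have H1 := @ge0_nondecreasing_set_cvg_integral _ (measurableTypeR R) R A (EFin \o f) mu.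
have {}H1 : (\int[mu]_(x in A i) (EFin \o f) x @[i --> \oo] -->
  \int[mu]_(x in \bigcup_i A i) (EFin \o f) x)%E.
  apply: H1.
  - apply/nondecreasing_seqP => n; rewrite subsetEset => x; rewrite /A /= !in_itv/=.
    have := nde _ _ (leqnSn n) => h /andP[h1 h2]; apply/andP; split; lra.
  - by move=> i; exact: measurable_itv.
  - by move=> i; apply/measurable_EFinP; apply: measurable_funTS.
  - by move=> i x _; rewrite lee_fin.
rewrite -bigA in H1.
apply: (cvg_unique _ H1) => //=.
have intA n : (\int[mu]_(x in A n) (EFin \o f) x = (F (b - e n) - F (a + e n))%:E)%E.
  have h := e0 n.
  have sub x : x \in `[a + e n, b - e n] -> x \in `]a, b[.
    by rewrite !in_itv/= => /andP[h1 h2]; apply/andP; split; lra.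
  rewrite /A /= (@continuous_FTC2 _ f F)//.
  - apply: continuous_in_subspaceT => x; rewrite inE/= => /sub xab.
    exact: cf.
  - apply: (@derivable_oo_continuousW _ _ a b) => //.
    move=> x; rewrite /= !in_itv/= => /andP[h1 h2]; apply/andP; split; lra.
  - move=> x xi; apply: F'f; apply: sub; move: xi; rewrite !in_itv/=.
    by move=> /andP[/ltW-> /ltW->].
apply: (@cvg_trans _ (((F (b - e n) - F (a + e n))%:E) @[n --> \oo])).
  by apply: near_eq_cvg; near=> n; rewrite intA.
apply: cvg_EFin; first by near=> n.
have [_ Fa Fb] := dF.
apply: cvgB.
  move/cvg_at_leftP : Fb; apply; split; first by move=> n; rewrite ltrBlDr ltrDl.
  by rewrite -[X in _ --> X]subr0; apply: cvgB => //; exact: cvg_cst.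
move/cvg_at_rightP : Fa; apply; split; first by move=> n; rewrite ltrDl.
by rewrite -[X in _ --> X]addr0; apply: cvgD => //; exact: cvg_cst.
Unshelve. all: by end_near. Qed.

Lemma continuous_at_powR (r y : R) : 0 < y -> {for y, continuous (fun u : R => u `^ r)}.
Proof.
move=> y0; apply: differentiable_continuous; apply/derivable1_diffP.
by apply: derivable_powR; rewrite in_itv/= y0.
Qed.

Lemma continuous_norm_powR (q : R) : 0 < q -> continuous (fun u : R => `|u| `^ q).
Proof.
move=> q0 x; have [->|x0] := eqVneq x 0; last first.
  apply: (@continuous_comp _ _ _ (@Num.norm _ R) (fun u : R => u `^ q)).
    exact: (@norm_continuous _ R).
  by apply: continuous_at_powR; rewrite normr_gt0.
rewrite /continuous_at normr0 powR0 ?gt_eqF//.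
apply/cvgr0Pnorm_lt => e e0.
near=> u.
rewrite ger0_norm ?powR_ge0//.
have -> : e = (e `^ q^-1) `^ q by rewrite -powRrM mulVf ?gt_eqF// powRr1// ltW.
rewrite gt0_ltr_powR ?nnegrE ?powR_ge0//.
near: u; apply: (@cvgr0_norm_lt _ _ _ _ _ (fun u : R => u)) => //; exact: powR_gt0.
Unshelve. all: by end_near. Qed.

Lemma measurable_norm_powR (c r : R) : measurable_fun setT (fun u : R => `|u - c| `^ r).
Proof.
apply: (measurableT_comp (measurable_powR _)) => //.
by apply: measurableT_comp => //; exact: measurable_funB.
Qed.

(** The odd extension of a power; up to the factor [q], it is a primitive of
    [|x|^(q - 1)] on the whole line, across the singularity. *)
Definition spow (q x : R) : R := Num.sg x * `|x| `^ q.

Lemma spowN q x : spow q (- x) = - spow q x.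
Proof. by rewrite /spow sgrN normrN mulNr. Qed.

Lemma spow_ge0 q x : 0 < q -> 0 <= x -> spow q x = `|x| `^ q.
Proof.
move=> q0; rewrite le_eqVlt => /predU1P[<-|x0]; rewrite /spow.
  by rewrite sgr0 mul0r normr0 powR0 ?gt_eqF.
by rewrite gtr0_sg// mul1r.
Qed.

Lemma spow_le0 q x : 0 < q -> x <= 0 -> spow q x = - `|x| `^ q.
Proof.
by move=> q0 x0; rewrite -{1}[x]opprK spowN spow_ge0 ?oppr_ge0// normrN.
Qed.

Lemma is_derive_spow q (x : R) : 0 < q -> x != 0 ->
  is_derive x 1 (spow q) (q * `|x| `^ (q - 1)).
Proof.
move=> q0 x0; have [xl|xg|xe] := ltgtP x 0; last by rewrite xe eqxx in x0.
  have h : is_derive (- x) 1 (fun u : R => u `^ q) (q * (- x) `^ (q - 1)).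
    by apply: is_derive1_powR; rewrite oppr_gt0.
  have h2 : is_derive x 1 (fun u : R => - u) (-1) by exact: is_deriveN.
  have D := @is_derive1_comp _ (fun u : R => u `^ q) (fun u : R => - u) _ _ _ h h2.
  have D' : is_derive x 1 (fun u : R => - (- u) `^ q) (q * `|x| `^ (q - 1)).
    by apply: (is_derive_eq (is_deriveN D)); rewrite ltr0_norm// mulrN1 opprK.
  apply: near_eq_is_derive D'; near=> u.
  have u0 : u < 0 by near: u; exact: lt_nbhsl.
  by rewrite spow_le0 ?(ltW u0)// ltr0_norm.
have D : is_derive x 1 (fun u : R => u `^ q) (q * `|x| `^ (q - 1)).
  by rewrite gtr0_norm//; exact: is_derive1_powR.
apply: near_eq_is_derive D; near=> u.
have u0 : 0 < u by near: u; exact: lt_nbhsr.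
by rewrite spow_ge0 ?(ltW u0)// gtr0_norm.
Unshelve. all: by end_near. Qed.

Lemma continuous_spow q : 0 < q -> continuous (spow q).
Proof.
move=> q0 x; have [->|x0] := eqVneq x 0; last first.
  apply: differentiable_continuous; apply/derivable1_diffP.
  by have [] := is_derive_spow q0 x0.
rewrite /continuous_at {2}/spow sgr0 mul0r; apply/norm_cvg0P.
rewrite (_ : (fun u => _) = (fun u : R => `|u| `^ q)); last first.
  apply/funext => u; have [u0|u0] := leP 0 u; first by rewrite spow_ge0// ger0_norm ?powR_ge0.
  by rewrite spow_le0 ?(ltW u0)// normrN ger0_norm ?powR_ge0.
have := @continuous_norm_powR q q0 0.
by rewrite /continuous_at normr0 powR0 ?gt_eqF.
Qed.

Lemma integral_oc_split (f : R -> R) (a c b : R) : measurable_fun setT f -> a <= c -> c <= b ->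
  (\int[mu]_(u in `]a, b]) (f u)%:E =
   \int[mu]_(u in `]a, c]) (f u)%:E + \int[mu]_(u in `]c, b]) (f u)%:E)%E.
Proof.
move=> mf ac cb.
rewrite (@itv_bndbnd_setU _ _ _ (BRight c))// integral_setU//.
  by apply/measurable_EFinP; exact: measurable_funTS.
apply/disj_setPS => x [] /=; rewrite !in_itv/= => /andP[_ h] /andP[h' _].
by move: h'; rewrite ltNge h.
Qed.

(** The singularity may be an end point of the interval, which [FTC2_ge0_oc]
    allows. *)
Lemma integral_norm_powR_away (q c a b : R) : 0 < q -> a <= b -> c <= a \/ b <= c ->
  (\int[mu]_(u in `]a, b]) (`|u - c| `^ (q - 1))%:E =
   ((spow q (b - c) - spow q (a - c)) / q)%:E)%E.
Proof.
move=> q0; rewrite le_eqVlt => /predU1P[->|ab] cab.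
  by rewrite set_itv_ge ?bnd_simp// integral_set0 subrr mul0r.
have cF : continuous (fun u : R => spow q (u - c) / q).
  move=> x; apply: cvgMl; apply: (@continuous_comp _ _ _ (fun u => u - c) (spow q)).
    by apply: cvgB; [exact: cvg_id|exact: cvg_cst].
  exact: continuous_spow.
have xc x : a < x < b -> x - c != 0.
  by rewrite subr_eq0 => /andP[ax xb]; apply/eqP => xc; case: cab; rewrite -xc leNgt ?ax ?xb.
have dF x : a < x < b -> is_derive x 1 (fun u : R => spow q (u - c) / q) (`|x - c| `^ (q - 1)).
  move=> xab; have h2 : is_derive x 1 (fun u : R => u - c) (1 - 0) by exact: is_deriveB.
  have D := @is_derive1_comp _ (spow q) (fun u : R => u - c) _ _ _
    (is_derive_spow q0 (xc x xab)) h2.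
  have -> : (fun u : R => spow q (u - c) / q) = q^-1 \*: (spow q \o (fun u : R => u - c)).
    by apply/funext => u /=; rewrite mulrC.
  apply: (is_derive_eq (is_deriveZ _ D)).
  by rewrite /GRing.scale/= subr0 mulr1 mulrA mulVf ?gt_eqF// mul1r.
rewrite (@FTC2_ge0_oc _ (fun u => spow q (u - c) / q))//.
- by rewrite mulrBl.
- exact: measurable_norm_powR.
- move=> x; rewrite in_itv/= => xab.
  apply: (@continuous_comp _ _ _ (fun u => `|u - c|) (fun u : R => u `^ (q-1))).
    by apply: cvg_norm; apply: cvgB; [exact: cvg_id|exact: cvg_cst].
  by apply: continuous_at_powR; rewrite normr_gt0; exact: xc.
- split.
  + by move=> x; rewrite in_itv/= => /dF[].
  + exact/cvg_at_right_filter/cF.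
  + exact/cvg_at_left_filter/cF.
- by move=> x; rewrite in_itv/= => /dF[] _ h; rewrite derive1E.
Qed.

Lemma integral_norm_powR (q c a b : R) : 0 < q -> a <= b ->
  (\int[mu]_(u in `]a, b]) (`|u - c| `^ (q - 1))%:E =
   ((spow q (b - c) - spow q (a - c)) / q)%:E)%E.
Proof.
move=> q0 ab; have [ca|ac] := leP c a; first by apply: integral_norm_powR_away => //; left.
have [bc|cb] := leP b c; first by apply: integral_norm_powR_away => //; right.
rewrite (integral_oc_split (measurable_norm_powR _ _) (ltW ac) (ltW cb)).
rewrite !integral_norm_powR_away ?(ltW ac) ?(ltW cb)//; [|by left|by right].
rewrite subrr (spow_ge0 q0 (lexx 0)) normr0 powR0 ?gt_eqF// -EFinD; congr EFin.
by rewrite -mulrDl; congr (_ / _); ring.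
Qed.

Lemma measurable_spow_sub (q c : R) : 0 < q -> measurable_fun setT (fun u : R => spow q (c - u)).
Proof.
move=> q0; apply: (measurableT_comp (f := spow q)); last exact: measurable_funB.
exact: (continuous_measurable_fun (continuous_spow q0)).
Qed.

Lemma integral_spow (q c a b : R) : 0 < q -> a <= b ->
  (\int[mu]_(u in `]a, b]) (spow q (c - u))%:E =
   ((`|c - a| `^ (q + 1) - `|c - b| `^ (q + 1)) / (q + 1))%:E)%E.
Proof.
move=> q0 ab.
have q10 : 0 < q + 1 by rewrite addr_gt0.
have R1 a' b' : c <= a' -> a' <= b' -> (\int[mu]_(u in `]a', b']) (spow q (c - u))%:E =
   ((`|c - a'| `^ (q + 1) - `|c - b'| `^ (q + 1)) / (q + 1))%:E)%E.
  move=> ca' ab'; have cb' := le_trans ca' ab'.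
  rewrite -opprB mulNr EFinN -2!(distrC _ c).
  rewrite -2?(@spow_ge0 (q + 1)) ?subr_ge0// -integral_norm_powR// addrK -integral_ge0N//.
  apply: eq_integral => u; rewrite inE/= in_itv/= => /andP[/ltW au _].
  by rewrite distrC spow_le0 ?EFinN// subr_le0 (le_trans ca').
have L1 a' b' : b' <= c -> a' <= b' -> (\int[mu]_(u in `]a', b']) (spow q (c - u))%:E =
   ((`|c - a'| `^ (q + 1) - `|c - b'| `^ (q + 1)) / (q + 1))%:E)%E.
  move=> cb' ab'; have ca' := le_trans ab' cb'.
  rewrite -2?(@spow_ge0 (q + 1)) ?subr_ge0//.
  rewrite (_ : _ - _ = spow (q + 1) (b' - c) - spow (q + 1) (a' - c)); last first.
    by rewrite -!(opprB c) !spowN opprK addrC.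
  rewrite -integral_norm_powR// addrK.
  apply: eq_integral => u; rewrite inE/= in_itv/= => /andP[_ ub].
  by rewrite distrC spow_ge0// subr_ge0 (le_trans ub).
have [ca|ac] := leP c a; first exact: R1.
have [bc|cb] := leP b c; first exact: L1.
rewrite (integral_oc_split (measurable_spow_sub _ q0) (ltW ac) (ltW cb)).
rewrite L1 ?lexx ?(ltW ac)// R1 ?lexx ?(ltW cb)//.
by rewrite subrr normr0 powR0 ?gt_eqF// subr0 sub0r -EFinD -mulrDl.
Qed.

End kernel.

(** * Increments of fractional Brownian motion as integrals of a kernel *)

Section bilinear.
Context {R : realType} (H : R) (hH : 2^-1 < H < 1).
Local Notation mu := (@lebesgue_measure R).
Local Notation mu2 := (mu \x mu)%E.

(** The density of the covariance of the increments, that is, the mixed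
    derivative of [(|u|^(2 H) + |v|^(2 H) - |u - v|^(2 H)) / 2]. *)
Definition hkernel (z : R * R) : R := H * (2 * H - 1) * `|z.1 - z.2| `^ (2 * H - 2).

(** The covariance of the increments of fractional Brownian motion over
    [[x, y]] and [[x', y']]. *)
Definition icov (x y x' y' : R) : R :=
  2^-1 * (`|y - x'| `^ (2 * H) + `|x - y'| `^ (2 * H)
         - `|y - y'| `^ (2 * H) - `|x - x'| `^ (2 * H)).

Let H0 : 0 < H. Proof. by move: hH => /andP[h _]; lra. Qed.
Let p0 : 0 < 2 * H - 1. Proof. by move: hH => /andP[h _]; lra. Qed.
Let cH0 : 0 < H * (2 * H - 1). Proof. by rewrite mulr_gt0. Qed.
Let EqH : 2 * H - 2 = 2 * H - 1 - 1. Proof. lra. Qed.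

Lemma hkernel_ge0 z : 0 <= hkernel z.
Proof. by rewrite /hkernel mulr_ge0 ?powR_ge0// ltW. Qed.

Lemma measurable_hkernel : measurable_fun setT hkernel.
Proof.
apply: measurable_funM; first exact: measurable_cst.
apply: (measurableT_comp (measurable_powR _)) => //.
by apply: measurableT_comp => //; exact: measurable_funB.
Qed.

Lemma integral_hkernel (u x y : R) : x <= y ->
  (\int[mu]_(v in `]x, y]) (hkernel (u, v))%:E =
   (H * (spow (2 * H - 1) (y - u) - spow (2 * H - 1) (x - u)))%:E)%E.
Proof.
move=> xy; rewrite /hkernel /=.
under eq_integral do rewrite distrC EFinM.
rewrite ge0_integralZl_EFin//; last 2 first.
- by apply/measurable_EFinP; apply: measurable_funTS; exact: measurable_norm_powR.
- exact: ltW.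
rewrite EqH integral_norm_powR// -EFinM; congr EFin.
rewrite -mulrA; congr (_ * _); rewrite mulrC mulfVK// gt_eqF//.
Qed.

Lemma integral_hkernel_rect (x y x' y' : R) : x <= y -> x' <= y' ->
  (\int[mu2]_z (\1_`]x, y] z.1 * \1_`]x', y'] z.2 * hkernel z)%:E =
   (icov x y x' y')%:E)%E.
Proof.
move=> xy xy'.
rewrite fubini_tonelli1//; last 2 first.
- apply/measurable_EFinP; apply: measurable_funM; last exact: measurable_hkernel.
  by apply: measurable_funM; apply: measurableT_comp.
- by move=> z; rewrite lee_fin mulr_ge0 ?hkernel_ge0// !indicE mulr_ge0.
rewrite /fubini_F /=.
transitivity (\int[mu]_(u in `]x, y]) (H * (spow (2 * H - 1) (y' - u) - spow (2 * H - 1) (x' - u)))%:E)%E.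
  rewrite [RHS]integral_mkcond; apply: eq_integral => u _.
  rewrite patchE; case: ifPn => ux; last first.
    under eq_integral do rewrite indicE (negbTE ux) !mul0r.
    by rewrite integral0.
  rewrite -integral_hkernel// [RHS]integral_mkcond; apply: eq_integral => v _.
  by rewrite patchE !indicE ux mul1r; case: ifPn => vx; rewrite ?mul1r ?mul0r.
have ms c : measurable_fun setT (fun u : R => (spow (2 * H - 1) (c - u))).
  exact: measurable_spow_sub.
have is_ c : mu.-integrable `]x, y] (fun u : R => (spow (2 * H - 1) (c - u))%:E).
  by apply: (integrable_fin_integral _ _ (integral_spow _ p0 xy)) => //; apply: measurable_funTS; exact: ms.
under eq_integral do rewrite EFinM EFinB.
rewrite integralZl//; last exact: integrableB.
rewrite integralB// !integral_spow// -EFinB -EFinM; congr EFin.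
rewrite subrK /icov (distrC y') (distrC y') (distrC x') (distrC x').
field; rewrite gt_eqF//.
Qed.

(** For fixed [u], the part of the inner integral where [|u - v| <= 1] is at
    most [Mq] times the integral [2 H] of the kernel; on the rest the kernel
    is at most [1], as its exponent is negative. *)
Lemma hkernel_bound (p q : R -> R) (Np Mq Nq : R) :
  measurable_fun setT p -> measurable_fun setT q ->
  (forall u, 0 <= p u) -> (forall u, 0 <= q u <= Mq) ->
  (\int[mu]_u (p u)%:E <= Np%:E)%E -> (\int[mu]_u (q u)%:E <= Nq%:E)%E ->
  (\int[mu2]_z (p z.1 * q z.2 * hkernel z)%:E <= (2 * Np * (Mq + Nq))%:E)%E.
Proof.
move=> mp mq p_ge0 q_bnd ip iq.
have q_ge0 u : 0 <= q u by case/andP: (q_bnd u).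
have Mq0 : 0 <= Mq by case/andP: (q_bnd 0) => h; exact: le_trans.
have Np0 : 0 <= Np.
  by rewrite -lee_fin (le_trans _ ip)//; apply: integral_ge0 => u _; rewrite lee_fin.
have Nq0 : 0 <= Nq.
  by rewrite -lee_fin (le_trans _ iq)//; apply: integral_ge0 => u _; rewrite lee_fin.
have mqk u : measurable_fun setT (fun v => q v * hkernel (u, v)).
  apply: measurable_funM => //.
  by apply: (measurableT_comp measurable_hkernel).
have inner u : (\int[mu]_v (q v * hkernel (u, v))%:E <= (2 * (Mq + Nq))%:E)%E.
  pose D := `]u - 1, u + 1]%classic : set R.
  have mD : measurable D by exact: measurable_itv.
  apply: (@le_trans _ _ (\int[mu]_v ((Mq * (\1_D v * hkernel (u, v)))%:E + (q v)%:E))%E).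
    apply: ge0_le_integral => //.
    - by move=> v _; rewrite lee_fin mulr_ge0// hkernel_ge0.
    - by apply/measurable_EFinP; exact: mqk.
    - apply: emeasurable_funD; apply/measurable_EFinP => //.
      apply: measurable_funM => //; apply: measurable_funM => //.
      by apply: (measurableT_comp measurable_hkernel).
    - move=> v _; rewrite -EFinD lee_fin indicE.
      have [vD|vD] := boolP (v \in D).
        rewrite mul1r -[leLHS]addr0 lerD// ler_wpM2r ?hkernel_ge0//.
        by case/andP: (q_bnd v).
      rewrite mul0r mulr0 add0r -[leRHS]mulr1 ler_wpM2l// /hkernel /=.
      have h1 : 1 <= `|u - v|.
        rewrite leNgt; apply/negP => h; move/negP: vD; apply.
        rewrite inE /D /= in_itv/=; move: h; rewrite ltr_norml => /andP[? ?].
        by apply/andP; split; lra.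
      have hc : H * (2 * H - 1) <= 1.
        by move: hH p0 => /andP[h2 h3] h4; rewrite mulr_ile1//; lra.
      rewrite mulr_ile1 ?powR_ge0 ?(ltW cH0)//.
      rewrite -[leRHS](powRr0 `|u - v|); apply: ler_powR => //.
      by move: hH => /andP[? ?]; lra.
  rewrite ge0_integralD//; last 4 first.
  - by move=> v _; rewrite lee_fin mulr_ge0// mulr_ge0 ?indicE ?hkernel_ge0.
  - apply/measurable_EFinP; apply: measurable_funM => //; apply: measurable_funM => //.
    by apply: (measurableT_comp measurable_hkernel).
  - by move=> v _; rewrite lee_fin.
  - exact/measurable_EFinP.
  rewrite mulrDr EFinD; apply: leeD; last first.
    by apply: (le_trans iq); rewrite lee_fin; lra.
  under eq_integral do rewrite EFinM.
  rewrite ge0_integralZl_EFin//; last 2 first.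
  - by move=> v _; rewrite lee_fin mulr_ge0// hkernel_ge0.
  - apply/measurable_EFinP; apply: measurable_funM => //.
    by apply: (measurableT_comp measurable_hkernel).
  have -> : (\int[mu]_v (\1_D v * hkernel (u, v))%:E = \int[mu]_(v in D) (hkernel (u, v))%:E)%E.
    rewrite [RHS]integral_mkcond; apply: eq_integral => v _.
    by rewrite patchE indicE; case: ifPn => _; rewrite ?mul1r ?mul0r.
  rewrite integral_hkernel; last lra.
  rewrite -EFinM lee_fin /spow.
  rewrite addrAC subrr add0r sgr1 normr1 powR1 mul1r.
  rewrite addrAC subrr add0r sgrN1 normrN1 powR1 mulr1 opprK.
  have h1 : Mq * H <= Mq by rewrite ler_piMr//; case/andP: hH => _ /ltW.
  lra.
rewrite fubini_tonelli1//; last 2 first.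
- apply/measurable_EFinP; apply: measurable_funM; last exact: measurable_hkernel.
  by apply: measurable_funM; apply: measurableT_comp.
- by move=> z; rewrite lee_fin mulr_ge0 ?hkernel_ge0// mulr_ge0.
rewrite /fubini_F /=.
apply: (@le_trans _ _ (\int[mu]_u ((2 * (Mq + Nq))%:E * (p u)%:E))%E).
  apply: ge0_le_integral => //.
  - by move=> u _; apply: integral_ge0 => v _; rewrite lee_fin mulr_ge0 ?hkernel_ge0// mulr_ge0.
  - apply: (@measurable_fun_fubini_tonelli_F _ _ _ _ _ mu (fun z => (p z.1 * q z.2 * hkernel z)%:E)).
      apply/measurable_EFinP; apply: measurable_funM; last exact: measurable_hkernel.
      by apply: measurable_funM; apply: measurableT_comp.
    by move=> z; rewrite lee_fin mulr_ge0 ?hkernel_ge0// mulr_ge0.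
  - by apply: measurable_funeM; exact/measurable_EFinP.
  - move=> u _.
    under eq_integral do rewrite -mulrA EFinM.
    rewrite ge0_integralZl_EFin//; last 2 first.
    + by move=> v _; rewrite lee_fin mulr_ge0// hkernel_ge0.
    + by apply/measurable_EFinP; exact: mqk.
    by rewrite muleC lee_wpmul2r ?lee_fin.
rewrite ge0_integralZl_EFin//; last 3 first.
- by move=> v _; rewrite lee_fin.
- exact/measurable_EFinP.
- by rewrite mulr_ge0// addr_ge0.
rewrite (_ : 2 * Np * (Mq + Nq) = (2 * (Mq + Nq)) * Np); last by ring.
rewrite [leRHS]EFinM; apply: lee_wpmul2l => //; rewrite lee_fin.
by rewrite mulr_ge0// addr_ge0.
Qed.

(** Turns quadratic forms in the increments into integrals, in which step
    functions over different partitions are compared pointwise. *)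
Lemma icov_form (I J : finType) (M : I -> J -> R) (x y : I -> R) (x' y' : J -> R) :
  (forall i, x i <= y i) -> (forall j, x' j <= y' j) ->
  mu2.-integrable setT (fun z => ((\sum_i \sum_j
     M i j * (\1_`]x i, y i] z.1 * \1_`]x' j, y' j] z.2)) * hkernel z)%:E) /\
  (\int[mu2]_z ((\sum_i \sum_j
     M i j * (\1_`]x i, y i] z.1 * \1_`]x' j, y' j] z.2)) * hkernel z)%:E =
  (\sum_i \sum_j M i j * icov (x i) (y i) (x' j) (y' j))%:E)%E.
Proof.
move=> xy xy'.
pose f i j z := \1_`]x i, y i] z.1 * \1_`]x' j, y' j] z.2 * hkernel z.
have mf i j : measurable_fun setT (EFin \o f i j).
  apply/measurable_EFinP; apply: measurable_funM; last exact: measurable_hkernel.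
  by apply: measurable_funM; apply: measurableT_comp.
have If i j : mu2.-integrable setT (EFin \o f i j).
  apply: (integrable_fin_integral _ _ (integral_hkernel_rect (xy i) (xy' j))) => //.
  by apply/measurable_EFinP; exact: mf.
have IMf i j : mu2.-integrable setT (fun z => ((M i j)%:E * (f i j z)%:E)%E).
  by apply: integrableZl => //; exact: If.
have E z : ((\sum_i \sum_j
     M i j * (\1_`]x i, y i] z.1 * \1_`]x' j, y' j] z.2)) * hkernel z)%:E =
   (\sum_i \sum_j ((M i j)%:E * (f i j z)%:E))%E.
  rewrite mulr_suml -sumEFin; apply: eq_bigr => i _.
  rewrite mulr_suml -sumEFin; apply: eq_bigr => j _.
  by rewrite -EFinM /f !mulrA.
split.
  rewrite (_ : (fun z => _) = fun z => (\sum_i \sum_j ((M i j)%:E * (f i j z)%:E))%E); last first.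
    by apply/funext => z; exact: E.
  by apply: integrable_sum => // i _; apply: integrable_sum.
under eq_integral do rewrite E.
rewrite integral_sum//; last by move=> i; apply: integrable_sum.
rewrite -sumEFin; apply: eq_bigr => i _.
rewrite integral_sum//.
rewrite -sumEFin; apply: eq_bigr => j _.
by rewrite integralZl ?[X in (_ * X)%E]integral_hkernel_rect//; exact: If.
Qed.

(** The coefficients enter only through a pointwise bound on their step
    function. The estimate is therefore uniform in the partitions and applies
    to conditional variances and to mean squares alike. *)
Lemma icov_form_bound (I J : finType) (M : I -> J -> R) (x y : I -> R) (x' y' : J -> R)
  (p q : R -> R) (Np Mq Nq : R) :
  (forall i, x i <= y i) -> (forall j, x' j <= y' j) ->
  measurable_fun setT p -> measurable_fun setT q ->
  (forall u, 0 <= p u) -> (forall u, 0 <= q u <= Mq) ->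
  (\int[mu]_u (p u)%:E <= Np%:E)%E -> (\int[mu]_u (q u)%:E <= Nq%:E)%E ->
  (forall u v, `|\sum_i \sum_j M i j * (\1_`]x i, y i] u * \1_`]x' j, y' j] v)|
     <= p u * q v) ->
  `|\sum_i \sum_j M i j * icov (x i) (y i) (x' j) (y' j)| <= 2 * Np * (Mq + Nq).
Proof.
move=> xy xy' mp mq p0' q0 ip iq Mpq.
have [I1 I2] := icov_form M xy xy'.
rewrite -lee_fin [leLHS](_ : _ = `|(\sum_i \sum_j M i j * icov (x i) (y i) (x' j) (y' j))%:E|%E)// -I2.
apply: (le_trans (le_abse_integral _ _ (measurable_int _ I1))) => //.
apply: le_trans (hkernel_bound mp mq p0' q0 ip iq).
apply: ge0_le_integral => //.
- by apply: measurableT_comp => //; exact: (measurable_int mu2 I1).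
- apply/measurable_EFinP; apply: measurable_funM; last exact: measurable_hkernel.
  by apply: measurable_funM; apply: measurableT_comp.
- move=> z _; rewrite lee_fin normrM (ger0_norm (hkernel_ge0 z)).
  by rewrite ler_wpM2r ?hkernel_ge0.
Qed.

End bilinear.

(** * Square integrable random variables *)

Section square_integrable.
Context {d : measure_display} {T : measurableType d} {R : realType}.
Variable P : probability T R.

Definition sqint (f : T -> R) : Prop :=
  measurable_fun setT f /\ (\int[P]_x (f x ^+ 2)%:E < +oo)%E.

Definition ip (f g : T -> R) : R := fine (\int[P]_x (f x * g x)%:E).

Lemma sqint_integrable_sqr f : sqint f -> P.-integrable setT (fun x => (f x ^+ 2)%:E).
Proof.
move=> [mf f2]; apply/integrableP; split.
  by apply/measurable_EFinP; exact: measurable_funX.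
apply: le_lt_trans f2; apply: ge0_le_integral => //.
- by apply: measurableT_comp => //; apply/measurable_EFinP; exact: measurable_funX.
- by apply/measurable_EFinP; exact: measurable_funX.
- by move=> x _; rewrite /= ger0_norm// sqr_ge0.
Qed.

Lemma sqint_mul_integrable f g : sqint f -> sqint g ->
  P.-integrable setT (fun x => (f x * g x)%:E).
Proof.
move=> hf hg; have [mf _] := hf; have [mg _] := hg.
apply: (le_integrable _ _ _ (integrableD measurableT (sqint_integrable_sqr hf) (sqint_integrable_sqr hg))) => //.
  by apply/measurable_EFinP; exact: measurable_funM.
move=> x _; rewrite /= lee_fin normrM.
rewrite [leRHS]ger0_norm ?addr_ge0 ?sqr_ge0//.
rewrite -(real_normK (num_real (f x))) -(real_normK (num_real (g x))).
have := sqr_ge0 (`|f x| - `|g x|); have := mulr_ge0 (normr_ge0 (f x)) (normr_ge0 (g x)); nra.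
Qed.

Lemma ipE f g : sqint f -> sqint g -> (\int[P]_x (f x * g x)%:E = (ip f g)%:E)%E.
Proof.
by move=> hf hg; rewrite fineK// integrable_fin_num//; exact: sqint_mul_integrable.
Qed.

Lemma sqint_cst c : sqint (cst c).
Proof.
split => //; rewrite (_ : (fun x => _) = cst (c ^+ 2)%:E)// integral_prob_cst.
exact: ltry.
Qed.

Lemma sqint_integrable f : sqint f -> P.-integrable setT (EFin \o f).
Proof.
move=> hf; have := sqint_mul_integrable hf (sqint_cst 1).
by apply: eq_integrable => // x _ /=; rewrite mulr1.
Qed.

Lemma sqintZ a f : sqint f -> sqint (fun x => a * f x).
Proof.
move=> hf; have [mf _] := hf; split; first exact: measurable_funM.
under eq_integral do rewrite exprMn EFinM.
rewrite integralZl//; last exact: sqint_integrable_sqr.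
have := integrable_fin_num measurableT (sqint_integrable_sqr hf).
by case: (\int[P]_x (f x ^+ 2)%:E)%E => //= r _; rewrite -EFinM ltry.
Qed.

Lemma sqintD f g : sqint f -> sqint g -> sqint (fun x => f x + g x).
Proof.
move=> hf hg; have [mf _] := hf; have [mg _] := hg; split.
  exact: measurable_funD.
have i1 := sqint_integrable_sqr hf; have i2 := sqint_integrable_sqr hg.
have i3 := sqint_mul_integrable hf (sqintZ 2 hg).
have -> : (\int[P]_x ((f x + g x) ^+ 2)%:E = \int[P]_x ((f x ^+ 2)%:E + (g x ^+ 2)%:E + (f x * (2 * g x))%:E))%E.
  by apply: eq_integral => x _; rewrite -!EFinD; congr EFin; ring.
have i4 := integrableD measurableT (integrableD measurableT i1 i2) i3.
have := integrable_fin_num measurableT i4.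
by rewrite ltey_eq => ->.
Qed.

Lemma sqint_sum (I : Type) (r : seq I) (f : I -> T -> R) :
  (forall i, sqint (f i)) -> sqint (fun x => \sum_(i <- r) f i x).
Proof.
move=> hf; elim: r => [|i r IH].
  rewrite (_ : (fun x => _) = cst 0); first exact: sqint_cst.
  by apply/funext => x; rewrite big_nil.
rewrite (_ : (fun x => _) = fun x => f i x + \sum_(i <- r) f i x); first exact: sqintD.
by apply/funext => x; rewrite big_cons.
Qed.

Lemma sqintB f g : sqint f -> sqint g -> sqint (fun x => f x - g x).
Proof.
move=> hf hg; rewrite (_ : (fun x => _) = fun x => f x + (-1) * g x).
  by apply: sqintD => //; exact: sqintZ.
by apply/funext => x; rewrite mulN1r.
Qed.

Lemma ip_sum (I J : Type) (r : seq I) (s : seq J) (a : I -> R) (b : J -> R)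
    (f : I -> T -> R) (g : J -> T -> R) :
  (forall i, sqint (f i)) -> (forall j, sqint (g j)) ->
  (\int[P]_x ((\sum_(i <- r) a i * f i x) * (\sum_(j <- s) b j * g j x))%:E =
  (\sum_(i <- r) \sum_(j <- s) a i * b j * ip (f i) (g j))%:E)%E.
Proof.
move=> hf hg.
under eq_integral => x _.
  rewrite mulr_suml -sumEFin; under eq_bigr => i _.
    rewrite mulr_sumr -sumEFin; under eq_bigr => j _.
      rewrite mulrACA EFinM; over.
    over.
  over.
rewrite integral_sum//; last first.
  move=> i; apply: integrable_sum => // j _; apply: integrableZl => //.
  exact: sqint_mul_integrable.
rewrite -sumEFin; apply: eq_bigr => i _.
rewrite integral_sum//; last first.
  by move=> j; apply: integrableZl => //; exact: sqint_mul_integrable.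
rewrite -sumEFin; apply: eq_bigr => j _.
rewrite integralZl//; last exact: sqint_mul_integrable.
by rewrite ipE.
Qed.

Lemma ip_ge0 f : 0 <= ip f f.
Proof. by apply: fine_ge0; apply: integral_ge0 => x _; rewrite lee_fin -expr2 sqr_ge0. Qed.

(** The discriminant of the nonnegative polynomial [|x f + g|^2] in [x]. *)
Lemma ip_cauchy_schwarz f g : sqint f -> sqint g -> `|ip f g| <= Num.sqrt (ip f f) * Num.sqrt (ip g g).
Proof.
move=> hf hg.
have key (x : R) : 0 <= ip f f * x ^+ 2 + 2 * ip f g * x + ip g g.
  pose F (b : bool) := if b then f else g.
  pose a (b : bool) : R := if b then x else 1.
  have hF b : sqint (F b) by case: b.
  have := ip_sum [:: true; false] [:: true; false] a a hF hF.
  rewrite !big_cons !big_nil /= !addr0.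
  set L := (\int[P]_x _)%E => HL.
  have : (0 <= L)%E by apply: integral_ge0 => w _; rewrite lee_fin -expr2 sqr_ge0.
  rewrite HL lee_fin.
  have -> : ip g f = ip f g by congr fine; apply: eq_integral => w _; rewrite mulrC.
  by move=> h; apply: le_trans h _; rewrite le_eqVlt; apply/orP; left; apply/eqP; ring.
rewrite -sqrtrM ?ip_ge0// -sqrtr_sqr; apply: ler_wsqrtr.
have a0 := ip_ge0 f; have c0 := ip_ge0 g.
have [a00|a1] := eqVneq (ip f f) 0.
  rewrite a00 mul0r; move: key; rewrite a00 => key.
  have [->|b0] := eqVneq (ip f g) 0; first by rewrite expr0n.
  have := key (- (ip g g + 1) / (2 * ip f g)).
  rewrite mul0r add0r mulrC -mulrA mulVf ?mulf_neq0// mulr1; lra.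
have ap : 0 < ip f f by rewrite lt_neqAle eq_sym a1.
have := key (- ip f g / ip f f).
have -> : ip f f * (- ip f g / ip f f) ^+ 2 + 2 * ip f g * (- ip f g / ip f f) + ip g g
  = (ip f f * ip g g - ip f g ^+ 2) / ip f f by field.
by rewrite pmulr_lge0 ?invr_gt0// subr_ge0.
Qed.

Lemma sqint_Lfun f : sqint f -> f \in Lfun P 2%:E.
Proof.
move=> [mf f2]; rewrite inE; apply/andP; split; rewrite inE//=.
rewrite /finite_norm unlock /Lnorm.
rewrite poweR_lty//.
apply: le_lt_trans f2; rewrite le_eqVlt; apply/orP; left; apply/eqP.
by apply: eq_integral => x _ /=; rewrite powR_mulrn// real_normK// num_real.
Qed.

Lemma LnormE f : ('N[P]_2%:E[EFin \o f] = (\int[P]_x (f x ^+ 2)%:E) `^ 2^-1)%E.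
Proof.
rewrite unlock /Lnorm; congr (_ `^ _)%E.
by apply: eq_integral => x _ /=; rewrite powR_mulrn// real_normK// num_real.
Qed.

End square_integrable.

Section product_integral.
Context {d1 d2 : measure_display} {T1 : measurableType d1} {T2 : measurableType d2}
  {R : realType} (P1 : probability T1 R) (P2 : probability T2 R).

Lemma integrable_tensor (h : T1 -> R) (k : T2 -> R) :
  P1.-integrable setT (EFin \o h) -> P2.-integrable setT (EFin \o k) ->
  (P1 \x P2)%E.-integrable setT (fun z => (h z.1 * k z.2)%:E) /\
  (\int[P1 \x P2]_z (h z.1 * k z.2)%:E = \int[P1]_x (h x)%:E * \int[P2]_y (k y)%:E)%E.
Proof.
move=> ih ik.
have mh : measurable_fun setT h by apply/measurable_EFinP; case/integrableP: ih.
have mk : measurable_fun setT k by apply/measurable_EFinP; case/integrableP: ik.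
have mhk : measurable_fun setT (fun z : T1 * T2 => (h z.1 * k z.2)%:E).
  by apply/measurable_EFinP; apply: measurable_funM; apply: measurableT_comp.
have I : (P1 \x P2)%E.-integrable setT (fun z => (h z.1 * k z.2)%:E).
  rewrite integrable12ltyP//.
  have [_ +] := integrableP _ _ _ ih; have [_ +] := integrableP _ _ _ ik => Ik Ih.
  under eq_integral => x _.
    under eq_integral => y _ do rewrite /= normrM EFinM.
    rewrite ge0_integralZl_EFin//; last first.
      by apply/measurable_EFinP; apply: measurableT_comp.
    over.
  rewrite ge0_integralZr//; last 2 first.
  - by apply/measurable_EFinP; apply: measurableT_comp.
  - exact: integral_ge0.
  by rewrite lte_mul_pinfty ?integral_ge0// ge0_fin_numE ?integral_ge0.
split => //.
rewrite -integral12_prod_meas1// /fubini_F /=.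
under eq_integral => x _.
  under eq_integral => y _ do rewrite EFinM.
  rewrite integralZl//; over.
have fk := integrable_fin_num measurableT ik.
by rewrite /= -(fineK fk) integralZr.
Qed.

End product_integral.

Section inner_product.
Context {d : measure_display} {T : measurableType d} {R : realType}.
Variable P : probability T R.
Local Notation sqint := (sqint P).
Local Notation ip := (ip P).

Lemma ipC f g : ip f g = ip g f.
Proof. by rewrite /ip; under eq_integral do rewrite mulrC. Qed.

Lemma ipBl f g h : sqint f -> sqint g -> sqint h ->
  ip (fun w => f w - g w) h = ip f h - ip g h.
Proof.
move=> sf sg sh; apply: EFin_inj; rewrite -(ipE (sqintB sf sg) sh).
under eq_integral do rewrite mulrBl EFinB.
by rewrite integralB ?ipE//; exact: sqint_mul_integrable.
Qed.

Lemma ipBr f g h : sqint f -> sqint g -> sqint h ->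
  ip h (fun w => f w - g w) = ip h f - ip h g.
Proof. by move=> sf sg sh; rewrite ipC ipBl// !(ipC h). Qed.

Lemma ip_le f a : sqint f -> (\int[P]_w (f w ^+ 2)%:E <= a%:E)%E -> ip f f <= a.
Proof. by move=> sf; rewrite -lee_fin -ipE//; under eq_integral do rewrite expr2. Qed.

Lemma ip_bound f g a b : sqint f -> sqint g -> 0 <= a -> 0 <= b ->
  ip f f <= a ^+ 2 -> ip g g <= b ^+ 2 -> `|ip f g| <= a * b.
Proof.
move=> sf sg a0 b0 fa gb; apply: le_trans (ip_cauchy_schwarz sf sg) _.
have H x c : 0 <= c -> x <= c ^+ 2 -> Num.sqrt x <= c.
  by move=> c0 xc; rewrite -(ger0_norm c0) -sqrtr_sqr ler_wsqrtr.
by apply: ler_pM; rewrite ?sqrtr_ge0 ?H.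
Qed.

Lemma ip_sub_bound f g a b : sqint f -> sqint g -> 0 <= a -> 0 <= b ->
  ip f f <= a ^+ 2 -> ip g g <= b ^+ 2 ->
  ip (fun w => f w - g w) (fun w => f w - g w) <= (a + b) ^+ 2.
Proof.
move=> sf sg a0 b0 fa gb.
have sfg := sqintB sf sg.
rewrite ipBl// !ipBr// (ipC g f).
have := ip_bound sf sg a0 b0 fa gb; rewrite ler_norml => /andP[h _].
rewrite sqrrD; lra.
Qed.

Lemma ip_diff_bound f f' g g' a b a' b' : sqint f -> sqint f' -> sqint g -> sqint g' ->
  0 <= a -> 0 <= b -> 0 <= a' -> 0 <= b' ->
  ip (fun w => f w - f' w) (fun w => f w - f' w) <= a ^+ 2 -> ip g g <= b ^+ 2 ->
  ip f' f' <= a' ^+ 2 -> ip (fun w => g w - g' w) (fun w => g w - g' w) <= b' ^+ 2 ->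
  `|ip f g - ip f' g'| <= a * b + a' * b'.
Proof.
move=> sf sf' sg sg' a0 b0 a'0 b'0 h1 h2 h3 h4.
have -> : ip f g - ip f' g' =
    ip (fun w => f w - f' w) g + ip f' (fun w => g w - g' w).
  by rewrite ipBl// ipBr//; ring.
apply: (le_trans (ler_normD _ _)); apply: lerD.
  by apply: ip_bound => //; exact: sqintB.
by apply: ip_bound => //; exact: sqintB.
Qed.

Lemma ip_cvg (Z W : nat -> T -> R) Y V :
  (forall n, sqint (Z n)) -> (forall n, sqint (W n)) -> sqint Y -> sqint V ->
  ip (fun w => Z n w - Y w) (fun w => Z n w - Y w) @[n --> \oo] --> 0 ->
  ip (fun w => W n w - V w) (fun w => W n w - V w) @[n --> \oo] --> 0 ->
  ip (Z n) (W n) @[n --> \oo] --> ip Y V.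
Proof.
move=> sZ sW sY sV; set p := fun n : nat => ip _ _; set q := fun n : nat => ip _ _.
move=> p0 q0.
have sq0 (r : nat -> R) : r n @[n --> \oo] --> 0 -> Num.sqrt (r n) @[n --> \oo] --> 0.
  by move=> r0; rewrite -sqrtr0; apply: continuous_cvg => //; exact: sqrt_continuous.
have bnd n : `|ip Y V - ip (Z n) (W n)| <=
    Num.sqrt (p n) * (Num.sqrt (q n) + Num.sqrt (ip V V)) +
    Num.sqrt (ip Y Y) * Num.sqrt (q n).
  have s1 := sqintB (sZ n) sY; have s2 := sqintB (sW n) sV.
  rewrite distrC; have sqE f : ip f f <= Num.sqrt (ip f f) ^+ 2 by rewrite sqr_sqrtr ?ip_ge0.
  apply: ip_diff_bound => //; rewrite ?addr_ge0 ?sqrtr_ge0//.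
  have sV' := sqintZ (-1) sV.
  have eV : ip (fun w => -1 * V w) (fun w => -1 * V w) = ip V V.
    by rewrite /ip; under eq_integral do rewrite !mulN1r mulrNN.
  have := ip_sub_bound s2 sV' (sqrtr_ge0 _) (sqrtr_ge0 _) (sqE _) (sqE _).
  rewrite eV; congr (_ <= _); rewrite /ip; congr fine; apply: eq_integral => w _; congr EFin; ring.
apply/cvgrPdist_le => e e0.
have lim0 : Num.sqrt (p n) * (Num.sqrt (q n) + Num.sqrt (ip V V)) +
    Num.sqrt (ip Y Y) * Num.sqrt (q n) @[n --> \oo] -->
    0 * (0 + Num.sqrt (ip V V)) + Num.sqrt (ip Y Y) * 0.
  apply: cvgD; apply: cvgM.
  - exact: sq0.
  - by apply: cvgD; [exact: sq0|exact: cvg_cst].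
  - exact: cvg_cst.
  - exact: sq0.
rewrite mul0r mulr0 addr0 in lim0.
near=> n; apply: (le_trans (bnd n)); near: n.
exact: (cvgr_le _ lim0).
Unshelve. all: by end_near. Qed.

End inner_product.

(** * Second moments of fractional Brownian motion *)

Section fbm.
Context {d : measure_display} {T : measurableType d} {R : realType}.
Variables (P : probability T R) (H : R) (B : R -> {RV P >-> R}).
Hypothesis hB : fractional_brownian_motion H B.

Lemma fbm_integral_mul t s : (\int[P]_w (B t w * B s w)%:E =
  (2^-1 * (`|t| `^ (2 * H) + `|s| `^ (2 * H) - `|t - s| `^ (2 * H)))%:E)%E.
Proof.
rewrite -(fbm_covariance hB) [in RHS]unlock !(fbm_centered hB) unlock /=.
by apply: eq_integral => w _; rewrite -[RHS]/(((B t w - 0) * (B s w - 0))%:E) !subr0.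
Qed.

Lemma fbm_sqint t : sqint P (B t).
Proof.
split => //; under eq_integral do rewrite expr2.
by rewrite fbm_integral_mul ltry.
Qed.

Definition fbm_incr (x y : R) (w : T) : R := B y w - B x w.

Lemma fbm_incr_sqint x y : sqint P (fbm_incr x y).
Proof. by apply: sqintB; exact: fbm_sqint. Qed.

Lemma fbm_incr_mean x y : (\int[P]_w (fbm_incr x y w)%:E = 0)%E.
Proof.
rewrite /fbm_incr; under eq_integral do rewrite EFinB.
rewrite integralB//; [|exact: (sqint_integrable (fbm_sqint _))..].
have E t : (\int[P]_w (B t w)%:E = 0)%E by have := fbm_centered hB t; rewrite unlock.
by rewrite !E sube0.
Qed.

(** Expanding the product, the terms that depend on a single time cancel
    out. *)
Lemma fbm_incr_ip x y x' y' : ip P (fbm_incr x y) (fbm_incr x' y') = icov H x y x' y'.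
Proof.
pose f (x y : R) (b : bool) : T -> R := if b then B y else B x.
pose a (b : bool) : R := if b then 1 else -1.
have hf x0 y0 b : sqint P (f x0 y0 b) by case: b; exact: fbm_sqint.
have := ip_sum [:: true; false] [:: true; false] a a (hf x y) (hf x' y').
have fE x0 y0 w : \sum_(b <- [:: true; false]) a b * f x0 y0 b w = fbm_incr x0 y0 w.
  by rewrite !big_cons big_nil /= addr0 mul1r mulN1r.
under eq_integral do rewrite !fE.
rewrite (ipE (fbm_incr_sqint _ _) (fbm_incr_sqint _ _)) => -[->].
have E t s : ip P (B t) (B s) = 2^-1 * (`|t| `^ (2 * H) + `|s| `^ (2 * H) - `|t - s| `^ (2 * H)).
  by rewrite /ip fbm_integral_mul.
rewrite !big_cons !big_nil /= !addr0 !E /icov; ring.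
Qed.

End fbm.

(** * Independent copies *)

Section independent_copies.
Context {d : measure_display} {T : measurableType d} {R : realType}.
Variable P : probability T R.

(** [W] stands for a copy of [V] independent of [A]. The sequences of
    increments considered below are known through their cylinders only, and
    Dynkin's theorem extends independence from these. *)
Lemma independent_copy_pi_lambda (E : Type) (G : set (set E)) (A : set T)
    (V W : T -> E) :
  setI_closed G -> measurable A ->
  (forall C, G C -> [/\ measurable (V @^-1` C), measurable (W @^-1` C) &
     P (A `&` V @^-1` C) = (P A * P (W @^-1` C))%E]) ->
  forall C, <<s G >> C -> [/\ measurable (V @^-1` C), measurable (W @^-1` C) &
     P (A `&` V @^-1` C) = (P A * P (W @^-1` C))%E].
Proof.
move=> GI mA HG.
apply: (lambda_system_subset GI _ HG); last by move=> X _ x _.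
split => //.
- by rewrite !preimage_setT setIT probability_setT mule1; split.
- move=> C C' C'C [mV mW E1] [mV' mW' E2].
  rewrite (_ : V @^-1` (C `\` C') = (V @^-1` C) `\` (V @^-1` C'))//.
  rewrite (_ : W @^-1` (C `\` C') = (W @^-1` C) `\` (W @^-1` C'))//.
  split; [exact: measurableD|exact: measurableD|].
  rewrite setIDA measureD//; last 2 first.
  + exact: measurableI.
  + by rewrite (le_lt_trans (probability_le1 _ _)) ?ltry//; exact: measurableI.
  rewrite measureD//; last first.
    by rewrite (le_lt_trans (probability_le1 _ _)) ?ltry.
  have sV : V @^-1` C' `<=` V @^-1` C by move=> x; exact: C'C.
  have sW : W @^-1` C' `<=` W @^-1` C by move=> x; exact: C'C.
  rewrite -setIA (setIidr sV) (setIidr sW).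
  transitivity (P A * P (W @^-1` C) - P A * P (W @^-1` C'))%E; first by congr (_ - _)%E.
  rewrite muleBr//.
    exact: fin_num_measure.
  by rewrite fin_num_adde_defr// fin_num_measure.
- move=> F ndF HF; rewrite !preimage_bigcup.
  have mV i : measurable (V @^-1` F i) by case: (HF i).
  have mW i : measurable (W @^-1` F i) by case: (HF i).
  have EF i : P (A `&` V @^-1` F i) = (P A * P (W @^-1` F i))%E by case: (HF i).
  split; [exact: bigcup_measurable|exact: bigcup_measurable|].
  have c1 : P (A `&` V @^-1` F i) @[i --> \oo] --> P (A `&` \bigcup_i V @^-1` F i).
    rewrite setI_bigcupr; apply: nondecreasing_cvg_mu => //.
    + by move=> i; exact: measurableI.
    + by apply: bigcup_measurable => i _; exact: measurableI.
    + apply/nondecreasing_seqP => n; rewrite subsetEset; apply: setIS => x.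
      by have /nondecreasing_seqP/(_ n) := ndF; rewrite subsetEset; apply.
  have c2 : (P A * P (W @^-1` F i))%E @[i --> \oo] --> (P A * P (\bigcup_i W @^-1` F i))%E.
    apply: cvgeZl; first exact: fin_num_measure.
    apply: nondecreasing_cvg_mu => //.
    + exact: bigcup_measurable.
    + apply/nondecreasing_seqP => n; rewrite subsetEset => x.
      by have /nondecreasing_seqP/(_ n) := ndF; rewrite subsetEset; apply.
  apply: (cvg_unique _ c1) => //.
  by apply: cvg_trans c2; apply: near_eq_cvg; near=> i; exact/esym/EF.
Unshelve. all: by end_near. Qed.

(** The law of [(U, V)] is the product of the laws of [U] and [W], so that
    Tonelli's theorem applies. *)
Lemma independent_copy_integral d1 d2 (E1 : measurableType d1) (E2 : measurableType d2)
    (U : T -> E1) (V W : T -> E2) (Phi : E1 * E2 -> \bar R) :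
  measurable_fun setT U -> measurable_fun setT V -> measurable_fun setT W ->
  (forall A B, measurable A -> measurable B ->
     P (U @^-1` A `&` V @^-1` B) = (P (U @^-1` A) * P (W @^-1` B))%E) ->
  measurable_fun setT Phi -> (forall z, 0 <= Phi z)%E ->
  (\int[P]_w Phi (U w, V w) = \int[P]_w \int[P]_w' Phi (U w, W w'))%E.
Proof.
move=> mU mV mW UV mPhi Phi0.
pose UVm w := (U w, V w).
have mUV : measurable_fun setT UVm by exact: measurable_fun_pair.
pose U' : {mfun T >-> E1} := HB.pack U (@isMeasurableFun.Build _ _ _ _ _ mU).
pose W' : {mfun T >-> E2} := HB.pack W (@isMeasurableFun.Build _ _ _ _ _ mW).
pose UV' : {mfun T >-> (E1 * E2)%type} := HB.pack UVm (@isMeasurableFun.Build _ _ _ _ _ mUV).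
have E X : measurable X -> (distribution P U' \x distribution P W')%E X = distribution P UV' X.
  apply: product_measure_unique => A B mA mB.
  by rewrite /distribution /pushforward /= -UV.
transitivity (\int[distribution P UV']_z Phi z)%E.
  by rewrite ge0_integral_distribution.
rewrite (eq_measure_integral (distribution P U' \x distribution P W')%E); last first.
  by move=> A mA _; rewrite /= -E.
rewrite fubini_tonelli1// /fubini_F.
rewrite ge0_integral_distribution//=; last 2 first.
- exact: (@measurable_fun_fubini_tonelli_F _ _ _ _ _ (distribution P W')).
- by move=> x; exact: integral_ge0.
apply: eq_integral => w _ /=.
rewrite ge0_integral_distribution//.
exact: (measurableT_comp mPhi (pair1_measurable _)).
Qed.

Lemma same_law_integral d1 (E1 : measurableType d1) (V W : T -> E1) (f : E1 -> \bar R) :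
  measurable_fun setT V -> measurable_fun setT W ->
  (forall B, measurable B -> P (V @^-1` B) = P (W @^-1` B)) ->
  measurable_fun setT f -> (forall x, 0 <= f x)%E ->
  (\int[P]_w f (V w) = \int[P]_w f (W w))%E.
Proof.
move=> mV mW VW mf f0.
(* A constant carries no information: every event is independent of it. *)
have := @independent_copy_integral _ _ R^o E1 (cst 0) V W (fun z => f z.2).
move=> /= -> //.
- by rewrite integral_prob_cst.
- move=> A C mA mC; rewrite preimage_cst; case: ifPn => _.
    by rewrite setTI (@probability_setT _ _ _ P) mul1e VW.
  by rewrite set0I measure0 mul0e.
- by apply: measurableT_comp.
Qed.

Lemma independent_integral d1 d2 (E1 : measurableType d1) (E2 : measurableType d2)
    (U : T -> E1) (V : T -> E2) (f : E1 -> \bar R) (g : E2 -> \bar R) :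
  measurable_fun setT U -> measurable_fun setT V ->
  (forall A B, measurable A -> measurable B ->
     P (U @^-1` A `&` V @^-1` B) = (P (U @^-1` A) * P (V @^-1` B))%E) ->
  measurable_fun setT f -> measurable_fun setT g ->
  (forall x, 0 <= f x)%E -> (forall x, 0 <= g x)%E ->
  (\int[P]_w (f (U w) * g (V w)) = (\int[P]_w f (U w)) * \int[P]_w g (V w))%E.
Proof.
move=> mU mV UV mf mg f0 g0.
have := @independent_copy_integral _ _ E1 E2 U V V (fun z => f z.1 * g z.2)%E.
move=> -> //; last 2 first.
- by apply: emeasurable_funM; apply: measurableT_comp.
- by move=> z; exact: mule_ge0.
have mfU : measurable_fun setT (fun w => f (U w)) by exact: measurableT_comp.
have mgV : measurable_fun setT (fun w => g (V w)) by exact: measurableT_comp.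
under eq_integral => w _ do rewrite /= ge0_integralZl//.
by rewrite ge0_integralZr//; exact: integral_ge0.
Qed.

End independent_copies.

(** * Almost sure properties on products and completions *)

Section completion_facts.
Context {d : measure_display} {T : measurableType d} {R : realType}.
Variable Q : probability T R.
Local Notation CT := (completed_space Q).
Definition completion : probability CT R := @completed_prob _ _ _ Q.
Local Notation CQ := completion.

Lemma completed_measurable (A : set T) : measurable A -> measurable (A : set CT).
Proof. exact: caratheodory_measurable_mu_ext. Qed.

Lemma completed_probE (A : set T) : measurable A -> CQ A = Q A.
Proof. by move=> mA; exact: (measurable_mu_extE Q mA). Qed.

Lemma measurable_completed d' (E : measurableType d') (f : T -> E) :
  measurable_fun setT f -> measurable_fun setT (f : CT -> E).
Proof.
move=> mf _ A mA; apply: completed_measurable; exact: mf.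
Qed.

(** The original probability is the image of its completion under the identity
    map. *)
Lemma ge0_integral_completed (f : T -> \bar R) : measurable_fun setT f ->
  (forall x, 0 <= f x)%E -> (\int[CQ]_x f x = \int[Q]_x f x)%E.
Proof.
move=> mf f0.
have mid : measurable_fun setT (fun x : CT => x : T).
  by apply: measurable_completed; exact: measurable_id.
have := @ge0_integral_pushforward _ _ CT T R (fun x => x) mid CQ setT f measurableT mf.
move=> H; rewrite -[LHS]H; last by move=> x _.
apply: eq_measure_integral => A mA _; exact: completed_probE.
Qed.

Lemma ae_completed (S : T -> Prop) : {ae Q, forall w, S w} -> {ae CQ, forall w, S w}.
Proof.
move=> [N [mN N0 sN]]; exists N; split => //.
- exact: completed_measurable.
- exact: etrans (completed_probE mN) N0.
Qed.

(** A null set for the outer measure has, for every [n], a measurable cover of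
    measure less than [1/n]; the intersection of these covers is null. *)
Lemma ae_completed_inv (S : T -> Prop) : {ae CQ, forall w, S w} -> {ae Q, forall w, S w}.
Proof.
move=> [N [mN N0 sN]].
have N0' : (Q^*)%mu N = 0%E by exact: N0.
have cov (n : nat) : exists F : (set T)^nat, @measurable_cover d T N F /\
    (\sum_(k <oo) Q (F k) < (n.+1%:R^-1)%R%:E)%E.
  have : ((Q^*)%mu N < (n.+1%:R^-1)%R%:E)%E by rewrite N0' lte_fin invr_gt0.
  by move=> /ereal_inf_lt[_ [F cF <-] Fn]; exists F; split => //; exact: cF.
have {cov} [F HF] := choice cov.
have mU n : measurable (\bigcup_k F n k).
  by apply: bigcup_measurable => k _; exact: (cover_measurable (HF n).1).
exists (\bigcap_n \bigcup_k F n k); split.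
- exact: bigcap_measurableType.
- apply/eqP; rewrite eq_le measure_ge0 andbT; apply/lee_addgt0Pr => e e0; rewrite add0e.
  have [n ne] : exists n : nat, n.+1%:R^-1 < e.
    by have [k] := ltr_add_invr e0; rewrite add0r; exists k.
  apply: (@le_trans _ _ (Q (\bigcup_k F n k))).
    apply: le_measure; rewrite ?inE//; first exact: bigcap_measurableType.
    by move=> w; apply.
  apply: (@le_trans _ _ (\sum_(k <oo) Q (F n k))%E).
    apply: measure_sigma_subadditive => //.
    exact: (cover_measurable (HF n).1).
  by apply: (le_trans (ltW (HF n).2)); rewrite lee_fin ltW.
- move=> w /sN Nw n _; exact: (cover_subset (HF n).1 Nw).
Qed.

Lemma measurable_completed_ae (f : T -> R) (g : CT -> R) : measurable_fun setT f ->
  {ae CQ, forall w, f w = g w} -> measurable_fun setT g.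
Proof.
move=> mf fg; apply/measurable_EFinP.
apply: (@ae_measurable_fun _ _ _ CQ (@completed_prob_is_complete _ _ _ Q) setT (EFin \o f)).
  by move: fg => [N [mN N0 sN]]; exists N; split => // w /= nS; apply: sN => /= E; apply: nS => _; rewrite E.
by apply/measurable_EFinP; exact: measurable_completed.
Qed.

End completion_facts.

Section product_facts.
Context {d1 d2 : measure_display} {T1 : measurableType d1} {T2 : measurableType d2}
  {R : realType} (P1 : probability T1 R) (P2 : probability T2 R).

Lemma ae_prod1 (S : T1 -> Prop) : {ae P1, forall w, S w} ->
  {ae (P1 \x P2)%E, forall w, S w.1}.
Proof.
move=> [N [mN N0 sN]]; exists (N `*` setT); split.
- exact: measurableX.
- by rewrite product_measure1E// [X in (X * _)%E]N0 mul0e.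
- by move=> [x y] /= nS; split => //; exact: sN.
Qed.

(** Almost every section of a null set is null, hence is not the whole of
    [T2]. *)
Lemma ae_prod1_inv (S : T1 -> Prop) : {ae (P1 \x P2)%E, forall w, S w.1} ->
  {ae P1, forall w, S w}.
Proof.
move=> [N [mN N0 sN]].
have mx := measurable_fun_xsection P2 mN.
have [H _] := @ae_eq_integral_abs _ _ _ P1 setT measurableT _ mx.
have /H : (\int[P1]_x `|(P2 \o xsection N) x| = 0)%E.
  by rewrite -[RHS]N0; apply: eq_integral => x _; rewrite gee0_abs.
apply: filterS => x /(_ I) /= xN0; apply: contrapT => nS.
have E : xsection N x = setT.
  by apply/seteqP; split => // y _; rewrite /xsection /= inE; apply: sN.
by move: xN0; rewrite E (@probability_setT _ _ _ P2) => /eqP; rewrite onee_eq0.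
Qed.

End product_facts.

(** * The Markov property along a grid *)

Lemma ae_iff_measure d (T : measurableType d) (R : realType)
    (m : {measure set T -> \bar R}) (A B : set T) :
  measurable A -> measurable B -> {ae m, forall w, A w <-> B w} -> m A = m B.
Proof.
move=> mA mB [N [mN N0 sub]].
have sub1 : A `<=` B `|` N.
  by move=> w Aw; have [Bw|nBw] := pselect (B w); [left|right; apply: sub => /= -[h _]; exact/nBw/h].
have sub2 : B `<=` A `|` N.
  by move=> w Aw; have [Bw|nBw] := pselect (A w); [left|right; apply: sub => /= -[_ h]; exact/nBw/h].
apply/eqP; rewrite eq_le; apply/andP; split.
- apply: (@le_trans _ _ (m (B `|` N))); first by rewrite le_measure ?inE//; exact: measurableU.
  by apply: (le_trans (measureU2 _ _ _)) => //; rewrite [X in (_ + X)%E]N0 adde0.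
- apply: (@le_trans _ _ (m (A `|` N))); first by rewrite le_measure ?inE//; exact: measurableU.
  by apply: (le_trans (measureU2 _ _ _)) => //; rewrite [X in (_ + X)%E]N0 adde0.
Qed.

Section sequences_cylinder.
Context {R : realType}.

Definition cylinder : set (set (nat -> R)) :=
  [set C | exists n A, (forall i, measurable (A i)) /\
     C = \bigcap_(i in `I_n) [set y | A i (y i)]].

Lemma cylinder_setI_closed : setI_closed cylinder.
Proof.
move=> _ _ [n [A [mA ->]]] [m [B [mB ->]]].
exists (maxn n m), (fun i => (if (i < n)%N then A i else setT) `&` (if (i < m)%N then B i else setT)).
split.
  by move=> i; apply: measurableI; case: ifPn.
apply/seteqP; split => [y [yA yB] i /= _|y /= h].
  by split; case: ifPn => // im; [exact: (yA i)|exact: (yB i)].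
split => i /= im.
  by have := h i; rewrite /= leq_max im => /(_ isT)[].
by have := h i; rewrite /= leq_max im orbT => /(_ isT)[].
Qed.

(** The sigma-algebra of the cylinders, on which independence and stationarity
    prescribe the law of the increments. *)
Definition seqspace := g_sigma_algebraType cylinder.

Lemma measurable_coord i : measurable_fun setT (fun y : seqspace => y i : R).
Proof.
move=> _ A mA; rewrite setTI; apply: sub_sigma_algebra.
exists i.+1, (fun k => if k == i then A else setT); split.
  by move=> k; case: ifPn.
apply/seteqP; split => [y Ay k _ /=|y /(_ i)/=]; first by case: eqP => // ->.
by rewrite ltnSn eqxx; exact.
Qed.

Definition psum (y : seqspace) (n : nat) : R := \sum_(i < n) (y : nat -> R) i.

Lemma measurable_psum n : measurable_fun setT (fun y => psum y n).
Proof.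
by apply: measurable_sum => i; exact: measurable_coord.
Qed.

End sequences_cylinder.

Section levy.
Context {d : measure_display} {T : measurableType d} {R : realType}.
Variable P : probability T R.
Variable X : R -> {RV P >-> R}.
Hypothesis LX : levy_process X.

Definition incrs (s h : R) (w : T) : @seqspace R :=
  fun k => X (s + k.+1%:R * h) w - X (s + k%:R * h) w.

Lemma measurable_incr s t : measurable_fun setT (fun w => X s w - X t w).
Proof. by apply: measurable_funB. Qed.

Lemma levy_incrs_law (s h : R) n (A : nat -> set R) : 0 <= s -> 0 < h ->
  (forall i, measurable (A i)) ->
  P (incrs s h @^-1` (\bigcap_(i in `I_n) [set y | A i (y i)])) =
  (\prod_(i < n) fine (P (X h @^-1` A i)))%:E.
Proof.
move=> s0 h0 mA.
pose t i := s + i%:R * h.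
have t0 : 0 <= t 0%N by rewrite /t mul0r addr0.
have ti : forall i, (i < n)%N -> t i < t i.+1.
  by move=> i _; rewrite /t ltrD2l ltr_pM2r// ltr_nat.
have := levy_indep_increments LX t0 ti mA.
have -> : \bigcap_(i in `I_n) ((fun w => X (t i.+1) w - X (t i) w) @^-1` A i) =
  incrs s h @^-1` (\bigcap_(i in `I_n) [set y | A i (y i)]) by [].
have mI : measurable (incrs s h @^-1` (\bigcap_(i in `I_n) [set y | A i (y i)])).
  rewrite preimage_bigcap; apply: bigcap_measurableType => i _.
  by rewrite -[X in measurable X]setTI; apply: (measurable_incr _ _).
move=> HE; have {HE} := congr1 EFin HE; rewrite fineK ?fin_num_measure// => ->.
congr EFin; apply: eq_bigr => i _; congr fine.
have := levy_stationary_increments LX (A := A i) (s := t i) (t := h).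
rewrite /t => H; rewrite -[RHS]H ?(ltW h0)//; last by rewrite addr_ge0 // mulr_ge0// ltW.
by congr (P _); apply/seteqP; split => w /=; rewrite -natr1 mulrDl mul1r addrA.
Qed.

Lemma measurable_incrs_cylinder (s h : R) C : cylinder C -> measurable (incrs s h @^-1` C).
Proof.
move=> [n [A [mA ->]]].
rewrite preimage_bigcap; apply: bigcap_measurableType => i _.
by rewrite -[X in measurable X]setTI; apply: (measurable_incr _ _).
Qed.

(** The times [0, s, s + h, ...] cut out consecutive increments, the first of
    which is [X s]. *)
Lemma levy_markov_cylinder (s h : R) n (A0 : set R) (A : nat -> set R) : 0 < s -> 0 < h ->
  measurable A0 -> (forall i, measurable (A i)) ->
  P (X s @^-1` A0 `&` incrs s h @^-1` (\bigcap_(i in `I_n) [set y | A i (y i)])) =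
  (P (X s @^-1` A0) * (\prod_(i < n) fine (P (X h @^-1` A i)))%:E)%E.
Proof.
move=> s0 h0 mA0 mA.
pose t i := if i is k.+1 then s + k%:R * h else 0.
pose B i := if i is k.+1 then A k else A0.
have mB i : measurable (B i) by case: i.
have ti : forall i, (i < n.+1)%N -> t i < t i.+1.
  move=> [|i] _ /=; first by rewrite mul0r addr0.
  by rewrite ltrD2l ltr_pM2r// ltr_nat.
have := levy_indep_increments LX (lexx 0 : 0 <= t 0%N) ti mB.
have mI : measurable (incrs s h @^-1` (\bigcap_(i in `I_n) [set y | A i (y i)])).
  by apply: measurable_incrs_cylinder; exists n, A.
have mX : measurable (X s @^-1` A0).
  by rewrite -[X in measurable X]setTI; apply: measurable_funP.
have -> : \bigcap_(i in `I_n.+1) ((fun w => X (t i.+1) w - X (t i) w) @^-1` B i) =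
  [set w | A0 (X s w - X 0 w)] `&` incrs s h @^-1` (\bigcap_(i in `I_n) [set y | A i (y i)]).
  apply/seteqP; split => [w Hw|w [Hw1 Hw2] [|i]].
  - split; first by have := Hw 0%N isT; rewrite /= mul0r addr0.
    by move=> i /= iltn; exact: (Hw i.+1).
  - by move=> _ /=; rewrite mul0r addr0.
  - by move=> /= iltn; exact: Hw2.
have mX0 : measurable [set w | A0 (X s w - X 0 w)].
  by rewrite -[X in measurable X]setTI; apply: (measurable_incr s 0).
have ae0 (D : set T) : measurable D -> P ([set w | A0 (X s w - X 0 w)] `&` D) = P (X s @^-1` A0 `&` D).
  move=> mD; apply: ae_iff_measure; [exact: measurableI|exact: measurableI|].
  apply: filterS (levy_start LX) => w Xw0; split => -[] /= h1 h2; split => //=; move: h1.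
    by rewrite Xw0 subr0.
  by rewrite Xw0 subr0.
rewrite ae0// => HE; have {HE} := congr1 EFin HE; rewrite fineK ?fin_num_measure//; last exact: measurableI.
move=> ->; rewrite big_ord_recl EFinM /= mul0r addr0.
congr (_ * _)%E.
  rewrite fineK ?fin_num_measure//.
  by have := ae0 setT measurableT; rewrite !setIT.
congr EFin; apply: eq_bigr => i _; congr fine.
rewrite /bump /= add1n.
have := levy_stationary_increments LX (A := A i) (s := s + i%:R * h) (t := h).
move=> H; rewrite -[RHS]H ?(ltW h0)//; last by rewrite addr_ge0 ?(ltW s0)// mulr_ge0// ltW.
by congr (P _); apply/seteqP; split => w /=; rewrite -natr1 mulrDl mul1r addrA.
Qed.

(** The Markov property at time [s], for the future seen along a grid of step
    [h]. *)
Lemma levy_markov (s h : R) (A0 : set R) (C : set seqspace) : 0 < s -> 0 < h ->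
  measurable A0 -> measurable C ->
  [/\ measurable (incrs s h @^-1` C), measurable (incrs 0 h @^-1` C) &
  P (X s @^-1` A0 `&` incrs s h @^-1` C) =
  (P (X s @^-1` A0) * P (incrs 0 h @^-1` C))%E].
Proof.
move=> s0 h0 mA0; apply: independent_copy_pi_lambda.
- exact: cylinder_setI_closed.
- by rewrite -[X in measurable X]setTI; apply: measurable_funP.
- move=> D cD; split; [exact: measurable_incrs_cylinder|exact: measurable_incrs_cylinder|].
  by case: cD => n [A [mA ->]]; rewrite levy_markov_cylinder// levy_incrs_law.
Qed.

Lemma measurable_incrs (s h : R) : measurable_fun setT (incrs s h).
Proof.
apply: (@measurability _ _ T (@seqspace R) setT (incrs s h) (@cylinder R)) => // _ [C cC <-].
by rewrite setTI; exact: measurable_incrs_cylinder.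
Qed.

Lemma psum_incrs s h w n : psum (incrs s h w) n = X (s + n%:R * h) w - X s w.
Proof.
rewrite /psum -(big_mkord xpredT (incrs s h w)) telescope_sumr//.
by rewrite mul0r addr0.
Qed.

End levy.

(** * A renewal bound for a drifting path *)

(** All the indices that satisfy [a] lie in a window of length [K] that starts
    at the first of them. *)
Lemma sum_window_le (a : nat -> bool) (K n : nat) :
  (forall k l, a k -> a l -> (k <= l)%N -> (l < k + K)%N) ->
  (\sum_(k < n) a k <= K)%N.
Proof.
move=> aK.
have -> : (\sum_(k < n) a k = size (seq.filter a (iota 0 n)))%N.
  rewrite -(big_mkord xpredT (fun k => nat_of_bool (a k))) size_filter -sum1_count.
  by rewrite [RHS]big_mkcond /index_iota subn0; apply: eq_bigr => k _; case: (a k).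
have [ea|] := pselect (exists k, a k); last first.
  move=> na; rewrite (_ : seq.filter a _ = [::])//.
  by apply/eqP; rewrite -[_ == _]negbK -has_filter; apply/negP => /hasP[k _ ak]; apply: na; exists k.
case: (ex_minnP ea) => k0 ak0 k0min.
rewrite -[leqRHS](size_iota k0 K); apply: uniq_leq_size.
  by rewrite filter_uniq// iota_uniq.
move=> k; rewrite mem_filter => /andP[ak _]; rewrite mem_iota (k0min _ ak)/=.
by apply: aK => //; exact: k0min.
Qed.

Lemma measurable_exp_cut d (T : measurableType d) (R : realType) (f : T -> R) (c : R) :
  measurable_fun setT f ->
  measurable_fun setT (fun w => (expR (- f w) * (c <= f w)%R%:R)%R%:E).
Proof.
move=> mf; apply/measurable_EFinP; apply: measurable_funM.
  by apply: measurableT_comp => //; exact: measurable_funN.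
apply: (@measurableT_comp _ _ _ _ _ _ (fun b : bool => b%:R : R)) => //.
exact: measurable_fun_ler.
Qed.

Section renewal.
Context {d : measure_display} {T : measurableType d} {R : realType}.
Variable P : probability T R.
Variable X : R -> {RV P >-> R}.
Hypothesis LX : levy_process X.
Local Open Scope ereal_scope.

(** If a walk visits an interval of length one and the increments that follow
    are in this set, there is no further visit from [K] steps later on. *)
Definition drift_event (K : nat) : set (@seqspace R) :=
  [set y | forall m, (K <= m)%N -> (1 < psum y m)%R].

Lemma measurable_drift_event K : measurable (drift_event K).
Proof.
rewrite (_ : drift_event K = \bigcap_(m in [set m | (K <= m)%N]) [set y | (1 < psum y m)%R])//.
apply: bigcap_measurableType => m _.
exact: (@measurable_superlevel _ (@seqspace R) _ (psum ^~ m) 1 (measurable_psum m)).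
Qed.

Variable K : nat.
Hypothesis hK : (2^-1)%:E <= P (incrs X 0 1 @^-1` drift_event K).

Lemma measurable_preimage_RV s (A : set R) : measurable A -> measurable (X s @^-1` A).
Proof. by move=> mA; rewrite -[X in measurable X]setTI; apply: measurable_funP. Qed.

(** By the Markov property, at least half of the probability of a visit at
    time [k] comes from paths whose next increments are in [drift_event K];
    and on any path there are at most [K] such times, since two of them differ
    by less than [K]. *)
Lemma renewal_count (x : R) (n : nat) :
  \sum_(k < n) P (X k.+1%:R @^-1` `[x, (x + 1)%R]%classic) <= (2 * K%:R)%R%:E.
Proof.
pose I := `[x, (x + 1)%R]%classic.
have mI : measurable I by exact: measurable_itv.
pose A (k : nat) := X k.+1%:R @^-1` I `&` incrs X k.+1%:R 1 @^-1` drift_event K.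
have Mk (k : nat) := levy_markov LX (ltr0Sn R k) ltr01 mI (measurable_drift_event K).
have mA k : measurable (A k).
  by apply: measurableI; [exact: measurable_preimage_RV|case: (Mk k)].
have PA k : P (X k.+1%:R @^-1` I) <= 2%:E * P (A k).
  have [_ _ ->] := Mk k.
  rewrite muleCA -[leLHS]mule1; apply: lee_wpmul2l => //.
  (* The event has probability at least [1/2] by the choice of [K]. *)
  rewrite -[leLHS]/(1%R%:E) -[in leLHS](@mulfV _ 2%R) ?pnatr_eq0// EFinM; apply: lee_wpmul2l => //.
apply: (@le_trans _ _ (\sum_(k < n) 2%:E * P (A k))); first by apply: lee_sum => k _; exact: PA.
rewrite -ge0_sume_distrr// EFinM; apply: lee_wpmul2l => //.
have -> : \sum_(k < n) P (A k) = \int[P]_w (\sum_(k < n) (\1_(A k) w)%:E).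
  rewrite ge0_integral_sum//.
    by apply: eq_bigr => k _; rewrite integral_indic// setIT.
  by move=> k; apply/measurable_EFinP; exact: measurable_indic.
apply: (@le_trans _ _ (\int[P]_w (cst K%:R%:E w))); last first.
  by rewrite integral_prob_cst.
apply: ge0_le_integral => //.
- by move=> w _; rewrite sume_ge0.
- by apply: emeasurable_sum => k; apply/measurable_EFinP; exact: measurable_indic.
- move=> w _; rewrite sumEFin lee_fin.
  have -> : (\sum_(k < n) \1_(A k) w = (\sum_(k < n) (w \in A k))%:R :> R)%R.
    by rewrite natr_sum; apply: eq_bigr => k _; rewrite indicE.
  rewrite ler_nat; apply: (@sum_window_le (fun k => w \in A k)).
  move=> k l; rewrite !inE => -[/= Ik Fk] [/= Il _] kl.
  rewrite ltnNge; apply/negP => kKl.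
  have := Fk (l - k)%N; rewrite leq_subRL// kKl => /(_ isT).
  rewrite psum_incrs mulr1 -natrD addSn subnKC//.
  by move: Ik Il; rewrite /I /= !in_itv/= => /andP[? ?] /andP[? ?]; lra.
Qed.

(** The range of [X_k + j] above [- M] is cut into intervals of length one, in
    each of which the visits are counted by [renewal_count]; the bounds form a
    geometric series. The shift [j] stands for an independent variable, to be
    integrated out afterwards. *)
Lemma renewal_exp_sum (M j : R) (n : nat) :
  \sum_(k < n) \int[P]_w (expR (- (X k.+1%:R w + j)) * (- M <= X k.+1%:R w + j)%R%:R)%R%:E
  <= (2 * K%:R * (expR M / (1 - expR (- 1))))%R%:E.
Proof.
pose I i : set R := `[(- M - j + i%:R)%R, (- M - j + i%:R + 1)%R]%classic.
pose e i : R := expR (M - i%:R)%R.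
have mX (k i : nat) : measurable_fun setT (fun w => (e i * \1_(X k.+1%:R @^-1` I i) w)%R%:E).
  apply/measurable_EFinP; apply: measurable_funM => //; apply: measurable_indic.
  by apply: measurable_preimage_RV; exact: measurable_itv.
apply: (@le_trans _ _ (\sum_(k < n) \int[P]_w \sum_(i <oo) (e i * \1_(X k.+1%:R @^-1` I i) w)%R%:E)).
  apply: lee_sum => k _; apply: ge0_le_integral => //.
  - by apply: measurable_exp_cut; exact: measurable_funD.
  - apply: ge0_emeasurable_sum => // i w _ _.
    by rewrite lee_fin mulr_ge0// expR_ge0.
  - move=> w _.
    have [Mw|] := leP (- M)%R (X k.+1%:R w + j)%R; last first.
      move=> _; rewrite mulr0; apply: nneseries_ge0 => i _ _.
      by rewrite lee_fin mulr_ge0// expR_ge0.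
    rewrite mulr1; pose i := Num.truncn (X k.+1%:R w + j + M)%R.
    have := truncn_itv (_ : 0 <= X k.+1%:R w + j + M)%R.
    move=> /(_ _)/andP[]; first lra.
    rewrite -/i => i1 i2.
    apply: (@le_trans _ _ (\sum_(0 <= i < i.+1) (e i * \1_(X k.+1%:R @^-1` I i) w)%R%:E)); last first.
      by apply: nneseries_lim_ge => l _ _; rewrite lee_fin mulr_ge0// expR_ge0.
    rewrite big_nat_recr//= -[leLHS]add0e; apply: leeD.
      by apply: sume_ge0 => l _; rewrite lee_fin mulr_ge0// expR_ge0.
    rewrite indicE mem_set; last first.
      by rewrite /I /= in_itv/=; rewrite -[i.+1%:R]natr1 in i2; apply/andP; split; lra.
    by rewrite mulr1 lee_fin /e ler_expR; lra.
under eq_bigr => k _.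
  rewrite integral_nneseries//; last first.
    by move=> i w _; rewrite lee_fin mulr_ge0// expR_ge0.
  over.
rewrite -nneseries_sum; last first.
  by move=> k i _; apply: integral_ge0 => w _; rewrite lee_fin mulr_ge0// expR_ge0.
apply: (@le_trans _ _ (\sum_(i <oo) (2 * K%:R * e i)%R%:E)).
  apply: lee_nneseries.
    by move=> i _ _; apply: sume_ge0 => k _; apply: integral_ge0 => w _; rewrite lee_fin mulr_ge0// expR_ge0.
  move=> i _; under eq_bigr => k _.
    under eq_integral do rewrite EFinM.
    rewrite ge0_integralZl_EFin ?expR_ge0//; last first.
      by apply/measurable_EFinP; apply: measurable_indic; apply: measurable_preimage_RV; exact: measurable_itv.
    rewrite integral_indic//; last by apply: measurable_preimage_RV; exact: measurable_itv.
    rewrite setIT; over.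
  rewrite -ge0_sume_distrr// mulrC [leRHS]EFinM; apply: lee_wpmul2l.
    by rewrite lee_fin expR_ge0.
  exact: renewal_count.
have z1 : (`|expR (-1)%R : R| < 1)%R.
  by rewrite ger0_norm ?expR_ge0// expR_lt1; lra.
apply: lime_le.
  by apply: is_cvg_nneseries => i _ _; rewrite lee_fin mulr_ge0 ?mulr_ge0// expR_ge0.
near=> m; rewrite sumEFin lee_fin.
have := @geometric_le_lim R m (2 * K%:R * expR M)%R (expR (-1)%R).
rewrite -mulrA => /(_ _ (expR_gt0 _) z1); rewrite !mulrA => HH.
apply: le_trans (HH _); last by rewrite mulr_ge0 ?mulr_ge0// expR_ge0.
rewrite /series /=; apply: ler_sum => i _; rewrite /e expRD -!mulrA.
by rewrite -expRM_natl mulrN mulr1.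
Unshelve. all: by end_near. Qed.

(** The base case is the empty partial sum. *)
Fixpoint psum_min (N : nat) (y : @seqspace R) : R :=
  if N is n.+1 then Num.min (psum_min n y) (psum y n) else 0%R.

Lemma measurable_psum_min N : measurable_fun setT (psum_min N).
Proof.
elim: N => [|N IH] /=; first exact: measurable_cst.
by apply: measurable_minr => //; exact: measurable_psum.
Qed.

Lemma psum_min_le N y i : (i < N)%N -> (psum_min N y <= psum y i)%R.
Proof.
elim: N => // N IH; rewrite ltnS leq_eqVlt => /predU1P[->|iN] /=.
  by rewrite ge_min lexx orbT.
by rewrite ge_min IH.
Qed.

Lemma psum_min_ge N y c : (c <= 0)%R -> (forall i, (i < N)%N -> (c <= psum y i)%R) ->
  (c <= psum_min N y)%R.
Proof.
move=> c0; elim: N => // N IH H /=; rewrite le_min H// IH// => i iN.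
by apply: H; rewrite ltnS ltnW.
Qed.

(** The minimum of the path over the dyadic points of level [r] in
    [[s, s + 2)]. Dyadic levels are nested, so that these minima decrease in
    [r]. *)
Definition path_min (r : nat) (s : R) (w : T) : R :=
  (X s w + psum_min (2 ^ r.+1) (incrs X s (2 ^- r) w))%R.

Lemma measurable_path_min r s : measurable_fun setT (path_min r s).
Proof.
apply: measurable_funD => //.
by apply: (measurableT_comp (measurable_psum_min _)); exact: measurable_incrs.
Qed.

Lemma path_min_le r s w i : (i < 2 ^ r.+1)%N ->
  (path_min r s w <= X (s + i%:R * 2 ^- r) w)%R.
Proof.
move=> iN; rewrite /path_min -lerBrDl -psum_incrs.
exact: psum_min_le.
Qed.

Lemma path_min_ge r s w c : (forall i, c <= X (s + i%:R * 2 ^- r) w)%R ->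
  (c <= path_min r s w)%R.
Proof.
move=> H; rewrite /path_min -lerBlDl; apply: psum_min_ge => [|i _].
  by have := H 0%N; rewrite mul0r addr0 subr_le0.
by rewrite psum_incrs lerB.
Qed.

Lemma path_min_nonincreasing s w : nonincreasing_seq (path_min ^~ s ^~ w).
Proof.
apply/nonincreasing_seqP => r; rewrite {2}/path_min -lerBlDl; apply: psum_min_ge => [|i ir].
  have := @path_min_le r.+1 s w 0; rewrite mul0r addr0 expn_gt0 => /(_ isT).
  by rewrite subr_le0.
rewrite psum_incrs lerB//.
have := @path_min_le r.+1 s w (2 * i)%N.
rewrite [(2 ^ r.+2)%N]expnS ltn_pmul2l// ir => /(_ isT).
by rewrite natrM exprS invfM mulrACA divff ?mul1r.
Qed.

(** By the Markov property, the increments after time [k] may be replaced by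
    an independent copy of the increments after [0]; given this copy,
    [renewal_exp_sum] applies. *)
Lemma expectation_path_min_sum (M : R) (r n : nat) :
  \sum_(k < n) \int[P]_w (expR (- path_min r k.+1%:R w) * (- M <= path_min r k.+1%:R w)%R%:R)%R%:E
  <= (2 * K%:R * (expR M / (1 - expR (- 1))))%R%:E.
Proof.
have h0 : (0 < 2 ^- r :> R)%R by rewrite invr_gt0 exprn_gt0.
pose J w := psum_min (2 ^ r.+1) (incrs X 0%R (2 ^- r)%R w).
have mJ : measurable_fun setT J.
  by apply: (measurableT_comp (measurable_psum_min _)); exact: measurable_incrs.
pose Phi (z : R * R) : \bar R := (expR (- (z.1 + z.2)) * (- M <= z.1 + z.2)%R%:R)%R%:E.
have Phi0 z : 0 <= Phi z by rewrite lee_fin mulr_ge0// expR_ge0.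
have mPhi : measurable_fun setT Phi.
  by apply: measurable_exp_cut; exact: measurable_funD.
have mPhiXJ k : measurable_fun setT (fun z : T * T => Phi (X k.+1%:R z.1, J z.2)).
  apply: (measurableT_comp mPhi).
  by apply: measurable_fun_pair => //; apply: measurableT_comp.
under eq_bigr => k _.
  rewrite (@independent_copy_integral _ _ _ P _ _ _ _ (X k.+1%:R)
    (fun w => psum_min (2 ^ r.+1) (incrs X k.+1%:R (2 ^- r)%R w)) J Phi)//; last 2 first.
  - by apply: (measurableT_comp (measurable_psum_min _)); exact: measurable_incrs.
  - move=> A B mA mB.
    have mB' : measurable (psum_min (2 ^ r.+1) @^-1` B).
      by rewrite -[X in measurable X]setTI; apply: measurable_psum_min.
    by have [_ _] := levy_markov LX (ltr0Sn R k) h0 mA mB'.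
  rewrite (@fubini_tonelli _ _ _ _ _ P P (fun z => Phi (X k.+1%:R z.1, J z.2)))//.
  over.
rewrite -ge0_integral_sum//; last 2 first.
- by move=> k; apply: (@measurable_fun_fubini_tonelli_G _ _ _ _ _ P (fun z => Phi (X k.+1%:R z.1, J z.2))).
- by move=> k w _; exact: integral_ge0.
apply: (@le_trans _ _ (\int[P]_w (cst (2 * K%:R * (expR M / (1 - expR (- 1))))%R%:E w))); last first.
  by rewrite integral_prob_cst.
apply: ge0_le_integral => //.
- by move=> w _; apply: sume_ge0 => k _; exact: integral_ge0.
- apply: emeasurable_sum => k.
  by apply: (@measurable_fun_fubini_tonelli_G _ _ _ _ _ P (fun z => Phi (X k.+1%:R z.1, J z.2))).
- by move=> w _; exact: (renewal_exp_sum M (J w) n).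
Qed.

(** On the paths above [- M] the expectation of the sum is bounded uniformly
    in [r], so that monotone convergence makes the sum finite almost surely.
    The index [r] is both the dyadic level and the number of terms, which
    makes the sums increase in [r]. *)
Lemma ae_path_min_sum_bounded :
  {ae P, forall w, exists M : nat, forall i r : nat, (- M%:R <= X (i%:R * 2 ^- r)%R w)%R} ->
  {ae P, forall w, exists b : R, forall r, (\sum_(k < r) expR (- path_min r k.+1%:R w) <= b)%R}.
Proof.
move=> hE.
pose E (M : nat) := \bigcap_i \bigcap_r (X (i%:R * 2 ^- r)%R @^-1` `[(- M%:R)%R, +oo[).
have mE M : measurable (E M).
  apply: bigcap_measurableType => i _; apply: bigcap_measurableType => r _.
  exact: measurable_preimage_RV.
pose S M r w : R := (\1_(E M) w * \sum_(k < r) expR (- path_min r k.+1%:R w))%R.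
have mS M r : measurable_fun setT (S M r).
  apply: measurable_funM; first exact: measurable_indic.
  apply: measurable_sum => k; apply: measurableT_comp => //; apply: measurable_funN.
  exact: measurable_path_min.
have S0 M r w : (0 <= S M r w)%R.
  by rewrite mulr_ge0// sumr_ge0// => k _; exact: expR_ge0.
have ndS M w : nondecreasing_seq (fun r => (S M r w)%:E).
  apply/nondecreasing_seqP => r; rewrite lee_fin /S ler_wpM2l//.
  rewrite big_ord_recr /= -[leLHS]addr0 lerD ?expR_ge0//.
  apply: ler_sum => k _; rewrite ler_expR lerN2.
  exact: (path_min_nonincreasing _ _ (leqnSn r)).
have iS M r : \int[P]_w (S M r w)%:E <= (2 * K%:R * (expR M%:R / (1 - expR (- 1))))%R%:E.
  apply: le_trans (expectation_path_min_sum M%:R r r).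
  rewrite -ge0_integral_sum//; last first.
    by move=> k; apply: measurable_exp_cut; exact: measurable_path_min.
  apply: ge0_le_integral => //.
  - by move=> w _; rewrite lee_fin.
  - exact/measurable_EFinP.
  - by apply: emeasurable_sum => k; apply: measurable_exp_cut; exact: measurable_path_min.
  - move=> w _; rewrite sumEFin lee_fin /S indicE.
    have [wE|wE] := boolP (w \in E M); last first.
      by rewrite mul0r sumr_ge0// => k _; rewrite mulr_ge0// expR_ge0.
    rewrite mul1r; apply: ler_sum => k _.
    suff -> : (- M%:R <= path_min r k.+1%:R w)%R by rewrite mulr1.
    apply: path_min_ge => i.
    move: wE; rewrite inE => /(_ (k.+1 * 2 ^ r + i)%N I) /(_ r I) /=.
    rewrite in_itv/= andbT natrD natrM natrX mulrDl mulfK//.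
have finS M : {ae P, forall w, limn (fun r => (S M r w)%:E) \is a fin_num}.
  have mg r : measurable_fun setT (fun w => (S M r w)%:E) by exact/measurable_EFinP.
  have mL : measurable_fun setT (fun w => limn (fun r => (S M r w)%:E)).
    apply: (emeasurable_fun_cvg (fun r w => (S M r w)%:E)) => // w _.
    exact: ereal_nondecreasing_is_cvgn.
  have L0 w : 0 <= limn (fun r => (S M r w)%:E).
    apply: lime_ge; first exact: ereal_nondecreasing_is_cvgn.
    by apply: nearW => r; rewrite lee_fin.
  have iL : P.-integrable setT (fun w => limn (fun r => (S M r w)%:E)).
    apply/integrableP; split => //.
    under eq_integral do rewrite gee0_abs//.
    rewrite monotone_convergence//.
    - apply: (@le_lt_trans _ _ (2 * K%:R * (expR M%:R / (1 - expR (- 1))))%R%:E); last exact: ltry.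
      apply: lime_le; last by apply: nearW => r; exact: iS.
      apply: ereal_nondecreasing_is_cvgn; apply/nondecreasing_seqP => r.
      apply: ge0_le_integral => //.
      + by move=> w _; rewrite lee_fin.
      + by move=> w _; have /nondecreasing_seqP := ndS M w; exact.
    - by move=> r w _; rewrite lee_fin.
  have := integrable_ae measurableT iL.
  by apply: filterS => w; apply.
have finS' := ae_foralln finS.
apply: filterS2 hE finS' => w [M HM] /(_ M) HL.
exists (fine (limn (fun r => (S M r w)%:E))) => r.
rewrite -lee_fin fineK//.
have -> : (\sum_(k < r) expR (- path_min r k.+1%:R w))%R = S M r w.
  rewrite /S indicE mem_set ?mul1r// => i _ r' _ /=.
  by rewrite in_itv/= andbT.
rewrite (cvg_lim _ (ereal_nondecreasing_cvgn (ndS M w)))//.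
by apply: ereal_sup_ubound; exists r.
Qed.

End renewal.

(** * Almost sure domination of the exponential of a path *)

Section paths.
Context {R : realType}.

(** Strictly above [x], so that right continuity applies along these
    points. *)
Definition dyadic_above (x : R) (r : nat) : R := (Num.truncn (x * 2 ^+ r)).+1%:R * 2 ^- r.

Lemma dyadic_above_gt x r : 0 <= x -> x < dyadic_above x r <= x + 2 ^- r.
Proof.
move=> x0; have p2 : 0 < 2 ^+ r :> R by rewrite exprn_gt0.
have /truncn_itv/andP[h1 h2] : 0 <= x * 2 ^+ r by rewrite mulr_ge0// ltW.
rewrite /dyadic_above ltr_pdivlMr// h2 /= -natr1 mulrDl mul1r lerD2r.
by rewrite ler_pdivrMr.
Qed.

Lemma dyadic_above_cvg x : 0 <= x -> dyadic_above x r @[r --> \oo] --> x.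
Proof.
move=> x0; apply: (@squeeze_cvgr _ _ _ _ (fun=> x) (fun r => x + 2 ^- r)).
- by near=> r; have /andP[/ltW -> ->] := dyadic_above_gt r x0.
- exact: cvg_cst.
- rewrite -[X in _ --> X]addr0; apply: cvgD; first exact: cvg_cst.
  have := @cvg_expr R (2^-1).
  rewrite ger0_norm ?invr_ge0// invf_lt1// ltr1n => /(_ isT).
  by apply: cvg_trans; apply: near_eq_cvg; near=> r; rewrite exprVn.
Unshelve. all: by end_near. Qed.

Lemma cadlag_dyadic_ge (f : R -> R) (a s c : R) : cadlag f -> 0 <= a -> a <= s ->
  (\forall r \near \oo, c <= f (a + dyadic_above (s - a) r)) -> c <= f s.
Proof.
move=> [fr _] a0 as_ H.
have sa : 0 <= s - a by rewrite subr_ge0.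
have : f (a + dyadic_above (s - a) r) @[r --> \oo] --> f s.
  have /cvg_at_rightP := fr s (le_trans a0 as_); apply; split.
    by move=> r; have /andP[+ _] := dyadic_above_gt r sa; rewrite ltrBlDl.
  rewrite -[X in _ --> X](subrKC a); apply: cvgD => //; first exact: cvg_cst.
  exact: dyadic_above_cvg.
move=> fc; rewrite -(cvg_lim _ fc)//; apply: limr_ge => //.
by apply/cvg_ex; exists (f s).
Qed.

(** The one-sided limits bound the path near each point of a compact
    interval. *)
Lemma cadlag_bounded (f : R -> R) (N : R) : cadlag f ->
  exists M : R, forall s, 0 <= s <= N -> `|f s| <= M.
Proof.
move=> [fr fl].
have : \forall M \near +oo, forall s, `[0, N]%classic s -> `|f s| <= M.
  have /compact_near_coveringP := @segment_compact R 0 N.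
  move=> /(_ _ (pinfty_nbhs R) (fun M s => 0 <= s -> `|f s| <= M)) H.
  have {}H : \forall M \near +oo, `[0, N]%classic `<=` (fun s => 0 <= s -> `|f s| <= M).
    apply: H => s; rewrite /= in_itv/= => /andP[s0 _].
    have [M1 HM1] : exists M1, \forall s' \near s^'+, `|f s'| <= M1.
      exists (`|f s| + 1).
      have := fr s s0 => /cvgrPdist_le/(_ 1 ltr01); apply: filterS => s' h.
      by rewrite -lerBlDl (le_trans (lerB_dist _ _))// distrC.
    have [M2 HM2] : exists M2, \forall s' \near s^'-, 0 <= s' -> `|f s'| <= M2.
      have [s00|s00] := leP s 0.
        exists 0; near=> s' => s'0; exfalso.
        have : s' < s by near: s'; exact: nbhs_left_lt.
        by rewrite ltNge (le_trans s00).
      have /cvg_ex[l fl'] := fl s s00.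
      exists (`|l| + 1).
      move: fl' => /cvgrPdist_le/(_ 1 ltr01); apply: filterS => s' h _.
      by rewrite -lerBlDl (le_trans (lerB_dist _ _))// distrC.
    have HMM : \forall s' \near s, 0 <= s' -> `|f s'| <= Num.max `|f s| (Num.max M1 M2).
      move: HM1 HM2; rewrite !near_withinE => H1 H2; near=> s' => s'0.
      have [ss|ss|<-] := ltgtP s s'.
      - rewrite !le_max; apply/orP; right; apply/orP; left.
        by move: ss; near: s'; exact: H1.
      - rewrite !le_max; apply/orP; right; apply/orP; right.
        by move: s'0; move: ss; near: s'; exact: H2.
      - by rewrite le_max lexx.
    exists ([set s' | 0 <= s' -> `|f s'| <= Num.max `|f s| (Num.max M1 M2)],
            [set M | Num.max `|f s| (Num.max M1 M2) <= M]).
      by split => //=; apply: nbhs_pinfty_ge; exact: num_real.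
    by move=> [s' M] /= [h1 h2] s'0; apply: le_trans h2; exact: h1.
  apply: filterS H => M HM s; rewrite /= in_itv/= => /andP[s0 sN].
  by apply: HM => //=; rewrite in_itv/= s0 sN.
move=> [M [_ HM]]; exists (M + 1) => s sN; apply: HM; first by rewrite ltrDl.
by rewrite /= in_itv.
Unshelve. all: by end_near. Qed.

End paths.

Section same_law.
Context {d : measure_display} {T : measurableType d} {R : realType}.
Variable P : probability T R.
Variables X1 X2 : R -> {RV P >-> R}.
Hypothesis L1 : levy_process X1.
Hypothesis L2 : levy_process X2.
Hypothesis X12 : same_law P (fun t => X1 t) (fun t => X2 t).

Lemma measurable_bigcap_RV (X : R -> {RV P >-> R}) (t : nat -> R) (A : nat -> set R) (D : set nat) :
  (forall i, measurable (A i)) -> measurable (\bigcap_(i in D) (X (t i) @^-1` A i)).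
Proof.
move=> mA; apply: bigcap_measurableType => i _; exact: measurable_preimage_RV.
Qed.

(** Through this equality, almost sure properties of the paths pass from [X1]
    to [X2]. *)
Lemma same_law_bigcap (t : nat -> R) (A : nat -> set R) :
  (forall i, 0 <= t i) -> (forall i, measurable (A i)) ->
  P (\bigcap_i (X1 (t i) @^-1` A i)) = P (\bigcap_i (X2 (t i) @^-1` A i)).
Proof.
move=> t0 mA.
have cv (X : R -> {RV P >-> R}) : P (\bigcap_(i in `I_n) (X (t i) @^-1` A i)) @[n --> \oo]
    --> P (\bigcap_i (X (t i) @^-1` A i)).
  have -> : \bigcap_i (X (t i) @^-1` A i) = \bigcap_n \bigcap_(i in `I_n) (X (t i) @^-1` A i).
    apply/seteqP; split => [w Hw n _ i _|w Hw i _]; first exact: Hw.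
    exact: (Hw i.+1 I i (ltnSn i)).
  apply: nonincreasing_cvg_mu.
  - by rewrite (le_lt_trans (probability_le1 _ _)) ?ltry//; exact: measurable_bigcap_RV.
  - by move=> n; exact: measurable_bigcap_RV.
  - by apply: bigcap_measurableType => n _; exact: measurable_bigcap_RV.
  - apply/nonincreasing_seqP => n; rewrite subsetEset => w Hw i /= im.
    by apply: Hw => /=; rewrite ltnW.
apply: (cvg_unique _ (cv X1)) => //.
apply: cvg_trans (cv X2); apply: near_eq_cvg; near=> n.
exact/esym/X12.
Unshelve. all: by end_near. Qed.

Hypothesis X1oo : {ae P, forall w, X1 t w @[t --> +oo] --> +oo}.

Lemma ae_nondecreasing_cvg1 (F : nat -> set T) : (forall n, measurable (F n)) ->
  nondecreasing_seq F -> {ae P, forall w, exists n, F n w} -> P (F n) @[n --> \oo] --> 1%E.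
Proof.
move=> mF ndF aeF.
have mU : measurable (\bigcup_n F n) by exact: bigcup_measurable.
have -> : 1%E = P (\bigcup_n F n).
  rewrite -(probability_setT P); apply: ae_iff_measure => //.
  by apply: filterS aeF => w [n Fn]; split => // _; exists n.
exact: nondecreasing_cvg_mu.
Qed.

Lemma cvg1_ae_bigcup (F : nat -> set T) : (forall n, measurable (F n)) ->
  nondecreasing_seq F -> P (F n) @[n --> \oo] --> 1%E -> {ae P, forall w, exists n, F n w}.
Proof.
move=> mF ndF F1.
have mU : measurable (\bigcup_n F n) by exact: bigcup_measurable.
have : P (\bigcup_n F n) = 1%E.
  have c := nondecreasing_cvg_mu (mu := P) mF mU ndF.
  exact: (cvg_unique _ c F1).
move=> PU; exists (~` \bigcup_n F n); split.
- exact: measurableC.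
- by rewrite probability_setC// PU subee.
- by move=> w /= nw [n _ Fn]; apply: nw; exists n.
Qed.

Lemma ae_levy_lower_bound (X : R -> {RV P >-> R}) : levy_process X ->
  {ae P, forall w, X t w @[t --> +oo] --> +oo} ->
  {ae P, forall w, exists M : nat, forall s, 0 <= s -> - M%:R <= X s w}.
Proof.
move=> LX Xoo; apply: filterS2 Xoo (levy_cadlag LX) => w Xoo cX.
have /cvgryPge/(_ 0)[N [_ HN]] := Xoo.
have [M HM] := cadlag_bounded (Num.max 0 (N + 1)) cX.
exists (Num.truncn (Num.max 0 M)).+1 => s s0.
have [sN|Ns] := leP s (N + 1).
  rewrite lerNl; apply: (@le_trans _ _ M).
    by rewrite (le_trans _ (HM s _))// ?s0 ?le_max ?sN ?orbT// -normrN ler_norm.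
  have /truncn_itv/andP[_ /ltW h] : 0 <= Num.max 0 M by rewrite le_max lexx.
  by apply: le_trans h; rewrite le_max lexx orbT.
apply: (@le_trans _ _ 0); first by rewrite oppr_le0.
by apply: HN; apply: lt_trans Ns; rewrite ltrDl.
Qed.

(** The convergence to infinity is known for [X1]. The bound is a countable
    intersection of conditions on single times, with the same probability for
    [X2]. *)
Lemma ae_levy_lower_bound2 :
  {ae P, forall w, exists M : nat, forall i r : nat, - M%:R <= X2 (i%:R * 2 ^- r) w}.
Proof.
(* An enumeration of the dyadic times. *)
pose t j : R := if unpickle j is Some (i, r) then (i : nat)%:R * 2 ^- r else 0.
have t0 j : 0 <= t j.
  by rewrite /t; case: unpickle => // -[i r]; rewrite mulr_ge0// invr_ge0 exprn_ge0.
have tE i r : t (pickle (i, r)) = i%:R * 2 ^- r by rewrite /t pickleK.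
pose A (M : nat) : set R := `[- M%:R, +oo[%classic.
pose F (X : R -> {RV P >-> R}) M := \bigcap_j (X (t j) @^-1` A M).
have mF X M : measurable (F X M).
  by apply: measurable_bigcap_RV => i; exact: measurable_itv.
have ndF X : nondecreasing_seq (F X).
  apply/nondecreasing_seqP => M; rewrite subsetEset => w Hw j _.
  have := Hw j I; rewrite /A /= !in_itv/= !andbT; apply: le_trans.
  by rewrite lerN2 ler_nat.
have : {ae P, forall w, exists M, F X2 M w}.
  apply: cvg1_ae_bigcup => //.
  have : {ae P, forall w, exists M, F X1 M w}.
    apply: filterS (ae_levy_lower_bound L1 X1oo) => w [M HM]; exists M => j _.
    by rewrite /A /= in_itv/= andbT; exact: HM.
  move=> /(ae_nondecreasing_cvg1 (mF X1) (ndF X1)); apply: cvg_trans.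
  by apply: near_eq_cvg; near=> M; apply: same_law_bigcap => // j; exact: measurable_itv.
apply: filterS => w [M HM]; exists M => i r.
by have := HM (pickle (i, r)) I; rewrite /= tE /A /= in_itv/= andbT.
Unshelve. all: by end_near. Qed.

(** Almost every path of [X1] is above [1] at all large integer times, so that
    the probability tends to [1] as [K] increases; it is the same for [X2]. *)
Lemma levy_drift_event :
  exists K, ((2^-1)%:E <= P (incrs X2 0 1 @^-1` drift_event K))%E.
Proof.
pose A K m : set R := if (K <= m)%N then `]1, +oo[%classic else setT.
have mA K m : measurable (A K m) by rewrite /A; case: ifPn.
pose F (X : R -> {RV P >-> R}) K := \bigcap_m (X m%:R @^-1` A K m).
have mF X K : measurable (F X K) by exact: measurable_bigcap_RV.
have ndF X : nondecreasing_seq (F X).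
  apply/nondecreasing_seqP => K; rewrite subsetEset => w Hw j _.
  have := Hw j I; rewrite /A /=; case: ifPn => //; case: ifPn => // h1 h2.
  by rewrite (ltnW h1) in h2.
have c1 : P (F X1 K) @[K --> \oo] --> 1%E.
  apply: ae_nondecreasing_cvg1 => //.
  apply: filterS X1oo => w /cvgryPgt/(_ 1)[N [_ HN]].
  exists (Num.truncn (Num.max 0 N)).+1 => m _; rewrite /A /=; case: ifPn => // Km.
  rewrite /= in_itv/= andbT; apply: HN.
  have /truncn_itv/andP[_ h] : 0 <= Num.max 0 N by rewrite le_max lexx.
  have hN : N < (Num.truncn (Num.max 0 N)).+1%:R.
    by rewrite (le_lt_trans _ h)// le_max lexx orbT.
  by rewrite (lt_le_trans hN)// ler_nat.
have c2 : P (F X2 K) @[K --> \oo] --> 1%E.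
  move: c1; apply: cvg_trans; apply: near_eq_cvg; near=> K; exact: same_law_bigcap.
have [K _ HK] : \forall K \near \oo, ((2^-1)%:E <= P (F X2 K))%E.
  have c3 : fine (P (F X2 K)) @[K --> \oo] --> (1 : R) by exact: (fine_cvg c2).
  have h : 2^-1 < 1 :> R by lra.
  have c4 := cvgr_ge _ c3 _ h.
  near=> K; rewrite -(@fineK _ (P _)) ?fin_num_measure// lee_fin.
  by near: K; exact: c4.
exists K; rewrite (le_trans (HK K (leqnn K)))//.
rewrite le_eqVlt; apply/orP; left; apply/eqP; apply: ae_iff_measure => //.
  have mD := measurable_drift_event (R:=R) K.
  by rewrite -[X in measurable X]setTI; apply: measurable_incrs.
apply: filterS (levy_start L2) => w X0; split => [Hw m Km|Hw m _].
  rewrite psum_incrs mulr1 add0r X0 subr0.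
  by have := Hw m I; rewrite /A Km /= in_itv/= andbT.
rewrite /A /=; case: ifPn => // Km; rewrite /= in_itv/= andbT.
by have := Hw m Km; rewrite psum_incrs mulr1 add0r X0 subr0.
Unshelve. all: by end_near. Qed.

(** By right continuity, the supremum over a window is a limit of maxima over
    dyadic points. The sums of minima begin with the window at time [1]; on
    the window at [0], the lower bound of the path is used. The windows have
    length two because they will serve for points at distance at most one from
    a cell of length one. *)
Lemma ae_levy_exp_dominated :
  {ae P, forall w, exists (c : nat -> R) (b : R),
    [/\ forall k, 0 <= c k,
     forall k s, k%:R <= s < k%:R + 2 -> expR (- X2 s w) <= c k &
     forall n, \sum_(k < n) c k <= b]}.
Proof.
have [K hK] := levy_drift_event.
have H1 := ae_path_min_sum_bounded L2 hK ae_levy_lower_bound2.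
apply: filterS3 H1 ae_levy_lower_bound2 (levy_cadlag L2) => w [b Hb] [M HM] cX.
pose e k r := expR (- path_min X2 r k.+1%:R w).
have nde k : nondecreasing_seq (e k).
  move=> r r' rr'; rewrite /e ler_expR lerN2; exact: path_min_nonincreasing.
have ub k : has_ubound (range (e k)).
  exists b => _ [r _ <-]; apply: (@le_trans _ _ (e k (maxn r k.+1))).
    by apply: nde; exact: leq_maxl.
  apply: le_trans (Hb (maxn r k.+1)).
  rewrite (bigD1 (Ordinal (leq_maxr r k.+1)))//= lerDl sumr_ge0// => i _.
have cve k := nondecreasing_is_cvgn (nde k) (ub k).
pose C k := limn (e k).
have eC k r : e k r <= C k by exact: nondecreasing_cvgn_le.
have C0 k : 0 <= C k by apply: le_trans (eC k 0%N); exact: expR_ge0.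
have dyad (s : R) k : k%:R <= s -> s < k%:R + 2 ->
    \forall r \near \oo, ((Num.truncn ((s - k%:R) * 2 ^+ r)).+1 < 2 ^ r.+1)%N.
  move=> ks sk; have sk0 : 0 <= s - k%:R by rewrite subr_ge0.
  near=> r; have : dyadic_above (s - k%:R) r < 2.
    near: r; apply: (cvgr_lt _ (dyadic_above_cvg sk0)); lra.
  rewrite /dyadic_above ltr_pdivrMr ?exprn_gt0// -exprS => h.
  by rewrite -(@ltr_nat R) natrX.
exists (fun k => if k is k'.+1 then C k' else expR M%:R), (expR M%:R + b); split.
- by case => [|k] //; exact: expR_ge0.
- case=> [|k] s /andP[ks sk].
    rewrite ler_expR lerNl; apply: (cadlag_dyadic_ge cX (lexx 0) ks).
    by near=> r; rewrite add0r; exact: HM.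
  have Cgt0 : 0 < C k by apply: lt_le_trans (eC k 0%N); exact: expR_gt0.
  rewrite -[leRHS](lnK Cgt0) ler_expR lerNl.
  apply: (cadlag_dyadic_ge cX _ ks) => //.
  near=> r; rewrite lerNl -ler_expR lnK//; apply: le_trans (eC k r).
  rewrite /e ler_expR lerN2; apply: path_min_le.
  by near: r; exact: dyad.
- case => [|n].
    rewrite big_ord0 addr_ge0 ?expR_ge0//.
    by have := Hb 0%N; rewrite big_ord0.
  rewrite big_ord_recl lerD2l /=.
  have : \sum_(k < n) e k r @[r --> \oo] --> \sum_(k < n) C k.
    by apply: cvg_big => [|i _]; [exact: add_continuous|exact: cve].
  move=> cs; rewrite -(cvg_lim _ cs)//; apply: limr_le.
    by apply/cvg_ex; eexists; exact: cs.
  near=> r; apply: le_trans (Hb r).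
  rewrite -(big_mkord xpredT (fun k => e k r)) -(big_mkord xpredT (fun k => expR (- path_min X2 r k.+1%:R w))).
  rewrite [leRHS](big_cat_nat _ (n := n))//=; last by near: r; exact: nbhs_infty_ge.
  by rewrite lerDl sumr_ge0// => i _; exact: expR_ge0.
Unshelve. all: by end_near. Qed.

End same_law.

(** * Exponential moments of a Levy process *)

Section left_continuity.
Context {d : measure_display} {T : measurableType d} {R : realType}.
Variable P : probability T R.
Variable X : R -> {RV P >-> R}.
Hypothesis LX : levy_process X.

(** The left limit exists on almost every path, and stochastic continuity
    identifies it along a sequence. *)
Lemma levy_ae_left_continuous (s : R) : 0 < s ->
  {ae P, forall w, X r w @[r --> s^'-] --> X s w}.
Proof.
move=> s0.
(* The shift by two keeps these times nonnegative. *)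
pose u n : R := s - s / n.+2%:R.
have u_bnd n : 0 <= u n < s.
  rewrite /u subr_ge0 ltrBlDr ltrDl divr_gt0// andbT.
  by rewrite ler_pdivrMr// ler_peMr ?(ltW s0)// ler1n.
have u_cvg : u n @[n --> \oo] --> s.
  rewrite -[X in _ --> X]subr0; apply: cvgB; first exact: cvg_cst.
  rewrite -[X in _ --> X](mulr0 s); apply: cvgMr.
  have := @cvg_harmonic R.
  by rewrite -(cvg_shiftS (@harmonic R)).
pose E j n := [set w | j.+1%:R^-1 < `|X (u n) w - X s w|].
have mE j n : measurable (E j n).
  apply: measurable_superlevel.
  by apply: measurableT_comp => //; exact: measurable_incr.
have PE j : P (E j n) @[n --> \oo] --> 0%E.
  have j0 : 0 < j.+1%:R^-1 :> R by rewrite invr_gt0.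
  have := levy_stochastic_continuity LX (ltW s0) j0.
  move=> /(cvg_comp u _); apply.
  move=> A hA.
  have : \forall n \near \oo, 0 <= u n -> A (u n) := u_cvg _ hA.
  by apply: filterS => n; apply; case/andP: (u_bnd n).
have PN j N : P (\bigcap_(n in [set n | (N <= n)%N]) E j n) = 0%E.
  apply/eqP; rewrite eq_le measure_ge0 andbT.
  apply: (cvge_ge _ (PE j)); exists N => // n /= Nn.
  apply: le_measure; rewrite ?inE//.
    by apply: bigcap_measurableType => k _; exact: mE.
  by move=> w; exact.
have N0 : {ae P, forall w, forall j N, ~ (\bigcap_(n in [set n | (N <= n)%N]) E j n) w}.
  apply: ae_foralln => j; apply: ae_foralln => N.
  exists (\bigcap_(n in [set n | (N <= n)%N]) E j n); split.
  - by apply: bigcap_measurableType => k _; exact: mE.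
  - exact: PN.
  - by move=> w /= /contrapT.
apply: filterS2 N0 (levy_cadlag LX) => w H [_ cl].
have /cvg_ex[l Xl] := cl s s0.
suff <- : l = X s w by [].
apply/eqP; rewrite -subr_eq0 -normr_le0; apply/ler_addgt0Pr => e e0; rewrite add0r leNgt.
apply/negP => el.
have Xu : X (u n) w @[n --> \oo] --> l.
  by have /cvg_at_leftP := Xl; apply; split => // n; case/andP: (u_bnd n).
have [j je] : exists j : nat, j.+1%:R^-1 < e.
  by have [k] := ltr_add_invr e0; rewrite add0r; exists k.
have : `|X (u n) w - X s w| @[n --> \oo] --> `|l - X s w|.
  by apply: cvg_norm; apply: cvgB => //; exact: cvg_cst.
move=> /cvgr_gt/(_ _ (lt_trans je el))[N _ HN].
by apply: (H j N) => n /= Nn; exact: HN.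
Qed.

End left_continuity.

Section exponential_moments.
Context {d : measure_display} {T : measurableType d} {R : realType}.
Variable P : probability T R.
Variable X : R -> {RV P >-> R}.
Hypothesis LX : levy_process X.

Lemma levy_incr_integral (a b : R) (f : R -> \bar R) : 0 <= a <= b ->
  measurable_fun setT f -> (forall x, 0 <= f x)%E ->
  (\int[P]_w f (X b w - X a w)%R = \int[P]_w f (X (b - a)%R w))%E.
Proof.
move=> /andP[a0 ab] mf f0.
have mV := measurable_incr X b a.
have := @independent_copy_integral _ _ _ P _ _ _ _ (cst 0 : T -> R)
    (fun w => X b w - X a w) (X (b - a)) (fun z => f z.2).
move=> /= -> //.
- by rewrite integral_prob_cst.
- move=> A C mA mC; have E : P ((fun w => X b w - X a w) @^-1` C) = P (X (b - a) @^-1` C).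
    have := levy_stationary_increments LX (A := C) (s := a) (t := b - a).
    by rewrite subrKC => -> //; rewrite subr_ge0.
  rewrite preimage_cst; case: ifPn => _.
    by rewrite setTI (@probability_setT _ _ _ P) mul1e.
  by rewrite set0I measure0 mul0e.
- by apply: measurableT_comp.
Qed.

Lemma levy_incr2_integral (a b c : R) (f g : R -> \bar R) : 0 <= a -> a <= b -> b <= c ->
  measurable_fun setT f -> (forall x, 0 <= f x)%E ->
  measurable_fun setT g -> (forall x, 0 <= g x)%E ->
  (\int[P]_w (f (X b w - X a w)%R * g (X c w - X b w)%R) =
   (\int[P]_w f (X (b - a)%R w)) * (\int[P]_w g (X (c - b)%R w)))%E.
Proof.
move=> a0 ab bc mf f0 mg g0.
have mfX s : measurable_fun setT (fun w => f (X s w)) by exact: measurableT_comp.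
have mgX s : measurable_fun setT (fun w => g (X s w)) by exact: measurableT_comp.
have If0 : (\int[P]_w f (X 0%R w) = f 0%R)%E.
  rewrite -[RHS]mule1 -(@probability_setT _ _ _ P) -integral_cst//.
  by apply: ae_eq_integral => //; apply: filterS (levy_start LX) => w X0 _ /=; rewrite X0.
have Ig0 : (\int[P]_w g (X 0%R w) = g 0%R)%E.
  rewrite -[RHS]mule1 -(@probability_setT _ _ _ P) -integral_cst//.
  by apply: ae_eq_integral => //; apply: filterS (levy_start LX) => w X0 _ /=; rewrite X0.
move: (ab); rewrite le_eqVlt => /predU1P[<-|ab'].
  rewrite subrr If0.
  under eq_integral do rewrite subrr.
  rewrite ge0_integralZl//; last by apply: measurableT_comp => //; exact: measurable_incr.
  by rewrite levy_incr_integral// a0 (le_trans ab).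
move: (bc); rewrite le_eqVlt => /predU1P[<-|bc'].
  rewrite subrr Ig0.
  under eq_integral do rewrite subrr.
  rewrite ge0_integralZr//; last by apply: measurableT_comp => //; exact: measurable_incr.
  by rewrite levy_incr_integral// a0.
have := @independent_copy_integral _ _ _ P _ _ _ _ (fun w => X b w - X a w)
    (fun w => X c w - X b w) (X (c - b)) (fun z => f z.1 * g z.2)%E.
move=> -> //; [|exact: measurable_incr|exact: measurable_incr| | |]; last first.
- by move=> z; exact: mule_ge0.
- by apply: emeasurable_funM; apply: measurableT_comp.
- move=> A C mA mC.
  (* The times [a < b < c], as a sequence. *)
  pose t i := if i is j.+1 then (if j is 0%N then b else c) else a.
  pose D i := if i is 0%N then A else C.
  have mD i : measurable (D i) by case: i.
  have t0 : 0 <= t 0%N by [].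
  have ti i : (i < 2)%N -> t i < t i.+1 by case: i => [|[|]].
  have := levy_indep_increments LX t0 ti mD.
  rewrite 2!big_ord_recl big_ord0 mulr1 /=.
  have -> : \bigcap_(i in `I_2) ((fun w => X (t i.+1) w - X (t i) w) @^-1` D i) =
    (fun w => X b w - X a w) @^-1` A `&` (fun w => X c w - X b w) @^-1` C.
    apply/seteqP; split => [w Hw|w [H1 H2] [|[|]]]//.
    by split; [exact: (Hw 0%N isT)|exact: (Hw 1%N isT)].
  have m1 : measurable ((fun w => X b w - X a w) @^-1` A).
    by rewrite -[X in measurable X]setTI; apply: measurable_incr.
  have m2 : measurable ((fun w => X c w - X b w) @^-1` C).
    by rewrite -[X in measurable X]setTI; apply: measurable_incr.
  move=> HE; have {HE} := congr1 EFin HE.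
  rewrite EFinM !fineK ?fin_num_measure//; last exact: measurableI.
  move=> ->; congr (_ * _)%E.
  have := levy_stationary_increments LX (A := C) (s := b) (t := c - b).
  rewrite subrKC => -> //; first by rewrite (le_trans a0).
  by rewrite subr_ge0.
under eq_integral => w _ do rewrite /= ge0_integralZl//.
rewrite ge0_integralZr//; last 2 first.
- by apply: measurableT_comp => //; exact: measurable_incr.
- exact: integral_ge0.
by rewrite levy_incr_integral// a0.
Qed.

Variable th : R.
(** The Laplace transform of the process at time [s], possibly infinite. *)
Definition exp_moment (s : R) : \bar R := (\int[P]_w (expR (- (th * X s w)))%:E)%E.

Lemma measurable_expN : measurable_fun setT (fun x => (expR (- (th * x)))%:E).
Proof.
apply/measurable_EFinP; apply: measurableT_comp => //.
by apply: measurable_funN; apply: measurable_funM.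
Qed.

Lemma exp_momentD s r : 0 <= s -> 0 <= r -> exp_moment (s + r) = (exp_moment s * exp_moment r)%E.
Proof.
move=> s0 r0.
have := @levy_incr2_integral 0 s (s + r) (fun x => (expR (- (th * x)))%:E)
  (fun x => (expR (- (th * x)))%:E).
rewrite lexx s0 lerDl r0 subr0 addrAC subrr add0r => /(_ isT isT isT).
move=> <- //; [|exact: measurable_expN|exact: measurable_expN].
rewrite /exp_moment; apply: ae_eq_integral => //.
- by apply: (measurableT_comp measurable_expN).
- apply: emeasurable_funM; first by apply: (measurableT_comp measurable_expN); exact: measurable_incr.
  by apply: (measurableT_comp measurable_expN); exact: measurable_incr.
- apply: filterS (levy_start LX) => w X0 _ /=.
  by rewrite X0 subr0 -EFinM -expRD; congr (expR _)%:E; ring.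
Qed.

Lemma exp_moment0 : exp_moment 0 = 1%E.
Proof.
rewrite -(@probability_setT _ _ _ P) -[RHS]mul1e -integral_cst//.
apply: ae_eq_integral => //.
- by apply: (measurableT_comp measurable_expN).
- by apply: filterS (levy_start LX) => w X0 _ /=; rewrite X0 mulr0 oppr0 expR0.
Qed.

Lemma exp_moment_ge0 s : (0 <= exp_moment s)%E.
Proof. by apply: integral_ge0 => w _; rewrite lee_fin expR_ge0. Qed.

Lemma exp_moment_gt0 s : (0 < exp_moment s)%E.
Proof.
rewrite lt_neqAle exp_moment_ge0 andbT eq_sym; apply/negP => /eqP.
have mf : measurable_fun setT (fun w => (expR (- (th * X s w)))%:E).
  by apply: (measurableT_comp measurable_expN).
have [+ _] := @ae_eq_integral_abs _ _ _ P setT measurableT _ mf.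
under eq_integral do rewrite gee0_abs ?lee_fin ?expR_ge0//.
move=> H /H; rewrite /ae_eq => -[N [mN N0 sN]].
have : P setT = 0%E.
  apply/eqP; rewrite eq_le measure_ge0 andbT -N0; apply: le_measure; rewrite ?inE//.
  move=> w _; apply: sN => /= /(_ I) [] /eqP; rewrite gt_eqF//; exact: expR_gt0.
by rewrite (@probability_setT _ _ _ P) => /eqP; rewrite onee_eq0.
Qed.

Hypothesis exp_moment1 : (exp_moment 1 < +oo)%E.

Lemma exp_moment_nat n : (exp_moment n%:R = exp_moment 1 ^+ n)%E.
Proof.
elim: n => [|n IH]; first by rewrite exp_moment0.
by rewrite -natr1 exp_momentD// IH expeS muleC.
Qed.

(** For [n >= s], the moment at time [n] is the product of the moment at [s]
    and a positive number. *)
Lemma exp_moment_fin s : 0 <= s -> exp_moment s \is a fin_num.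
Proof.
move=> s0; rewrite ge0_fin_numE ?exp_moment_ge0//.
pose n := (Num.truncn s).+1.
have sn : s <= n%:R by have /truncn_itv/andP[_ /ltW] := s0.
have : (exp_moment n%:R < +oo)%E.
  rewrite exp_moment_nat -(@fineK _ (exp_moment 1)) ?ge0_fin_numE ?exp_moment_ge0// -EFin_expe.
  exact: ltry.
rewrite -{1}(subrKC s n%:R) exp_momentD ?subr_ge0//.
have := exp_moment_gt0 (n%:R - s); have := exp_moment_ge0 s.
case: (exp_moment s) => [r||]//; first by move=> *; exact: ltry.
move=> _ h; rewrite gt0_mulye//.
Qed.

Definition rate : R := ln (fine (exp_moment 1)).

Let f s := fine (exp_moment s).
Let f_gt0 s : 0 <= s -> 0 < f s.
Proof. by move=> s0; rewrite /f fine_gt0// exp_moment_gt0 -ge0_fin_numE ?exp_moment_ge0// exp_moment_fin. Qed.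
Let fD s r : 0 <= s -> 0 <= r -> f (s + r) = f s * f r.
Proof. by move=> s0 r0; rewrite /f exp_momentD// fineM ?exp_moment_fin. Qed.
Let f1 : f 1 = expR rate.
Proof. by rewrite /rate lnK// posrE f_gt0. Qed.
Let fM s n : 0 <= s -> f (n%:R * s) = f s ^+ n.
Proof.
move=> s0; elim: n => [|n IH]; first by rewrite mul0r /f exp_moment0.
by rewrite -natr1 mulrDl mul1r fD ?mulr_ge0// IH exprSr.
Qed.
Let f_dyadic i r : f (i%:R * 2 ^- r) = expR (i%:R * 2 ^- r * rate).
Proof.
have h0 : 0 <= 2 ^- r :> R by rewrite invr_ge0 exprn_ge0.
rewrite fM// -mulrA expRM_natl; congr (_ ^+ _).
have := fM (2 ^ r) h0; rewrite natrX mulfV ?expf_neq0// f1 => H.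
have H2 : expR rate = expR (2 ^- r * rate) ^+ (2 ^ r).
  by rewrite -expRM_natl mulrA natrX mulfV ?expf_neq0// mul1r.
have p2 : (0 < 2 ^ r)%N by rewrite expn_gt0.
apply: (pexpIrn p2); rewrite ?nnegrE ?expR_ge0//.
  exact/ltW/f_gt0.
by rewrite -H H2.
Qed.

(** Fatou's lemma along dyadic times that decrease to [s]; at these times the
    formula holds by multiplicativity. *)
Lemma exp_moment_le s : 0 <= s -> (exp_moment s <= (expR (s * rate))%:E)%E.
Proof.
move=> s0.
have mg r : measurable_fun setT (fun w => (expR (- (th * X (dyadic_above s r) w)))%:E).
  by apply: (measurableT_comp measurable_expN).
have H : (\int[P]_w limn_einf (fun r => (expR (- (th * X (dyadic_above s r) w)))%:E)
   <= limn_einf (fun r => exp_moment (dyadic_above s r)))%E.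
  by apply: fatou => // r w _; rewrite lee_fin expR_ge0.
have c1 : exp_moment (dyadic_above s r) @[r --> \oo] --> (expR (s * rate))%:E.
  have -> : (fun r => exp_moment (dyadic_above s r)) = (fun r => (expR (dyadic_above s r * rate))%:E).
    apply/funext => r.
    rewrite -(@fineK _ (exp_moment _)) ?exp_moment_fin ?mulr_ge0 ?invr_ge0 ?exprn_ge0//.
    by rewrite -/(f _) /dyadic_above f_dyadic.
  apply: cvg_EFin; first exact: nearW.
  apply: continuous_cvg; first exact: continuous_expR.
  by apply: cvgMl; exact: dyadic_above_cvg.
have [E _] := cvg_limn_einf_sup c1; rewrite E in H.
apply: le_trans H; rewrite le_eqVlt; apply/orP; left; apply/eqP.
apply: ae_eq_integral => //.
- by apply: (measurableT_comp measurable_expN).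
- rewrite /limn_einf; apply: measurableT_comp => //.
  by apply: measurable_fun_limn_esup => r; apply: measurableT_comp.
- apply: filterS (levy_cadlag LX) => w [cr _] _ /=.
  suff c2 : (expR (- (th * X (dyadic_above s r) w)))%:E @[r --> \oo] -->
      (expR (- (th * X s w)))%:E by have [-> _] := cvg_limn_einf_sup c2.
  apply: cvg_EFin; first exact: nearW.
  apply: continuous_cvg; first exact: continuous_expR.
  apply: cvgN; apply: cvgMr.
  have /cvg_at_rightP := cr s s0; apply; split.
    by move=> r; case/andP: (dyadic_above_gt r s0).
  exact: dyadic_above_cvg.
Qed.

(** As the moments at times [s] and [n - s] have product [exp (n rate)], the
    upper bound for [n - s] is a lower bound for [s]. *)
Lemma exp_momentE s : 0 <= s -> exp_moment s = (expR (s * rate))%:E.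
Proof.
move=> s0; apply/eqP; rewrite eq_le exp_moment_le//=.
pose n := (Num.truncn s).+1.
have sn : s <= n%:R by have /truncn_itv/andP[_ /ltW] := s0.
have ns0 : 0 <= n%:R - s by rewrite subr_ge0.
have h1 : f n%:R = f s * f (n%:R - s) by rewrite -fD// subrKC.
have h2 : f n%:R = expR (n%:R * rate) by rewrite -[n%:R]mulr1 fM// f1 mulr1 expRM_natl.
have h3 : f (n%:R - s) <= expR ((n%:R - s) * rate).
  by rewrite -lee_fin fineK ?exp_moment_fin//; exact: exp_moment_le.
rewrite -(@fineK _ (exp_moment s)) ?exp_moment_fin// lee_fin -/(f s).
rewrite -(@ler_pM2r _ (expR ((n%:R - s) * rate))) ?expR_gt0//.
rewrite -expRD -mulrDl subrKC -h2 h1 ler_wpM2l//; exact/ltW/f_gt0.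
Qed.

End exponential_moments.

(** * A measurable version of the two-sided process *)

(** Serves for [xi] on the negative half line, where the left limits of [xi]
    are limits from the right of left limits of [X2]. *)
Lemma cadlag_left_limit_right {R : realType} (f : R -> R) (s : R) : cadlag f -> 0 <= s ->
  left_limit f x @[x --> s^'+] --> f s.
Proof.
move=> [fr fl] s0; apply/cvgrPdist_le => e e0.
have /cvgrPdist_le/(_ e e0) := fr s s0.
rewrite near_withinE => -[d d0 /= Hd].
near=> x.
have sx : s < x by near: x; exact: nbhs_right_gt.
have xd : x < s + d by near: x; apply: nbhs_right_lt; rewrite ltrDl.
have cx := fl x (le_lt_trans s0 sx).
have cd : `|f s - f y| @[y --> x^'-] --> `|f s - left_limit f x|.
  by apply: cvg_norm; apply: cvgB; [exact: cvg_cst|exact: cx].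
rewrite -(cvg_lim _ cd)//; apply: limr_le; first by apply/cvg_ex; eexists; exact: cd.
near=> y.
have sy : s < y by near: y; exact: nbhs_left_gt.
have yx : y < x by near: y; exact: nbhs_left_lt.
apply: Hd => //=; rewrite /ball/= ltr_norml; apply/andP; split; lra.
Unshelve. all: by end_near. Qed.

(** The function that equals [c k] on the [k]-th cell; the cells are disjoint
    and have length one, so that the sum of the [c k] bounds both its supremum
    and its integral. *)
Lemma step_majorant {R : realType} (c : nat -> R) (b : R) :
  (forall k, 0 <= c k) -> (forall n, \sum_(k < n) c k <= b) ->
  exists h : R -> R, [/\ measurable_fun setT h, forall u, 0 <= h u <= b,
    (\int[@lebesgue_measure R]_u (h u)%:E <= b%:E)%E &
    forall k u, - k.+1%:R < u <= - k%:R -> c k <= h u].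
Proof.
move=> c0 cb.
pose I (k : nat) : set R := `]- k.+1%:R, - k%:R]%classic.
pose S u := (\sum_(k <oo) (c k * \1_(I k) u)%:E)%E.
have ck0 k u : 0 <= c k * \1_(I k) u by rewrite mulr_ge0.
have Sb u : (0 <= S u <= b%:E)%E.
  apply/andP; split; first by apply: nneseries_ge0 => k _ _; rewrite lee_fin.
  apply: lime_le; first by apply: is_cvg_nneseries => k _ _; rewrite lee_fin.
  apply: nearW => n; rewrite big_mkord sumEFin lee_fin; apply: le_trans (cb n).
  by apply: ler_sum => k _; rewrite indicE ler_piMr// lern1 leq_b1.
have SE u : ((fine (S u))%:E = S u)%E.
  rewrite fineK// ge0_fin_numE; first by case/andP: (Sb u) => _ /le_lt_trans; apply; exact: ltry.
  by case/andP: (Sb u).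
have mk k : measurable_fun setT (fun u : R => (c k * \1_(I k) u)%:E).
  by apply/measurable_EFinP; apply: measurable_funM => //; apply: measurable_indic; exact: measurable_itv.
have mS : measurable_fun setT S.
  by apply: ge0_emeasurable_sum => // k u _ _; rewrite lee_fin.
exists (fine \o S); split.
- by apply: measurableT_comp.
- by move=> u; rewrite -!lee_fin /= SE; exact: Sb.
- under eq_integral do rewrite /= SE.
  rewrite integral_nneseries//; last by move=> k u _; rewrite lee_fin.
  apply: lime_le.
    by apply: is_cvg_nneseries => k _ _; apply: integral_ge0 => u _; rewrite lee_fin.
  apply: nearW => n; rewrite big_mkord.
  apply: (@le_trans _ _ (\sum_(k < n) (c k)%:E)%E); last by rewrite sumEFin lee_fin.
  apply: lee_sum => k _.
  under eq_integral do rewrite EFinM.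
  rewrite ge0_integralZl_EFin//; last first.
    by apply/measurable_EFinP; apply: measurable_indic; exact: measurable_itv.
  rewrite integral_indic//; last exact: measurable_itv.
  rewrite setIT [X in (_ * X)%E](_ : _ = 1%E) ?mule1//.
  etransitivity; first exact: lebesgue_measure_itv.
  rewrite /= lte_fin ltrN2 ltr_nat ltnSn.
  by rewrite -EFinB opprK -natr1 addrA addNr add0r.
- move=> k u uk; rewrite -lee_fin /= SE.
  apply: (@le_trans _ _ (\sum_(0 <= i < k.+1) (c i * \1_(I i) u)%:E)%E); last first.
    by apply: nneseries_lim_ge => i _ _; rewrite lee_fin.
  rewrite big_nat_recr//= -[leLHS]add0e; apply: leeD.
    by apply: sume_ge0 => l _; rewrite lee_fin.
  by rewrite indicE mem_set ?mulr1// /I /= in_itv.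
Qed.

Section two_sided.
Context {d : measure_display} {T : measurableType d} {R : realType}.
Variable P : probability T R.
Variables (xi : R -> T -> R) (X1 X2 : R -> {RV P >-> R}).
Hypothesis hxi : two_sided_levy_process xi X1 X2.
Let L1 : levy_process X1. Proof. by case: hxi. Qed.
Let L2 : levy_process X2. Proof. by case: hxi. Qed.

(** On the negative half line [xi] is made of left limits, which are not
    obviously measurable but almost surely equal [X2] at each fixed time. This
    version is measurable at every time. *)
Definition xi_version (t : R) (w : T) : R :=
  (X1 (Num.max t 0) w - X1 0 w) - (X2 (Num.max (- t) 0) w - X2 0 w).

Lemma measurable_xi_version t : measurable_fun setT (xi_version t).
Proof. by apply: measurable_funB; exact: measurable_incr. Qed.

Lemma xi_version_nonneg t w : 0 <= t -> xi_version t w = X1 t w - X1 0 w.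
Proof.
move=> t0; rewrite /xi_version (max_idPl t0) (_ : Num.max (- t) 0 = 0) ?subrr ?subr0//.
by apply/max_idPr; rewrite oppr_le0.
Qed.

Lemma xi_version_nonpos t w : t <= 0 -> xi_version t w = - (X2 (- t) w - X2 0 w).
Proof.
move=> t0; rewrite /xi_version (max_idPr t0) subrr sub0r (_ : Num.max (- t) 0 = - t)//.
by apply/max_idPl; rewrite oppr_ge0.
Qed.

Lemma xi_version_ae t : {ae P, forall w, xi t w = xi_version t w}.
Proof.
have [t0|t0] := leP 0 t.
  apply: filterS (levy_start L1) => w X0.
  by rewrite (two_sided_nonneg hxi)// xi_version_nonneg// X0 subr0.
have t0' : 0 < - t by rewrite oppr_gt0.
apply: filterS2 (levy_start L2) (levy_ae_left_continuous L2 t0') => w X0 lc.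
rewrite (two_sided_neg hxi)// xi_version_nonpos ?ltW// X0 subr0; congr (- _).
exact: cvg_lim.
Qed.

Lemma xi_left_limit_neg w u : cadlag (fun t => X2 t w) -> u <= 0 ->
  xi r w @[r --> u^'-] --> - X2 (- u) w.
Proof.
move=> cX u0.
have := cadlag_left_limit_right cX (_ : 0 <= - u).
rewrite oppr_ge0 => /(_ u0) H.
have H2 : - left_limit (fun s => X2 s w) (- r) @[r --> u^'-] --> - X2 (- u) w.
  apply: cvgN; apply/cvg_at_leftNP.
  rewrite (_ : _ \o _ = left_limit (fun s => X2 s w)); first exact: H.
  by apply/funext => x /=; rewrite opprK.
apply: cvg_trans H2; apply: near_eq_cvg; near=> r.
rewrite (two_sided_neg hxi)//; apply: lt_le_trans u0.
by near: r; exact: nbhs_left_lt.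
Unshelve. all: by end_near. Qed.

Lemma xi_left_limit_ae u : {ae P, forall w, left_limit (xi ^~ w) u = xi_version u w}.
Proof.
have [u0|u0] := leP u 0.
  apply: filterS2 (levy_start L2) (levy_cadlag L2) => w X0 cX.
  rewrite xi_version_nonpos// X0 subr0.
  exact/cvg_lim/xi_left_limit_neg.
apply: filterS2 (levy_start L1) (levy_ae_left_continuous L1 u0) => w X0 lc.
rewrite xi_version_nonneg ?ltW// X0 subr0; apply: cvg_lim => //.
apply: cvg_trans lc; apply: near_eq_cvg; near=> r.
rewrite (two_sided_nonneg hxi)// ltW//; near: r; exact: nbhs_left_gt.
Unshelve. all: by end_near. Qed.

Lemma xi_version_left_limits : {ae P, forall w, forall u, cvg (xi_version r w @[r --> u^'-])}.
Proof.
apply: filterS2 (levy_cadlag L1) (levy_cadlag L2) => w c1 c2 u.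
have [u0|u0] := leP u 0.
  apply/cvg_ex; exists (- (X2 (- u) w - X2 0 w)).
  have H2 : - (X2 (- r) w - X2 0 w) @[r --> u^'-] --> - (X2 (- u) w - X2 0 w).
    apply: cvgN; apply: cvgB; last exact: cvg_cst.
    apply/cvg_at_leftNP.
    rewrite (_ : _ \o _ = (fun s => X2 s w)); last first.
      by apply/funext => x /=; rewrite opprK.
    by apply: (c2.1); rewrite oppr_ge0.
  apply: cvg_trans H2; apply: near_eq_cvg; near=> r.
  rewrite xi_version_nonpos// (le_trans _ u0)//; near: r; exact: nbhs_left_le.
have /cvg_ex[l cl] := c1.2 u u0.
apply/cvg_ex; exists (l - X1 0 w).
have H2 : X1 r w - X1 0 w @[r --> u^'-] --> l - X1 0 w.
  by apply: cvgB => //; exact: cvg_cst.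
apply: cvg_trans H2; apply: near_eq_cvg; near=> r.
rewrite xi_version_nonneg//; near: r; exact: nbhs_left_ge.
Unshelve. all: by end_near. Qed.

(** The integrand of the Riemann sums, for [xi_version]. *)
Definition discount (t r : R) (w : T) : R := expR (- xi_version t w + xi_version r w).

Lemma measurable_discount t r : measurable_fun setT (discount t r).
Proof.
apply: measurableT_comp => //; apply: measurable_funD; last exact: measurable_xi_version.
by apply: measurable_funN; exact: measurable_xi_version.
Qed.

Hypothesis X1oo : {ae P, forall w, X1 t w @[t --> +oo] --> +oo}.

(** If [u <= 0], then [- r] lies in the window attached to the cell of [u],
    where [ae_levy_exp_dominated] applies. If [0 < u <= t], then [r] lies in
    [[-1, t]], where the path is bounded. *)
Lemma discount_dominated (t : R) : 0 <= t ->
  {ae P, forall w, exists (g : R -> R) (Mg Ng : R),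
    [/\ measurable_fun setT g, forall u, 0 <= g u <= Mg,
      (\int[@lebesgue_measure R]_u (g u)%:E <= Ng%:E)%E &
      forall r u, r < u <= r + 1 -> u <= t -> discount t r w <= g u]}.
Proof.
move=> t0.
have H := ae_levy_exp_dominated L1 L2 (two_sided_same_law hxi) X1oo.
have H2 : {ae P, forall w, X1 0 w = 0 /\ X2 0 w = 0}.
  by apply: filterS2 (levy_start L1) (levy_start L2) => w.
apply: filterS3 H H2 (levy_cadlag L1) => w [c [b [c0 cX cb]]] [X10 X20] c1.
have [M HM] := cadlag_bounded t c1.
have M0 : 0 <= M by apply: le_trans (HM 0 _); rewrite ?normr_ge0// lexx t0.
have [h [mh hb ih hc]] := step_majorant c0 cb.
pose A := expR (2 * M).
pose D : set R := `]0, t]%classic.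
have b0 : 0 <= b by have := cb 0%N; rewrite big_ord0.
have c0b : c 0%N <= b by have := cb 1%N; rewrite big_ord1.
exists (fun u => A * (h u + (1 + c 0%N) * \1_D u)), (A * (b + (1 + b))), (A * (b + (1 + c 0%N) * t)).
have mD : measurable D by exact: measurable_itv.
have A0 : 0 <= A by exact: expR_ge0.
have h0 u : 0 <= h u by case/andP: (hb u).
have m1 : measurable_fun setT (fun u : R => (1 + c 0%N) * \1_D u).
  by apply: measurable_funM => //; exact: measurable_indic.
have c10 : 0 <= 1 + c 0%N by rewrite addr_ge0.
split.
- by apply: measurable_funM => //; exact: measurable_funD.
- move=> u; case/andP: (hb u) => hu0 hub; rewrite mulr_ge0 ?addr_ge0 ?mulr_ge0//=.
  rewrite ler_wpM2l// lerD// indicE; case: (_ \in _); rewrite ?mulr1 ?mulr0 ?lerD2l//.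
  by rewrite addr_ge0.
- under eq_integral do rewrite EFinM.
  rewrite ge0_integralZl_EFin//; last 2 first.
  + by move=> u _; rewrite lee_fin addr_ge0// mulr_ge0.
  + by apply/measurable_EFinP; exact: measurable_funD.
  rewrite EFinM; apply: lee_wpmul2l; first by rewrite lee_fin.
  under eq_integral do rewrite EFinD.
  rewrite ge0_integralD//; last 4 first.
  + by move=> u _; rewrite lee_fin.
  + by apply/measurable_EFinP.
  + by move=> u _; rewrite lee_fin mulr_ge0.
  + by apply/measurable_EFinP.
  rewrite EFinD; apply: leeD => //.
  under eq_integral do rewrite EFinM.
  rewrite ge0_integralZl_EFin//; last by apply/measurable_EFinP; exact: measurable_indic.
  rewrite integral_indic// setIT EFinM; apply: lee_wpmul2l; first by rewrite lee_fin.
  rewrite [leLHS](@lebesgue_measure_itv R `]0, t])/= lte_fin.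
  by case: ifPn => _; rewrite ?oppr0 ?adde0 ?lee_fin// -EFinB subr0.
- move=> r u /andP[ru ur] ut.
  have rt : r <= t by apply: ltW; exact: lt_le_trans ut.
  have FE : discount t r w = expR (- X1 t w + X1 (Num.max r 0) w) * expR (- X2 (Num.max (- r) 0) w).
    rewrite /discount -expRD xi_version_nonneg// /xi_version X10 X20 !subr0; congr expR; ring.
  have F1 : expR (- X1 t w + X1 (Num.max r 0) w) <= A.
    rewrite ler_expR (_ : 2 * M = M + M); last by ring.
    apply: lerD; first by rewrite (le_trans (ler_norm _))// normrN HM// t0 lexx.
    by rewrite (le_trans (ler_norm _))// HM// le_max lexx orbT ge_max rt t0.
  have [u0|u0] := leP u 0.
    have r0 : r <= 0 by rewrite ltW// (lt_le_trans ru).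
    have /truncn_itv/andP[k1 k2] : 0 <= - u by rewrite oppr_ge0.
    set k := Num.truncn (- u) in k1 k2.
    rewrite FE ler_pM ?expR_ge0//; last first.
      apply: (@le_trans _ _ (c k)); last first.
        rewrite -[leLHS]addr0 lerD ?mulr_ge0// hc// lerNr k1 andbT ltrNl//.
      rewrite (max_idPl _) ?oppr_ge0//; apply: cX.
      by rewrite -natr1 in k2; apply/andP; split; lra.
  have uD : u \in D by rewrite inE /D /= in_itv/= u0 ut.
  rewrite FE ler_pM ?expR_ge0// indicE uD mulr1.
  apply: (@le_trans _ _ (1 + c 0%N)); last by rewrite lerDr.
  have [r0|r0] := leP 0 r.
    by rewrite (max_idPr _) ?oppr_le0// X20 oppr0 expR0 lerDl.
  rewrite (max_idPl _) ?oppr_ge0 ?(ltW r0)// -[leLHS]add0r lerD// cX//.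
  by apply/andP; split; lra.
Qed.

End two_sided.

(** * Second moments of the integrand *)

Section one_process.
Context {d : measure_display} {T : measurableType d} {R : realType}.
Variable P : probability T R.
Variable X : R -> {RV P >-> R}.
Hypothesis LX : levy_process X.
Hypothesis X2lt1 : (exp_moment X 2 1 < 1)%E.

Let exp_moment2fin : (exp_moment X 2 1 < +oo)%E.
Proof. exact: lt_trans X2lt1 (ltry _). Qed.

Lemma rate2_lt0 : rate X 2 < 0.
Proof.
rewrite /rate; apply: ln_lt0; have h := exp_moment_gt0 X 2 1.
have fi : exp_moment X 2 1 \is a fin_num by rewrite ge0_fin_numE ?exp_moment_ge0.
by rewrite -!lte_fin fineK// h.
Qed.

Lemma exp_sqint s : 0 <= s -> sqint P (fun w => expR (- X s w)).
Proof.
move=> s0; split.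
  by apply: measurableT_comp => //; exact: measurable_funN.
have -> : (\int[P]_w (expR (- X s w) ^+ 2)%:E = exp_moment X 2 s)%E.
  by apply: eq_integral => w _; rewrite -expRM_natl mulrN.
by rewrite (exp_momentE LX exp_moment2fin)// ltry.
Qed.

Lemma exp_moment1_fin : (exp_moment X 1 1 < +oo)%E.
Proof.
have := integrable_fin_num measurableT (sqint_integrable (exp_sqint ler01)).
rewrite ltey_eq => H; apply/orP; left; move: H; congr (_ \is a fin_num).
by apply: eq_integral => w _; rewrite /= mul1r.
Qed.

(** The integral is [exp (s a) - 2 exp (s b) + 1] with [a = rate X 2] and
    [b = rate X 1], where [exp (s a) <= 1] and [exp (s b) >= 1 + s b]. *)
Lemma exp_diff_sq_le s : 0 <= s ->
  (\int[P]_w ((expR (- X s w) - 1) ^+ 2)%:E <= (2 * s * `|rate X 1|)%:E)%E.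
Proof.
move=> s0; have hs := exp_sqint s0.
have i1 := sqint_integrable_sqr hs.
have i2 := sqint_integrable (sqintZ 2 hs).
have i3 := sqint_integrable (sqint_cst P 1).
have -> : (\int[P]_w ((expR (- X s w) - 1) ^+ 2)%:E =
   \int[P]_w ((expR (- X s w) ^+ 2)%:E - (2 * expR (- X s w))%:E + 1%:E))%E.
  by apply: eq_integral => w _; rewrite -EFinB -EFinD; congr EFin; ring.
rewrite integralD//; last exact: integrableB.
rewrite integralB// integral_prob_cst.
have -> : (\int[P]_w (expR (- X s w) ^+ 2)%:E = exp_moment X 2 s)%E.
  by apply: eq_integral => w _; rewrite -expRM_natl mulrN.
have -> : (\int[P]_w (2 * expR (- X s w))%:E = 2%:E * exp_moment X 1 s)%E.
  under eq_integral do rewrite EFinM.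
  rewrite integralZl//; last exact: sqint_integrable.
  by congr (_ * _)%E; apply: eq_integral => w _; rewrite mul1r.
rewrite (exp_momentE LX exp_moment2fin)// (exp_momentE LX exp_moment1_fin)// -EFinM -EFinB -EFinD lee_fin.
have h1 : expR (s * rate X 2) <= 1.
  by rewrite expR_le1 mulr_ge0_le0// ltW// rate2_lt0.
have h2 := expR_ge1Dx (s * rate X 1).
have h3 : - (s * rate X 1) <= s * `|rate X 1|.
  by rewrite -mulrN ler_wpM2l// -normrN ler_norm.
rewrite -mulrA; move: h1 h2 h3.
move: (expR (s * rate X 2)) (expR (s * rate X 1)) (s * rate X 1) (s * `|rate X 1|) => a b c e.
lra.
Qed.

End one_process.

Section moments.
Context {d : measure_display} {T : measurableType d} {R : realType}.
Variable P : probability T R.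
Variables (xi : R -> T -> R) (X1 X2 : R -> {RV P >-> R}).
Hypothesis hxi : two_sided_levy_process xi X1 X2.
Let L1 : levy_process X1. Proof. by case: hxi. Qed.
Let L2 : levy_process X2. Proof. by case: hxi. Qed.
Hypothesis X1lt1 : (exp_moment X1 2 1 < 1)%E.

Lemma exp_moment_same th : exp_moment X2 th 1 = exp_moment X1 th 1.
Proof.
rewrite /exp_moment; apply: (@same_law_integral _ _ _ P _ _ (X2 1) (X1 1) (fun x => (expR (- (th * x)))%:E)) => //.
- move=> B mB; have := two_sided_same_law hxi 1 (t := fun=> 1) (A := fun=> B).
  move=> /(_ (fun=> ler01) (fun=> mB)).
  have E (X : R -> {RV P >-> R}) : \bigcap_(i in `I_1) (X 1 @^-1` B) = X 1 @^-1` B.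
    by apply/seteqP; split => [w /(_ 0%N isT)|w Bw i _].
  by rewrite !E.
- exact: measurable_expN.
Qed.

Lemma exp_moment2_X2 : (exp_moment X2 2 1 < 1)%E. Proof. by rewrite exp_moment_same. Qed.

Lemma rate_same th : rate X2 th = rate X1 th.
Proof. by rewrite /rate exp_moment_same. Qed.

Definition incr_sigma (X : R -> {RV P >-> R}) : set (set T) :=
  [set A | exists t B, [/\ 0 <= t, measurable B & A = X t @^-1` B]].

Lemma measurable_incr_sigma (X : R -> {RV P >-> R}) a b : 0 <= a -> 0 <= b ->
  measurable_fun setT (fun w : g_sigma_algebraType (incr_sigma X) => X b w - X a w).
Proof.
have H s : 0 <= s -> measurable_fun setT (fun w : g_sigma_algebraType (incr_sigma X) => X s w).
  move=> s0 _ A mA; rewrite setTI; apply: sub_sigma_algebra.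
  by exists s, A.
by move=> a0 b0; apply: measurable_funB; exact: H.
Qed.

Lemma two_sided_indep_integral (f g : T -> R) :
  measurable_fun setT (f : g_sigma_algebraType (incr_sigma X1) -> R) ->
  measurable_fun setT (g : g_sigma_algebraType (incr_sigma X2) -> R) ->
  measurable_fun setT f -> measurable_fun setT g ->
  (forall w, 0 <= f w) -> (forall w, 0 <= g w) ->
  (\int[P]_w (f w * g w)%:E = (\int[P]_w (f w)%:E) * \int[P]_w (g w)%:E)%E.
Proof.
move=> mf1 mg2 mf mg f0 g0.
transitivity (\int[P]_w (`|f w|%:E * `|g w|%:E))%E.
  by apply: eq_integral => w _; rewrite EFinM !ger0_norm.
rewrite (@independent_integral _ _ _ P _ _ _ _ f g (fun x => `|x|%:E) (fun x => `|x|%:E))//.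
- by congr (_ * _)%E; apply: eq_integral => w _; rewrite ger0_norm.
- move=> A B mA mB; apply: (two_sided_independent hxi).
  + by have := mf1 measurableT A mA; rewrite setTI.
  + by have := mg2 measurableT B mB; rewrite setTI.
- by apply/measurable_EFinP; exact: normr_measurable.
- by apply/measurable_EFinP; exact: normr_measurable.
Qed.

Let rho : R := rate X1 2.

Let fin2 : (exp_moment X1 2 1 < +oo)%E. Proof. exact: lt_trans X1lt1 (ltry _). Qed.
Let fin2' : (exp_moment X2 2 1 < +oo)%E. Proof. exact: lt_trans exp_moment2_X2 (ltry _). Qed.

Lemma incr_exp2 (X : R -> {RV P >-> R}) (a b : R) : levy_process X -> 0 <= a <= b ->
  (\int[P]_w (expR (- (2 * (X b w - X a w))))%:E = exp_moment X 2 (b - a))%E.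
Proof.
move=> LX ab; rewrite (@levy_incr_integral _ _ _ P X LX a b (fun x => (expR (- (2 * x)))%:E))//.
exact: measurable_expN.
Qed.

Lemma discount_nonneg t r w : 0 <= t -> 0 <= r -> discount X1 X2 t r w = expR (- (X1 t w - X1 r w)).
Proof.
by move=> t0 r0; rewrite /discount !xi_version_nonneg//; congr expR; ring.
Qed.

Lemma discount_nonpos t r w : 0 <= t -> r <= 0 ->
  discount X1 X2 t r w = expR (- (X1 t w - X1 0 w)) * expR (- (X2 (- r) w - X2 0 w)).
Proof.
by move=> t0 r0; rewrite /discount xi_version_nonneg// xi_version_nonpos// -expRD; congr expR; ring.
Qed.

Lemma sqr_expR (x : R) : expR (- x) ^+ 2 = expR (- (2 * x)).
Proof. by rewrite -expRM_natl mulrN. Qed.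

Lemma discount_sqr t r : 0 <= t -> r <= t ->
  (\int[P]_w (discount X1 X2 t r w ^+ 2)%:E = (expR ((t - r) * rho))%:E)%E.
Proof.
move=> t0 rt; have [r0|r0] := leP 0 r.
  under eq_integral do rewrite discount_nonneg// sqr_expR.
  by rewrite incr_exp2 ?r0// (exp_momentE L1 fin2)// subr_ge0.
have r0' : 0 <= - r by rewrite oppr_ge0 ltW.
under eq_integral do rewrite discount_nonpos ?(ltW r0)// exprMn !sqr_expR.
rewrite (@two_sided_indep_integral (fun w => expR (- (2 * (X1 t w - X1 0 w))))
  (fun w => expR (- (2 * (X2 (- r) w - X2 0 w))))).
- rewrite !incr_exp2 ?lexx ?t0// (exp_momentE L1 fin2) ?subr0// (exp_momentE L2 fin2')// rate_same -/rho.
  by rewrite -EFinM -expRD; congr (expR _)%:E; ring.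
- apply: measurableT_comp => //; apply: measurable_funN; apply: measurable_funM => //.
  exact: measurable_incr_sigma.
- apply: measurableT_comp => //; apply: measurable_funN; apply: measurable_funM => //.
  exact: measurable_incr_sigma.
- apply: measurableT_comp => //; apply: measurable_funN; apply: measurable_funM => //.
  exact: measurable_incr.
- apply: measurableT_comp => //; apply: measurable_funN; apply: measurable_funM => //.
  exact: measurable_incr.
- by move=> w; exact: expR_ge0.
- by move=> w; exact: expR_ge0.
Qed.

Lemma discount_sqint t r : 0 <= t -> r <= t -> sqint P (discount X1 X2 t r).
Proof.
move=> t0 rt; split; first exact: measurable_discount.
by rewrite discount_sqr// ltry.
Qed.

Let theta : R := `|rate X1 1|.

Lemma incr_diff_exp2 (X : R -> {RV P >-> R}) (a b c : R) : levy_process X ->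
  (exp_moment X 2 1 < 1)%E -> 0 <= a -> a <= b -> b <= c ->
  (\int[P]_w ((expR (- (X b w - X a w)) - 1) ^+ 2 * expR (- (2 * (X c w - X b w))))%:E <=
   (2 * (b - a) * `|rate X 1|)%:E * exp_moment X 2 (c - b))%E.
Proof.
move=> LX lt1 a0 ab bc.
under eq_integral do rewrite EFinM.
rewrite (@levy_incr2_integral _ _ _ P X LX a b c (fun x => ((expR (- x) - 1) ^+ 2)%:E)
  (fun x => (expR (- (2 * x)))%:E))//; last 2 first.
- by move=> x; rewrite lee_fin sqr_ge0.
- exact: measurable_expN.
- by apply: lee_wpmul2r; [exact: exp_moment_ge0|apply: exp_diff_sq_le; rewrite ?subr_ge0].
- apply/measurable_EFinP; apply: measurable_funX; apply: measurable_funB => //.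
  by apply: measurableT_comp => //; exact: measurable_funN.
Qed.

Lemma discount_diff_nonneg t r r' : 0 <= r -> r <= r' -> r' <= t ->
  (\int[P]_w ((discount X1 X2 t r w - discount X1 X2 t r' w) ^+ 2)%:E <=
   (2 * (r' - r) * theta * expR ((t - r') * rho))%:E)%E.
Proof.
move=> r0 rr' rt; have r'0 := le_trans r0 rr'; have t0 := le_trans r'0 rt.
rewrite [leRHS]EFinM -(exp_momentE L1 fin2) ?subr_ge0//.
apply: le_trans (incr_diff_exp2 L1 X1lt1 r0 rr' rt).
rewrite le_eqVlt; apply/orP; left; apply/eqP; apply: eq_integral => w _; congr EFin.
rewrite !discount_nonneg// -sqr_expR -exprMn mulrBl mul1r -expRD; congr ((expR _ - _) ^+ _).
ring.
Qed.

(** The difference is a product of three independent factors: one of [X1] up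
    to [t], and two of [X2], up to [- r'] and between [- r'] and [- r]. *)
Lemma discount_diff_nonpos t r r' : 0 <= t -> r <= r' -> r' <= 0 ->
  (\int[P]_w ((discount X1 X2 t r w - discount X1 X2 t r' w) ^+ 2)%:E <=
   (2 * (r' - r) * theta * expR ((t - r') * rho))%:E)%E.
Proof.
move=> t0 rr' r'0; have r0 := le_trans rr' r'0.
have nr'0 : 0 <= - r' by rewrite oppr_ge0.
have nr0 : 0 <= - r by rewrite oppr_ge0.
pose f w := expR (- (2 * (X1 t w - X1 0 w))).
pose g w := expR (- (2 * (X2 (- r') w - X2 0 w))) * (expR (- (X2 (- r) w - X2 (- r') w)) - 1) ^+ 2.
have -> : (\int[P]_w ((discount X1 X2 t r w - discount X1 X2 t r' w) ^+ 2)%:E = \int[P]_w (f w * g w)%:E)%E.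
  apply: eq_integral => w _; congr EFin; rewrite !discount_nonpos// -mulrBr exprMn sqr_expR.
  have -> : expR (- (X2 (- r) w - X2 0 w)) - expR (- (X2 (- r') w - X2 0 w)) =
      expR (- (X2 (- r') w - X2 0 w)) * (expR (- (X2 (- r) w - X2 (- r') w)) - 1).
    by rewrite mulrBr mulr1 -expRD; congr (expR _ - _); ring.
  by rewrite exprMn sqr_expR.
have me (X : R -> {RV P >-> R}) c a b : 0 <= a -> 0 <= b ->
    measurable_fun setT (fun w : g_sigma_algebraType (incr_sigma X) => expR (- (c * (X b w - X a w)))).
  move=> a0 b0; apply: measurableT_comp => //; apply: measurable_funN; apply: measurable_funM => //.
  exact: measurable_incr_sigma.
have me' (X : R -> {RV P >-> R}) c a b :
    measurable_fun setT (fun w => expR (- (c * (X b w - X a w)))).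
  apply: measurableT_comp => //; apply: measurable_funN; apply: measurable_funM => //.
  exact: measurable_incr.
rewrite two_sided_indep_integral; [|exact: me| |exact: me'| | |]; last 4 first.
- apply: measurable_funM; first exact: me.
  apply: measurable_funX; apply: measurable_funB => //.
  by have := me X2 1 (- r') (- r) nr'0 nr0; under eq_fun do rewrite mul1r.
- apply: measurable_funM; first exact: me'.
  apply: measurable_funX; apply: measurable_funB => //.
  by have := me' X2 1 (- r') (- r); under eq_fun do rewrite mul1r.
- by move=> w; exact: expR_ge0.
- by move=> w; rewrite mulr_ge0 ?expR_ge0 ?sqr_ge0.
rewrite incr_exp2 ?lexx ?t0// subr0 (exp_momentE L1 fin2)//.
under eq_integral do rewrite EFinM.
rewrite (@levy_incr2_integral _ _ _ P X2 L2 0 (- r') (- r)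
  (fun x => (expR (- (2 * x)))%:E) (fun x => ((expR (- x) - 1) ^+ 2)%:E))//; last 4 first.
- by rewrite lerN2.
- exact: measurable_expN.
- apply/measurable_EFinP; apply: measurable_funX; apply: measurable_funB => //.
  by apply: measurableT_comp => //; exact: measurable_funN.
- by move=> x; rewrite lee_fin sqr_ge0.
rewrite subr0 -/(exp_moment X2 2 (- r')) (exp_momentE L2 fin2')// rate_same -/rho muleA -EFinM -expRD.
have dr : 0 <= - r - - r' by rewrite subr_ge0 lerN2.
apply: (@le_trans _ _ ((expR (t * rho + - r' * rho))%:E * (2 * (- r - - r') * theta)%:E)%E).
  apply: lee_wpmul2l; first by rewrite lee_fin expR_ge0.
  by apply: le_trans (exp_diff_sq_le L2 exp_moment2_X2 dr) _; rewrite rate_same.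
rewrite -EFinM lee_fin le_eqVlt; apply/orP; left; apply/eqP.
by rewrite opprK (addrC (- r)) mulrC -mulrDl.
Qed.

(** An interval that contains [0] is cut there, since the two half lines carry
    independent processes. *)
Lemma discount_diff t r r' : 0 <= t -> r <= r' -> r' <= t ->
  (\int[P]_w ((discount X1 X2 t r w - discount X1 X2 t r' w) ^+ 2)%:E <=
   (4 * (r' - r) * theta * expR ((t - r') * rho))%:E)%E.
Proof.
move=> t0 rr' rt.
have th0 : 0 <= theta by exact: normr_ge0.
have e0 := expR_ge0 ((t - r') * rho).
have le24 : ((2 * (r' - r) * theta * expR ((t - r') * rho))%:E <=
    (4 * (r' - r) * theta * expR ((t - r') * rho))%:E)%E.
  rewrite lee_fin; apply: ler_wpM2r => //; apply: ler_wpM2r => //.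
  by apply: ler_wpM2r; [rewrite subr_ge0|lra].
have [r0|r0] := leP 0 r; first exact: le_trans (discount_diff_nonneg r0 rr' rt) le24.
have [r'0|r'0] := leP r' 0; first exact: le_trans (discount_diff_nonpos t0 rr' r'0) le24.
have H1 := discount_diff_nonpos t0 (ltW r0) (lexx 0).
have H2 := discount_diff_nonneg (lexx 0) (ltW r'0) rt.
have m1 a b : measurable_fun setT (fun w => (2 * (discount X1 X2 t a w - discount X1 X2 t b w) ^+ 2)%:E).
  apply/measurable_EFinP; apply: measurable_funM => //; apply: measurable_funX.
  by apply: measurable_funB; exact: measurable_discount.
apply: (@le_trans _ _ (\int[P]_w ((2 * (discount X1 X2 t r w - discount X1 X2 t 0 w) ^+ 2)%:E +
   (2 * (discount X1 X2 t 0 w - discount X1 X2 t r' w) ^+ 2)%:E))%E).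
  apply: ge0_le_integral => //.
  - by move=> w _; rewrite lee_fin sqr_ge0.
  - apply/measurable_EFinP; apply: measurable_funX.
    by apply: measurable_funB; exact: measurable_discount.
  - by apply: emeasurable_funD; exact: m1.
  - move=> w _; rewrite -EFinD lee_fin.
    set a := discount _ _ _ r _; set b := discount _ _ _ 0 _; set c := discount _ _ _ r' _.
    (* This is [(a - c)^2 <= 2 (a - b)^2 + 2 (b - c)^2], which accounts for
       the constant [4]. *)
    by have := sqr_ge0 (a - b - (b - c)); nra.
rewrite ge0_integralD//; last 2 first.
- by move=> w _; rewrite lee_fin mulr_ge0// sqr_ge0.
- by move=> w _; rewrite lee_fin mulr_ge0// sqr_ge0.
have m2 a b : measurable_fun setT (fun w => ((discount X1 X2 t a w - discount X1 X2 t b w) ^+ 2)%:E).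
  by apply/measurable_EFinP; apply: measurable_funX; apply: measurable_funB; exact: measurable_discount.
under eq_integral do rewrite EFinM.
rewrite ge0_integralZl_EFin//; last by move=> w _; rewrite lee_fin sqr_ge0.
under [X in (_ + X)%E]eq_integral do rewrite EFinM.
rewrite [X in (_ + X)%E]ge0_integralZl_EFin//; last by move=> w _; rewrite lee_fin sqr_ge0.
apply: (@le_trans _ _ (2%:E * (2 * (0 - r) * theta * expR ((t - 0) * rho))%:E +
   2%:E * (2 * (r' - 0) * theta * expR ((t - r') * rho))%:E)%E).
  by apply: leeD; apply: lee_wpmul2l.
rewrite -!EFinM -EFinD lee_fin.
have h : expR ((t - 0) * rho) <= expR ((t - r') * rho).
  rewrite ler_expR; have := rate2_lt0 X1lt1; rewrite -/rho => rho0; nra.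
have h2 := ler_wpM2l (_ : 0 <= - r * theta) h.
have {}h2 : - r * theta * expR ((t - 0) * rho) <= - r * theta * expR ((t - r') * rho).
  by apply: h2; rewrite mulr_ge0// oppr_ge0 ltW.
lra.
Qed.

End moments.

(** * Convergence in probability *)

Lemma ge0_cvge0P {R : realType} (a : nat -> \bar R) : (forall n, 0 <= a n)%E ->
  a n @[n --> \oo] --> 0%E <-> forall dl : R, 0 < dl -> \forall n \near \oo, (a n <= dl%:E)%E.
Proof.
move=> a0; split=> [a_cvg dl dl0|H].
  have [af fa] := (fine_cvgP _ _).1 a_cvg.
  near=> n; rewrite -(@fineK _ (a n)); last by near: n.
  rewrite lee_fin; near: n; exact: (cvgr_le _ fa).
apply/fine_cvgP; split.
  have := H 1 ltr01; apply: filterS => n an.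
  by rewrite ge0_fin_numE// (le_lt_trans an)// ltry.
apply/cvgr0Pnorm_le => dl dl0; have := H dl dl0; apply: filterS => n an.
by rewrite ger0_norm ?fine_ge0// -lee_fin fineK// ge0_fin_numE// (le_lt_trans an)// ltry.
Unshelve. all: by end_near. Qed.

Section convergence_in_probability.
Context {d : measure_display} {T : measurableType d} {R : realType}.
Variable P : probability T R.
Implicit Types (Z : nat -> T -> R) (X Y W : T -> R).

Lemma measurable_far X Y (e : R) : measurable_fun setT X -> measurable_fun setT Y ->
  measurable [set w | e < `|X w - Y w|].
Proof.
move=> mX mY; apply: measurable_superlevel.
by apply: measurableT_comp => //; exact: measurable_funB.
Qed.

Definition cauchy_in_probability Z : Prop := forall e dl : R, 0 < e -> 0 < dl ->
  exists N : nat, forall n m, (N <= n)%N -> (N <= m)%N ->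
    (P [set w | (e < `|Z n w - Z m w|)%R] <= dl%:E)%E.

Lemma far_triangle X Y W (e : R) : measurable_fun setT X -> measurable_fun setT Y ->
  measurable_fun setT W ->
  (P [set w | (e < `|X w - Y w|)%R] <=
   P [set w | (e / 2 < `|X w - W w|)%R] + P [set w | (e / 2 < `|W w - Y w|)%R])%E.
Proof.
move=> mX mY mW; apply: le_trans (measureU2 _ _ _); last 2 first.
- exact: measurable_far.
- exact: measurable_far.
apply: le_measure; rewrite ?inE; [exact: measurable_far|apply: measurableU; exact: measurable_far|].
move=> w /= ew; have [h|h] := ltP (e / 2) `|X w - W w|; [by left|right => /=].
rewrite ltNge; apply/negP => h2; move: ew; rewrite ltNge => /negP; apply.
rewrite (_ : X w - Y w = (X w - W w) + (W w - Y w)); last by ring.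
apply: (le_trans (ler_normD _ _)); lra.
Qed.

(** Borel-Cantelli's lemma for a subsequence of which consecutive terms are
    more than [2^-k] apart with probability at most [2^-k]. *)
Lemma cauchy_subsequence Z : (forall n, measurable_fun setT (Z n)) ->
  cauchy_in_probability Z ->
  exists phi : nat -> nat, (forall k, (k <= phi k)%N) /\
    {ae P, forall w, cvg (Z (phi k) w @[k --> \oo])}.
Proof.
move=> mZ cZ.
have e0 k : 0 < 2 ^- k :> R by rewrite invr_gt0 exprn_gt0.
have [N HN] := choice (fun k => cZ _ _ (e0 k) (e0 k)).
(* The sum makes [phi] nondecreasing and at least [N k]. *)
pose phi k := (\sum_(j < k.+1) N j + k)%N.
have phiS k : (phi k <= phi k.+1)%N by rewrite /phi [X in (_ <= X + _)%N]big_ord_recr/=; lia.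
have phiN k : (N k <= phi k)%N by rewrite /phi big_ord_recr/=; lia.
exists phi; split; first by move=> k; rewrite /phi; lia.
pose E k := [set w | 2 ^- k < `|Z (phi k) w - Z (phi k.+1) w|].
have mE k : measurable (E k) by exact: measurable_far.
have PE k : (P (E k) <= (2 ^- k)%:E)%E.
  by apply: HN => //; exact: (leq_trans (phiN k) (phiS k)).
have half : `|2^-1 : R| < 1 by rewrite ger0_norm ?invr_ge0// invf_lt1// ltr1n.
have sE : (\sum_(k <oo) P (E k) < +oo)%E.
  apply: (@le_lt_trans _ _ (1 / (1 - 2^-1))%R%:E); last exact: ltry.
  apply: lime_le; first by apply: is_cvg_nneseries => k _ _; exact: measure_ge0.
  apply: nearW => n; rewrite big_mkord.
  apply: (@le_trans _ _ (\sum_(k < n) (2 ^- k)%:E)%E); first by apply: lee_sum => k _; exact: PE.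
  rewrite sumEFin lee_fin.
  have := @geometric_le_lim R n 1 (2^-1) ler01 _ half.
  rewrite invr_gt0 => /(_ (ltr0n _ 2)); apply: le_trans.
  rewrite /series /= big_mkord; apply: ler_sum => k _.
  by rewrite mul1r exprVn.
have E0 := lim_sup_set_cvg0 mE sE.
exists (lim_sup_set E); split => //.
  apply: bigcap_measurableType => n _; apply: bigcup_measurable => k _; exact: mE.
move=> w nc; apply: contrapT => nE; apply: nc => /=.
have [K HK] : exists K, forall k, (K <= k)%N -> `|Z (phi k) w - Z (phi k.+1) w| <= 2 ^- k.
  apply: contrapT => nK; apply: nE => n _.
  apply: contrapT => nU; apply: nK; exists n => k nk.
  by rewrite leNgt; apply/negP => Ek; apply: nU; exists k.
have tail k j : (K <= k)%N -> `|Z (phi k) w - Z (phi (k + j)%N) w| <= 2 * 2 ^- k - 2 * 2 ^- (k + j).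
  move=> Kk; elim: j => [|j IH]; first by rewrite addn0 !subrr normr0.
  rewrite (_ : Z (phi k) w - Z (phi (k + j.+1)%N) w = (Z (phi k) w - Z (phi (k + j)%N) w)
    + (Z (phi (k + j)%N) w - Z (phi (k + j.+1)%N) w)); last by ring.
  apply: (le_trans (ler_normD _ _)).
  have h := HK (k + j)%N (leq_trans Kk (leq_addr _ _)).
  rewrite addnS.
  have -> : 2 ^- (k + j).+1 = 2 ^- (k + j) / 2 :> R by rewrite exprS invfM mulrC.
  by move: IH h; set a := `|_|; set b := `|_|; lra.
apply: cauchy_cvg; apply: cauchy_exP => e e1.
have [l [Kl le]] : exists l, (K <= l)%N /\ 2 * 2 ^- l < e.
  have := @cvg_expr R (2^-1) half.
  have e2 : 0 < e / 2 by rewrite divr_gt0.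
  move=> /cvgrPdist_lt/(_ _ e2)[l _ Hl].
  exists (maxn K l); split; first exact: leq_maxl.
  have := Hl (maxn K l) (leq_maxr _ _).
  rewrite sub0r normrN ger0_norm ?exprn_ge0 ?invr_ge0// exprVn; lra.
exists (Z (phi l) w).
suff : \forall k \near \oo, ball (Z (phi l) w) e (Z (phi k) w) by [].
exists l => // k /= lk; rewrite /ball /=.
rewrite -(subnKC lk); apply: (le_lt_trans (tail l _ Kl)).
by have := e0 (l + (k - l))%N; lra.
Qed.

(** If [X] is far from the limit [Y], it is far from all late terms of the
    subsequence. *)
Lemma fatou_in_probability Z (phi : nat -> nat) X Y (e : R) (dl : \bar R) :
  (forall n, measurable_fun setT (Z n)) -> measurable_fun setT X -> measurable_fun setT Y ->
  (forall k, (k <= phi k)%N) ->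
  {ae P, forall w, Z (phi k) w @[k --> \oo] --> Y w} ->
  (\forall m \near \oo, P [set w | (e < `|X w - Z m w|)%R] <= dl)%E ->
  (P [set w | (e < `|X w - Y w|)%R] <= dl)%E.
Proof.
move=> mZ mX mY phik ZY [M _ HM].
pose F K := \bigcap_(k in [set k | (K <= k)%N]) [set w | e < `|X w - Z (phi k) w|].
have mF K : measurable (F K).
  by apply: bigcap_measurableType => k _; exact: measurable_far.
have mU : measurable (\bigcup_K F K) by exact: bigcup_measurable.
have c : P (F K) @[K --> \oo] --> P (\bigcup_K F K).
  apply: nondecreasing_cvg_mu => //.
  apply/nondecreasing_seqP => K; rewrite subsetEset => w Hw k /= Kk.
  by apply: Hw => /=; rewrite ltnW.
have PU : (P (\bigcup_K F K) <= dl)%E.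
  apply: (cvge_le _ c).
  near=> K; apply: (@le_trans _ _ (P [set w | (e < `|X w - Z (phi (maxn K M)) w|)%R])).
    apply: le_measure; rewrite ?inE//; first exact: measurable_far.
    by move=> w Hw; apply: (Hw (maxn K M)) => /=; exact: leq_maxl.
  by apply: HM => /=; apply: leq_trans (phik _); exact: leq_maxr.
apply: le_trans PU.
have [N [mN N0 sN]] := ZY.
apply: (@le_trans _ _ (P ((\bigcup_K F K) `|` N))).
  apply: le_measure; rewrite ?inE; [exact: measurable_far|exact: measurableU|].
  move=> w /= ew; apply: contrapT => /not_orP[nF nN].
  have Zw : Z (phi k) w @[k --> \oo] --> Y w by apply: contrapT => /sN.
  have c2 : `|X w - Z (phi k) w| @[k --> \oo] --> `|X w - Y w|.
    by apply: cvg_norm; apply: cvgB => //; exact: cvg_cst.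
  move: c2 => /cvgr_gt/(_ _ ew)[K _ HK].
  by apply: nF; exists K => // k /= Kk; exact: HK.
apply: (le_trans (measureU2 _ _ _)) => //.
by rewrite [X in (_ + X)%E]N0 adde0.
Unshelve. all: by end_near. Qed.

(** The almost surely convergent subsequence is part of the conclusion,
    because Fatou's lemma will be applied along it. *)
Lemma cauchy_in_probability_cvg Z : (forall n, measurable_fun setT (Z n)) ->
  cauchy_in_probability Z ->
  exists (Y : T -> R) (phi : nat -> nat), [/\ measurable_fun setT Y,
    forall k, (k <= phi k)%N,
    {ae P, forall w, Z (phi k) w @[k --> \oo] --> Y w} &
    cvg_in_probability P Z Y].
Proof.
move=> mZ cZ; have [phi [phik cphi]] := cauchy_subsequence mZ cZ.
pose Y w := fine (limn_esup (fun k => (Z (phi k) w)%:E)).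
have mY : measurable_fun setT Y.
  apply: measurableT_comp => //.
  by apply: measurable_fun_limn_esup => k; exact/measurable_EFinP.
have ZY : {ae P, forall w, Z (phi k) w @[k --> \oo] --> Y w}.
  apply: filterS cphi => w /cvg_ex[l Zl].
  suff -> : Y w = l by [].
  rewrite /Y; have : (Z (phi k) w)%:E @[k --> \oo] --> l%:E.
    by apply: cvg_EFin => //; exact: nearW.
  by move=> /cvg_limn_einf_sup[_ ->].
exists Y, phi; split => // e e0.
apply/ge0_cvge0P => // dl dl0; have [N HN] := cZ e dl e0 dl0.
exists N => // n /= Nn; apply: (fatou_in_probability mZ (mZ n) mY phik ZY).
by exists N => // m /= Nm; exact: HN.
Qed.

Lemma cvg_in_probability_unique Z X Y : (forall n, measurable_fun setT (Z n)) ->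
  measurable_fun setT X -> measurable_fun setT Y ->
  cvg_in_probability P Z X -> cvg_in_probability P Z Y -> {ae P, forall w, X w = Y w}.
Proof.
move=> mZ mX mY ZX ZY.
have H0 (e : R) : 0 < e -> P [set w | e < `|X w - Y w|] = 0%E.
  move=> e0; have e2 : 0 < e / 2 by rewrite divr_gt0.
  apply/eqP; rewrite eq_le measure_ge0 andbT.
  have c : (P [set w | (e / 2 < `|Z n w - X w|)%R] + P [set w | (e / 2 < `|Z n w - Y w|)%R])%E
     @[n --> \oo] --> (0 + 0)%E.
    by apply: cvgeD => //; [exact: ZX|exact: ZY].
  rewrite -[X in (_ <= X)%E](adde0 0).
  apply: (cvge_ge _ c); apply: nearW => n.
  have -> : [set w | e / 2 < `|Z n w - X w|] = [set w | e / 2 < `|X w - Z n w|].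
    by apply/seteqP; split => w /=; rewrite distrC.
  exact: far_triangle.
have : {ae P, forall w, forall j : nat, ~ (j.+1%:R^-1 < `|X w - Y w|)}.
  apply: ae_foralln => j; exists [set w | j.+1%:R^-1 < `|X w - Y w|]; split.
  - exact: measurable_far.
  - by apply: H0; rewrite invr_gt0.
  - by move=> w /= /contrapT.
apply: filterS => w H; apply/eqP; rewrite -subr_eq0 -normr_le0.
apply/ler_addgt0Pr => e e0; rewrite add0r leNgt; apply/negP => eX.
have [j je] : exists j : nat, j.+1%:R^-1 < e.
  by have [k] := ltr_add_invr e0; rewrite add0r; exists k.
by apply: (H j); exact: lt_trans eX.
Qed.

End convergence_in_probability.

(** * Step functions *)

Section steps.
Context {R : realType}.
Local Notation mu := (@lebesgue_measure R).

Definition stepf (n : nat) (x : nat -> R) (f : R -> R) (v : R) : R :=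
  \sum_(i < n) f (x i) * \1_`]x i, x i.+1] v.

Lemma measurable_stepf n x f : measurable_fun setT (stepf n x f).
Proof.
apply: measurable_sum => i; apply: measurable_funM => //.
Qed.

Section cells.
Variables (n : nat) (x : nat -> R).
Hypothesis xi : forall i, (i < n)%N -> x i < x i.+1.

Lemma grid_le i j : (i <= j)%N -> (j <= n)%N -> x i <= x j.
Proof.
move=> ij; elim: j ij => [|j IH]; first by rewrite leqn0 => /eqP ->.
rewrite leq_eqVlt => /predU1P[->//|ij] jn.
by apply: le_trans (ltW (xi jn)); apply: IH => //; exact: ltnW.
Qed.

Lemma grid_cell v : x 0%N < v <= x n -> exists2 i, (i < n)%N & x i < v <= x i.+1.
Proof.
move=> /andP[v0 vn].
have ex : exists i, v <= x i by exists n.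
case: (ex_minnP ex) => -[|i] vi imin; first by rewrite ltNge vi in v0.
exists i; first by apply: imin.
rewrite vi andbT ltNge; apply/negP => /imin; lia.
Qed.

Lemma stepf_cell f v i : (i < n)%N -> x i < v <= x i.+1 -> stepf n x f v = f (x i).
Proof.
move=> i_n vi; rewrite /stepf (bigD1 (Ordinal i_n))//= indicE mem_set/=; last by rewrite in_itv.
rewrite mulr1 big1 ?addr0// => j /eqP ji; rewrite indicE memNset ?mulr0//= in_itv/=.
move=> /andP[jv vj]; case/andP: vi => iv vi; apply: ji; apply: val_inj => /=.
have [ij|ji|//] := ltngtP (nat_of_ord j) i.
- have := @grid_le j.+1 i ij (ltnW i_n) => h; exfalso; lra.
- have := @grid_le i.+1 j ji (ltnW (ltn_ord j)) => h; exfalso; lra.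
Qed.

Lemma stepf_out f v : ~~ (x 0%N < v <= x n) -> stepf n x f v = 0.
Proof.
move=> nv; rewrite /stepf big1// => j _; rewrite indicE memNset ?mulr0//= in_itv/= => /andP[jv vj].
move/negP: nv; apply; apply/andP; split.
  by apply: le_lt_trans jv; apply: grid_le => //; exact: ltnW.
by apply: (le_trans vj); apply: grid_le => //; exact: ltn_ord.
Qed.

End cells.

(** Coefficients and cells of the difference of two step functions, indexed by
    a sum type. The cells of the two partitions overlap, which quadratic forms
    permit; no common refinement is needed. *)
Definition diff_coef n m (a : 'I_n -> R) (b : 'I_m -> R) (k : 'I_n + 'I_m) : R :=
  match k with inl i => a i | inr j => - b j end.

Definition join_pt n m (x y : nat -> R) (k : 'I_n + 'I_m) : R :=
  match k with inl i => x i | inr j => y j end.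

Definition join_ptS n m (x y : nat -> R) (k : 'I_n + 'I_m) : R :=
  match k with inl i => x i.+1 | inr j => y j.+1 end.

Lemma dominated_to0 (e : nat -> R -> R) (g : R -> R) (Ng : R) :
  (forall n, measurable_fun setT (e n)) -> measurable_fun setT g ->
  (forall n v, 0 <= e n v) -> (forall n v, e n v <= g v) ->
  (\int[mu]_v (g v)%:E <= Ng%:E)%E ->
  (forall v, e n v @[n --> \oo] --> 0) ->
  forall eta : R, 0 < eta -> \forall n \near \oo, (\int[mu]_v (e n v)%:E <= eta%:E)%E.
Proof.
move=> me mg e0 eg ig ecv eta eta0.
have g0 v : 0 <= g v by exact: le_trans (e0 0%N v) (eg 0%N v).
have Ig : mu.-integrable setT (EFin \o g).
  apply/integrableP; split; first exact/measurable_EFinP.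
  by under eq_integral do rewrite gee0_abs ?lee_fin//; exact: le_lt_trans ig (ltry _).
have me' n : measurable_fun setT (fun v => (e n v)%:E) by apply/measurable_EFinP; exact: me.
have c0 v : (e n v)%:E @[n --> \oo] --> 0%E.
  by apply: cvg_EFin; [exact: nearW|exact: ecv].
have H : (\int[mu]_v (e n v)%:E)%E @[n --> \oo] --> 0%E.
  have [|||||_ _] := @dominated_convergence _ _ R mu setT measurableT
      (fun n v => (e n v)%:E) (cst 0%E) (EFin \o g).
  - by move=> n; exact: me'.
  - exact: measurable_cst.
  - by apply: aeW => v _; exact: c0.
  - exact: Ig.
  - by apply: aeW => v n _; rewrite gee0_abs ?lee_fin.
  by rewrite integral0.
have Ifin n : (\int[mu]_v (e n v)%:E)%E \is a fin_num.
  rewrite ge0_fin_numE; last by apply: integral_ge0 => v _; rewrite lee_fin.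
  apply: le_lt_trans (le_lt_trans ig (ltry _)); apply: ge0_le_integral => //.
  - by move=> v _; rewrite lee_fin.
  - by apply/measurable_EFinP; exact: me.
  - by apply/measurable_EFinP; exact: mg.
  - by move=> v _; rewrite lee_fin.
have H2 : fine (\int[mu]_v (e n v)%:E)%E @[n --> \oo] --> (0 : R) by exact: (fine_cvg H).
have H3 := cvgr_le _ H2 _ eta0.
near=> n; rewrite -(fineK (Ifin n)) lee_fin; near: n; exact: H3.
Unshelve. all: by end_near. Qed.

End steps.

(** * Sums of increments with random coefficients *)

Section random_sums.
Context {d1 d2 : measure_display} {T1 : measurableType d1} {T2 : measurableType d2}
  {R : realType} (P1 : probability T1 R) (P2 : probability T2 R).
Variables (H : R) (B : R -> {RV P2 >-> R}).
Hypothesis hB : fractional_brownian_motion H B.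
Local Notation Q := (P1 \x P2)%E.

Definition incr_sum (I : finType) (a : I -> T1 -> R) (x y : I -> R) (z : T1 * T2) : R :=
  \sum_i a i z.1 * fbm_incr B (x i) (y i) z.2.

(** The variance of [incr_sum] for a fixed path of [xi]. *)
Definition cond_var (I : finType) (a : I -> T1 -> R) (x y : I -> R) (w : T1) : R :=
  \sum_i \sum_j a i w * a j w * icov H (x i) (y i) (x j) (y j).

Section one.
Variables (I : finType) (a : I -> T1 -> R) (x y : I -> R).

Lemma measurable_incr_sum : (forall i, measurable_fun setT (a i)) ->
  measurable_fun setT (incr_sum a x y).
Proof.
move=> ma; apply: measurable_sum => i; apply: measurable_funM.
  by apply: measurableT_comp.
by apply: measurable_funB; apply: measurableT_comp.
Qed.

Lemma measurable_cond_var : (forall i, measurable_fun setT (a i)) ->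
  measurable_fun setT (cond_var a x y).
Proof.
move=> ma; apply: measurable_sum => i; apply: measurable_sum => j.
by apply: measurable_funM => //; exact: measurable_funM.
Qed.

Lemma integral_incr_sum_sqr w :
  (\int[P2]_w2 (incr_sum a x y (w, w2) ^+ 2)%:E = (cond_var a x y w)%:E)%E.
Proof.
have := @ip_sum _ _ _ P2 _ _ (index_enum I) (index_enum I) (a ^~ w) (a ^~ w)
  (fun i => fbm_incr B (x i) (y i)) (fun i => fbm_incr B (x i) (y i))
  (fun i => fbm_incr_sqint hB (x i) (y i)) (fun i => fbm_incr_sqint hB (x i) (y i)).
rewrite /cond_var.
under [in X in _ = X -> _]eq_bigr do under eq_bigr do rewrite (fbm_incr_ip hB).
by move=> <-; apply: eq_integral => w2 _; rewrite expr2.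
Qed.

(** Chebyshev's inequality for each [w] with conditional variance at most
    [eta]. *)
Lemma incr_sum_prob_le (e eta : R) : 0 < e -> 0 <= eta -> (forall i, measurable_fun setT (a i)) ->
  (Q [set z | (e < `|incr_sum a x y z|)%R] <=
   P1 [set w | (eta < cond_var a x y w)%R] + (eta / e ^+ 2)%:E)%E.
Proof.
move=> e0 eta0 ma.
have mS := measurable_incr_sum ma.
have mA : measurable [set z | e < `|incr_sum a x y z|].
  by apply: measurable_superlevel; exact: measurableT_comp.
pose G := [set w | eta < cond_var a x y w].
have mG : measurable G by exact/measurable_superlevel/measurable_cond_var.
have cheb w : (P2 (xsection [set z | (e < `|incr_sum a x y z|)%R] w) <= (cond_var a x y w / e ^+ 2)%:E)%E.
  have mx := measurable_xsection w mA.
  have mSw : measurable_fun setT (fun w2 => incr_sum a x y (w, w2)).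
    by apply: (measurableT_comp mS); exact: pair1_measurable.
  rewrite mulrC EFinM -integral_incr_sum_sqr -ge0_integralZl_EFin//; last 3 first.
  - by move=> w2 _; rewrite lee_fin sqr_ge0.
  - by apply/measurable_EFinP; exact: measurable_funX.
  - by rewrite invr_ge0 sqr_ge0.
  rewrite -[X in (P2 X <= _)%E]setIT -integral_indic//.
  apply: ge0_le_integral => //.
  - by apply/measurable_EFinP; exact: measurable_indic.
  - apply: measurable_funeM; apply/measurable_EFinP; exact: measurable_funX.
  - move=> w2 _; rewrite -EFinM lee_fin indicE.
    case: (boolP (w2 \in _)) => [|_]; last by rewrite mulr_ge0 ?invr_ge0 ?sqr_ge0.
    rewrite inE /xsection /= inE /= => ew.
    rewrite mulrC ler_pdivlMr ?exprn_gt0// mul1r -[leRHS]real_normK ?num_real//.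
    by rewrite lerXn2r ?nnegrE ?(ltW e0) ?(ltW ew).
apply: (@le_trans _ _ (\int[P1]_w ((\1_G w)%:E + (eta / e ^+ 2)%:E))%E).
  apply: ge0_le_integral => //.
  - exact: measurable_fun_xsection.
  - by apply: emeasurable_funD => //; apply/measurable_EFinP; exact: measurable_indic.
  - move=> w _ /=; have [wG|wG] := boolP (w \in G).
      rewrite indicE wG -[leLHS]adde0; apply: leeD; last by rewrite lee_fin divr_ge0// sqr_ge0.
      by apply: probability_le1; exact: measurable_xsection.
    rewrite indicE (negbTE wG) add0e; apply: (le_trans (cheb w)).
    rewrite lee_fin ler_pM2r ?invr_gt0 ?exprn_gt0// leNgt; apply/negP => h.
    by move/negP: wG; apply; rewrite inE.
rewrite ge0_integralD//; last 2 first.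
- by apply/measurable_EFinP; exact: measurable_indic.
- by move=> w _; rewrite lee_fin divr_ge0// sqr_ge0.
rewrite integral_indic// setIT integral_prob_cst.
exact: lexx.
Qed.

End one.

Lemma incr_sum_mul (I J : finType) (a : I -> T1 -> R) (x y : I -> R)
    (b : J -> T1 -> R) (x' y' : J -> R) :
  (forall i, sqint P1 (a i)) -> (forall j, sqint P1 (b j)) ->
  (\int[Q]_z (incr_sum a x y z * incr_sum b x' y' z)%:E =
   (\sum_i \sum_j ip P1 (a i) (b j) * icov H (x i) (y i) (x' j) (y' j))%:E)%E.
Proof.
move=> ha hb.
pose h i j z := (a i z.1 * b j z.1) * (fbm_incr B (x i) (y i) z.2 * fbm_incr B (x' j) (y' j) z.2).
have hf i j := integrable_tensor (sqint_mul_integrable (ha i) (hb j))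
  (sqint_mul_integrable (fbm_incr_sqint hB (x i) (y i)) (fbm_incr_sqint hB (x' j) (y' j))).
under eq_integral => z _.
  rewrite mulr_suml -sumEFin; under eq_bigr => i _.
    rewrite mulr_sumr -sumEFin; under eq_bigr => j _.
      rewrite mulrACA; over.
    over.
  over.
rewrite integral_sum//; last first.
  by move=> i; apply: integrable_sum => // j _; exact: (hf i j).1.
rewrite -sumEFin; apply: eq_bigr => i _.
rewrite integral_sum//; last by move=> j; exact: (hf i j).1.
rewrite -sumEFin; apply: eq_bigr => j _.
rewrite (hf i j).2 ipE// ipE; [|exact: (fbm_incr_sqint hB)..].
by rewrite -EFinM (fbm_incr_ip hB).
Qed.

Lemma incr_sum_sqint (I : finType) (a : I -> T1 -> R) (x y : I -> R) :
  (forall i, sqint P1 (a i)) -> sqint Q (incr_sum a x y).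
Proof.
move=> ha; split; first by apply: measurable_incr_sum => i; case: (ha i).
by under eq_integral do rewrite expr2; rewrite incr_sum_mul// ltry.
Qed.

Lemma incr_sum_mean (I : finType) (a : I -> T1 -> R) (x y : I -> R) :
  (forall i, sqint P1 (a i)) -> (\int[Q]_z (incr_sum a x y z)%:E = 0)%E.
Proof.
move=> ha.
have hf i := integrable_tensor (sqint_integrable (ha i))
  (sqint_integrable (fbm_incr_sqint hB (x i) (y i))).
under eq_integral do rewrite -sumEFin.
rewrite integral_sum//; last by move=> i; exact: (hf i).1.
by rewrite big1// => i _; rewrite (hf i).2 (fbm_incr_mean hB) mule0.
Qed.

End random_sums.

(** * Refining partitions along a fixed path *)

Section partition_facts.
Context {R : realType}.
Variables (t : R) (N : nat -> R) (u : nat -> nat -> R).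
Hypothesis hu : partition_sequence t N u.

Lemma mesh_ge n i : (i < n)%N -> u n i.+1 - u n i <= mesh u n.
Proof.
move=> i_n; rewrite /mesh.
exact: (@le_bigmax _ _ _ 0 (fun k : 'I_n => u n k.+1 - u n k) (Ordinal i_n)).
Qed.

(** The point [r] is found before [f], since for a random integrand it has to
    be the same for all [w]. *)
Lemma partition_step (n : nat) (v : R) : (0 < n)%N ->
  (~~ (- N n < v <= t) /\ forall f, stepf n (u n) f v = 0) \/
  (- N n < v <= t /\
   exists r, [/\ v - mesh u n <= r, r < v & forall f, stepf n (u n) f v = f r]).
Proof.
move=> n0.
have uS i : (i < n)%N -> u n i < u n i.+1 by move=> h; exact: (partition_increasing hu h).
rewrite -(partition_first hu n0) -(partition_last hu n0).
have [vin|vout] := boolP (u n 0%N < v <= u n n); last first.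
  by left; split => // f; exact: stepf_out.
right; split => //; have [i i_n vi] := grid_cell vin.
exists (u n i); split; last by move=> f; exact: stepf_cell.
- by have := mesh_ge i_n; case/andP: vi => ? ?; lra.
- by case/andP: vi.
Qed.

Lemma partition_near_mesh (e : R) : 0 < e -> \forall n \near \oo, (0 < n)%N /\ mesh u n <= e.
Proof.
move=> e0; near=> n; split; first by near: n; exact: nbhs_infty_gt.
near: n; exact: (cvgr_le _ (partition_mesh_cvg0 hu) _ e0).
Unshelve. all: by end_near. Qed.

Lemma partition_near_bound (v : R) : \forall n \near \oo, - N n < v.
Proof.
have := partition_bound_cvgy hu => /cvgryPgt/(_ (- v)).
by apply: filterS => n; rewrite ltrNl.
Qed.

Lemma stepf_cvg (f : R -> R) (l : R) (v : R) : v <= t ->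
  f r @[r --> v^'-] --> l -> stepf n (u n) f v @[n --> \oo] --> l.
Proof.
move=> vt /cvgrPdist_le fl; apply/cvgrPdist_le => e e0.
have := fl e e0; rewrite near_withinE => -[dl dl0 /= Hdl].
near=> n.
have [n0 mn] : (0 < n)%N /\ mesh u n <= dl / 2.
  by near: n; apply: partition_near_mesh; rewrite divr_gt0.
have Nv : - N n < v by near: n; exact: partition_near_bound.
have [[+ _]|[_ [r [r1 r2 ->]]]] := partition_step v n0; first by rewrite Nv vt.
apply: Hdl => //=; rewrite /ball /= ger0_norm; lra.
Unshelve. all: by end_near. Qed.

Lemma stepf_gt (f : R -> R) n v : t < v -> (0 < n)%N -> stepf n (u n) f v = 0.
Proof.
move=> tv n0; have [[_ ->]//|[/andP[_ +] _]] := partition_step v n0.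
by rewrite leNgt tv.
Qed.

End partition_facts.

Lemma sum_diff (V : zmodType) n m (F : 'I_n + 'I_m -> V) :
  \sum_k F k = \sum_i F (inl i) + \sum_j F (inr j).
Proof. by rewrite big_sumType. Qed.

Section pathwise.
Context {R : realType} (H : R) (hH : 2^-1 < H < 1).
Local Notation mu := (@lebesgue_measure R).

Lemma diff_step n m (x y : nat -> R) (f : R -> R) v :
  \sum_(k : 'I_n + 'I_m) diff_coef (fun i : 'I_n => f (x i)) (fun j : 'I_m => f (y j)) k *
    \1_`]join_pt x y k, join_ptS x y k] v = stepf n x f v - stepf m y f v.
Proof.
rewrite sum_diff /=; congr (_ + _); rewrite /stepf -sumrN; apply: eq_bigr => j _.
by rewrite mulNr.
Qed.

Variables (t : R) (f l g : R -> R) (Mg Ng : R).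
Hypothesis mg : measurable_fun setT g.
Hypothesis g_bnd : forall v, 0 <= g v <= Mg.
Hypothesis g_int : (\int[mu]_v (g v)%:E <= Ng%:E)%E.
Hypothesis f_ge0 : forall r, 0 <= f r.
Hypothesis fg : forall r v, r < v <= r + 1 -> v <= t -> f r <= g v.
Hypothesis fl : forall v, v <= t -> f r @[r --> v^'-] --> l v.
Hypothesis l0 : forall v, t < v -> l v = 0.

Let g0 v : 0 <= g v. Proof. by case/andP: (g_bnd v). Qed.

Section one_partition.
Variables (N : nat -> R) (u : nat -> nat -> R).
Hypothesis hu : partition_sequence t N u.

Lemma stepf_cvg_l v : stepf n (u n) f v @[n --> \oo] --> l v.
Proof.
have [vt|tv] := leP v t; first exact: (stepf_cvg hu vt (fl vt)).
rewrite l0//; apply: cvg_near_cst; near=> n; apply: (stepf_gt hu) => //.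
by near: n; exact: nbhs_infty_gt.
Unshelve. all: by end_near. Qed.

Lemma stepf_dominated n v : (0 < n)%N -> mesh u n <= 1 -> 0 <= stepf n (u n) f v <= g v.
Proof.
move=> n0 m1; have [[_ ->]|[/andP[_ vt] [r [r1 r2 ->]]]] := partition_step hu v n0.
  by rewrite lexx g0.
by rewrite f_ge0 fg//; apply/andP; split => //; lra.
Qed.

Lemma measurable_step_limit : measurable_fun setT l.
Proof.
apply: (measurable_fun_cvg (h := fun n => stepf n (u n) f)).
  by move=> n; exact: measurable_stepf.
by move=> v _; exact: stepf_cvg_l.
Qed.

Lemma stepf_L1_cvg (eta : R) : 0 < eta -> \forall n \near \oo,
  [/\ (0 < n)%N, mesh u n <= 1 & (\int[mu]_v (`|stepf n (u n) f v - l v|)%:E <= eta%:E)%E].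
Proof.
move=> eta0; have [n0 _ Hn0] := partition_near_mesh hu ltr01.
have ml := measurable_step_limit.
have lg v : 0 <= l v <= g v.
  apply/andP; split.
    rewrite -(cvg_lim _ (@stepf_cvg_l v))//; apply: limr_ge.
      by apply/cvg_ex; eexists; exact: stepf_cvg_l.
    exists n0 => // n nn.
    by have [a b] := Hn0 n nn; case/andP: (stepf_dominated v a b).
  rewrite -(cvg_lim _ (@stepf_cvg_l v))//; apply: limr_le.
    by apply/cvg_ex; eexists; exact: stepf_cvg_l.
  exists n0 => // n nn.
  by have [a b] := Hn0 n nn; case/andP: (stepf_dominated v a b).
have := @dominated_to0 R (fun n v => `|stepf (n + n0) (u (n + n0)%N) f v - l v|) g Ng.
have H1 n : measurable_fun setT (fun v => `|stepf (n + n0) (u (n + n0)%N) f v - l v|).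
  by apply: measurableT_comp => //; apply: measurable_funB => //; exact: measurable_stepf.
move=> /(_ H1 mg (fun n v => normr_ge0 _) _ g_int _ _ eta0) [].
- move=> n v; have [a b] := Hn0 (n + n0)%N (leq_addl _ _).
  have /andP[s0 sg] := stepf_dominated v a b; have /andP[l0' lg'] := lg v.
  by rewrite ler_norml; apply/andP; split; lra.
- move=> v; have := @stepf_cvg_l v; rewrite -(cvg_shiftn n0) => c.
  rewrite -(normr0 R) -(subrr (l v)); apply: cvg_norm; apply: cvgB => //; exact: cvg_cst.
move=> k _ Hk; exists (k + n0)%N => // n /= kn.
have nn : (n0 <= n)%N by apply: leq_trans kn; exact: leq_addl.
have [a b] := Hn0 n nn; split => //.
have := Hk (n - n0)%N; rewrite /= subnK//; apply.
by rewrite leq_subRL// addnC.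
Qed.

End one_partition.

(** The difference [A] of the two step functions satisfies [|A| <= e + e'],
    which is small in [L^1], and [|A| <= g]. The coefficients of the quadratic
    form have [A(v) A(w)] as step function, so [icov_form_bound] applies with
    the first bound for one factor and the second for the other. *)
Lemma pathwise_form_small (N N' : nat -> R) (u u' : nat -> nat -> R) :
  partition_sequence t N u -> partition_sequence t N' u' ->
  forall eta : R, 0 < eta -> exists K : nat, forall n m, (K <= n)%N -> (K <= m)%N ->
  let c := diff_coef (fun i : 'I_n => f (u n i)) (fun j : 'I_m => f (u' m j)) in
  let x := join_pt (u n) (u' m) in let y := join_ptS (u n) (u' m) in
  (\sum_k \sum_k' c k * c k' * icov H (x k) (y k) (x k') (y k') <= eta : Prop).
Proof.
move=> hu hu' eta eta0.
have Mg0 : 0 <= Mg by case/andP: (g_bnd 0) => a; exact: le_trans.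
have Ng0 : 0 <= Ng.
  by rewrite -lee_fin (le_trans _ g_int)//; apply: integral_ge0 => v _; rewrite lee_fin.
(* Chosen so that the final bound is at most [eta]; the last term keeps it
   positive. *)
pose C := 2 * (Mg + 2 * Ng) + 1.
have C0 : 0 < C by rewrite /C; lra.
pose eta' := eta / (2 * C) / 2.
have eta'0 : 0 < eta' by rewrite !divr_gt0// mulr_gt0.
have [K1 _ HK1] := stepf_L1_cvg hu eta'0.
have [K2 _ HK2] := stepf_L1_cvg hu' eta'0.
exists (maxn K1 K2) => n m Kn Km.
set c := diff_coef _ _; set x := join_pt _ _; set y := join_ptS _ _.
have [n0 mn In] := HK1 n (leq_trans (leq_maxl _ _) Kn).
have [m0 mm Im] := HK2 m (leq_trans (leq_maxr _ _) Km).
pose e v := `|stepf n (u n) f v - l v|; pose e' v := `|stepf m (u' m) f v - l v|.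
have ml := measurable_step_limit hu.
have me : measurable_fun setT e.
  by apply: measurableT_comp => //; apply: measurable_funB => //; exact: measurable_stepf.
have me' : measurable_fun setT e'.
  by apply: measurableT_comp => //; apply: measurable_funB => //; exact: measurable_stepf.
have xy k : x k <= y k.
  by case: k => [i|j]; apply: ltW; [exact: (partition_increasing hu)|exact: (partition_increasing hu')].
have hxy v : 0 <= e v by exact: normr_ge0.
have hxy' v : 0 <= e' v by exact: normr_ge0.
have B : `|\sum_k \sum_k' c k * c k' * icov H (x k) (y k) (x k') (y k')| <=
    2 * (2 * eta') * (Mg + Ng).
  apply: (@icov_form_bound R H hH _ _ (fun k k' => c k * c k') x y x y
    (fun v => e v + e' v) g) => //.
  - exact: measurable_funD.
  - by move=> v; rewrite addr_ge0.
  - under eq_integral do rewrite EFinD.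
    rewrite ge0_integralD//; last 4 first.
    + by move=> v _; rewrite lee_fin.
    + by apply/measurable_EFinP.
    + by move=> v _; rewrite lee_fin.
    + by apply/measurable_EFinP.
    rewrite (_ : 2 * eta' = eta' + eta'); last by ring.
    by rewrite EFinD leeD.
  - move=> v w.
    have -> : \sum_k \sum_k' c k * c k' * (\1_`]x k, y k] v * \1_`]x k', y k'] w) =
      (stepf n (u n) f v - stepf m (u' m) f v) * (stepf n (u n) f w - stepf m (u' m) f w).
      rewrite -!diff_step mulr_suml; apply: eq_bigr => k _.
      by rewrite mulr_sumr; apply: eq_bigr => k' _; rewrite mulrACA.
    rewrite normrM ler_pM//.
      rewrite /e /e' -[X in X - stepf m _ _ _](subrK (l v)) -addrA.
      by rewrite (le_trans (ler_normD _ _))// lerD2l distrC.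
    have /andP[a1 a2] := stepf_dominated hu w n0 mn.
    have /andP[b1 b2] := stepf_dominated hu' w m0 mm.
    by rewrite ler_norml; apply/andP; split; lra.
apply: le_trans (le_trans (ler_norm _) B) _.
have -> : 2 * (2 * eta') * (Mg + Ng) = eta * ((Mg + Ng) / C).
  by rewrite /eta'; field; rewrite gt_eqF.
rewrite ger_pMr// ler_pdivrMr// mul1r /C; lra.
Qed.

End pathwise.

(** * Closeness of Riemann sums in probability *)

Section riemann_sums_close.
Context {R : realType} {d1 d2 : measure_display} {T1 : measurableType d1}
  {T2 : measurableType d2} (P1 : probability T1 R) (P2 : probability T2 R).
Variables (H : R) (hH : 2^-1 < H < 1).
Variables (B : R -> {RV P2 >-> R}) (hB : fractional_brownian_motion H B).
Variables (xi : R -> T1 -> R) (X1 X2 : R -> {RV P1 >-> R}).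
Hypothesis hxi : two_sided_levy_process xi X1 X2.
Hypothesis X1oo : {ae P1, forall w, X1 t w @[t --> +oo] --> +oo}.
Local Notation Q := (P1 \x P2)%E.

(** The Riemann sums with [xi_version] in the place of [xi], measurable for
    the product sigma-algebra itself, before its completion. *)
Definition rsum (t : R) (u : nat -> nat -> R) (n : nat) : T1 * T2 -> R :=
  incr_sum B (fun (i : 'I_n) => discount X1 X2 t (u n i)) (fun i => u n i) (fun i => u n i.+1).

Definition rsum_diff_coef (t : R) (u u' : nat -> nat -> R) (n m : nat) (k : 'I_n + 'I_m)
    (w : T1) : R :=
  diff_coef (fun i : 'I_n => discount X1 X2 t (u n i) w) (fun j : 'I_m => discount X1 X2 t (u' m j) w) k.

Lemma rsum_diff t u u' n m z : rsum t u n z - rsum t u' m z =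
  incr_sum B (@rsum_diff_coef t u u' n m) (join_pt (u n) (u' m)) (join_ptS (u n) (u' m)) z.
Proof.
rewrite /incr_sum sum_diff /=; congr (_ + _); rewrite /rsum /incr_sum -sumrN.
by apply: eq_bigr => j _; rewrite mulNr.
Qed.

Lemma measurable_rsum_diff_coef t u u' n m (k : 'I_n + 'I_m) :
  measurable_fun setT (@rsum_diff_coef t u u' n m k).
Proof.
case: k => [i|j]; first exact: measurable_discount.
by apply: measurable_funN; exact: measurable_discount.
Qed.

Lemma measurable_rsum t u n : measurable_fun setT (rsum t u n).
Proof. by apply: measurable_incr_sum => i; exact: measurable_discount. Qed.

Lemma discount_left_limit t : {ae P1, forall w, forall v, cvg (discount X1 X2 t r w @[r --> v^'-])}.
Proof.
apply: filterS (xi_version_left_limits hxi) => w Hw v.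
apply/cvg_ex; exists (expR (- xi_version X1 X2 t w + lim (xi_version X1 X2 r w @[r --> v^'-]))).
have c : - xi_version X1 X2 t w + xi_version X1 X2 r w @[r --> v^'-] -->
    - xi_version X1 X2 t w + lim (xi_version X1 X2 r w @[r --> v^'-]).
  by apply: cvgD; [exact: cvg_cst|exact: Hw].
exact: (@cvg_comp _ _ _ _ expR _ _ _ c (@continuous_expR R _)).
Qed.

Section two_sequences.
Variables (t : R) (t0 : 0 <= t) (N N' : nat -> R) (u u' : nat -> nat -> R).
Hypothesis hu : partition_sequence t N u.
Hypothesis hu' : partition_sequence t N' u'.

Lemma cond_var_small_ae : {ae P1, forall w, forall eta : R, 0 < eta ->
  exists K : nat, forall n m, (K <= n)%N -> (K <= m)%N ->
  cond_var H (@rsum_diff_coef t u u' n m) (join_pt (u n) (u' m)) (join_ptS (u n) (u' m)) w <= eta}.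
Proof.
apply: filterS2 (discount_left_limit t) (discount_dominated hxi X1oo t0) => w fl [g [Mg [Ng [mg gM gN fg]]]].
pose l v := if v <= t then lim (discount X1 X2 t r w @[r --> v^'-]) else 0.
apply: (@pathwise_form_small R H hH t (fun r => discount X1 X2 t r w) l g Mg Ng mg gM gN _ _ _ _ N N' u u' hu hu').
- by move=> r; exact: expR_ge0.
- exact: fg.
- by move=> v vt; rewrite /l vt; exact: fl.
- by move=> v vt; rewrite /l leNgt vt.
Qed.

(** The sets of paths on which all the conditional variances from rank [K] on
    are at most [eta] increase to a set of full measure. *)
Lemma rsum_close (e dl : R) : 0 < e -> 0 < dl ->
  exists K : nat, forall n m, (K <= n)%N -> (K <= m)%N ->
  (Q [set z | (e < `|rsum t u n z - rsum t u' m z|)%R] <= dl%:E)%E.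
Proof.
move=> e0 dl0; pose eta := dl / 2 * e ^+ 2.
have eta0 : 0 < eta by rewrite mulr_gt0 ?divr_gt0 ?exprn_gt0.
pose V n m := cond_var H (@rsum_diff_coef t u u' n m) (join_pt (u n) (u' m)) (join_ptS (u n) (u' m)).
have mV n m : measurable_fun setT (V n m).
  by apply: measurable_cond_var => k; exact: measurable_rsum_diff_coef.
pose F K := \bigcap_(n in [set n | (K <= n)%N]) \bigcap_(m in [set m | (K <= m)%N])
  [set w | V n m w <= eta].
have mF K : measurable (F K).
  apply: bigcap_measurable; first by exists K => /=.
  move=> n _; apply: bigcap_measurable; first by exists K => /=.
  move=> m _; rewrite (_ : [set w | _] = (V n m) @^-1` `]-oo, eta]).
    by rewrite -[X in measurable X]setTI; apply: mV.
  by apply/seteqP; split => w /=; rewrite in_itv.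
have ndF : nondecreasing_seq F.
  move=> K L KL; rewrite subsetEset => w Fw n Ln m Lm.
  by apply: Fw; [exact: leq_trans Ln|exact: leq_trans Lm].
have aeF : {ae P1, forall w, exists n, F n w}.
  by apply: filterS cond_var_small_ae => w /(_ eta eta0)[K HK]; exists K => n Kn m Km; exact: HK.
have F1 := ae_nondecreasing_cvg1 mF ndF aeF.
have F1' : fine (P1 (F n)) @[n --> \oo] --> (1 : R).
  by apply: fine_cvg; exact: F1.
have dl2 : 1 - dl / 2 < 1 :> R by rewrite ltrBlDr ltrDl divr_gt0.
have [K _ HK] := cvgr_gt _ F1' _ dl2.
exists K => n m Kn Km.
have {HK} := HK K (leqnn _) => /= HK.
rewrite (_ : [set z | _] = [set z | e < `|incr_sum B (@rsum_diff_coef t u u' n m)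
  (join_pt (u n) (u' m)) (join_ptS (u n) (u' m)) z|]); last first.
  by apply/seteqP; split => z /=; rewrite rsum_diff.
have := incr_sum_prob_le P1 hB (join_pt (u n) (u' m)) (join_ptS (u n) (u' m))
  e0 (ltW eta0) (@measurable_rsum_diff_coef t u u' n m).
move=> /le_trans; apply.
have -> : eta / e ^+ 2 = dl / 2 by rewrite /eta mulfK// gt_eqF// exprn_gt0.
have -> : dl%:E = ((dl / 2)%:E + (dl / 2)%:E)%E by rewrite -EFinD; congr EFin; lra.
rewrite leeD2r//.
apply: (@le_trans _ _ (P1 (~` F K))).
  apply: le_measure; rewrite ?inE//.
  - exact: (measurable_superlevel _ (mV n m)).
  - exact: measurableC.
  - by move=> w /= h /(_ n Kn m Km) /=; rewrite leNgt => /negP; apply.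
rewrite probability_setC//.
have fF : P1 (F K) \is a fin_num by exact: fin_num_measure.
rewrite -(fineK fF) -EFinB lee_fin; lra.
Qed.

End two_sequences.

End riemann_sums_close.

(** * Existence of the integral *)

Section reference_partition.
Context {R : realType}.
Variables (t : R) (t0 : 0 <= t).

Let N (n : nat) : R := Num.sqrt n%:R.
Let u (n i : nat) : R := - N n + i%:R * ((t + N n) / n%:R).

Let NE n : N n ^+ 2 = n%:R. Proof. by rewrite sqr_sqrtr. Qed.

Let N0 n : (0 < n)%N -> 0 < N n. Proof. by move=> n0; rewrite sqrtr_gt0 ltr0n. Qed.

Let meshE n : (0 < n)%N -> mesh u n = t / n%:R + (N n)^-1.
Proof.
move=> n0; have nn : 0 < n%:R :> R by rewrite ltr0n.
have -> : t / n%:R + (N n)^-1 = (t + N n) / n%:R.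
  by rewrite -NE; field; rewrite gt_eqF// N0.
have step i : u n i.+1 - u n i = (t + N n) / n%:R by rewrite /u -natr1; ring.
have c0 : 0 <= (t + N n) / n%:R by rewrite divr_ge0// addr_ge0// ltW// N0.
apply/eqP; rewrite eq_le; apply/andP; split.
  by apply: bigmax_le => // i _; rewrite step.
rewrite -(step 0%N).
exact: (@le_bigmax _ _ _ 0 (fun k : 'I_n => u n k.+1 - u n k) (Ordinal n0)).
Qed.

Let Noo : N n @[n --> \oo] --> +oo.
Proof.
apply/cvgryPge => A; near=> n.
have An : A ^+ 2 <= n%:R by near: n; exact: nbhs_infty_ger.
have [A0|A0] := leP A 0; first by rewrite (le_trans A0)// sqrtr_ge0.
by rewrite -(ler_pXn2r (n := 2)) ?nnegrE ?sqrtr_ge0 ?(ltW A0)// NE.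
Unshelve. all: by end_near. Qed.

(** Uniform subdivisions of [[- sqrt n, t]], of mesh [t / n + 1 / sqrt n]. *)
Lemma partition_sequence_exists : exists N u, partition_sequence t N u.
Proof.
exists N, u; split.
- by move=> n n0; rewrite /u mul0r addr0.
- move=> n n0; rewrite /u; field; rewrite pnatr_eq0; lia.
- move=> n i i_n; have n0 : (0 < n)%N by lia.
  rewrite /u ltrD2l ltr_pM2r ?ltr_nat// divr_gt0 ?ltr0n//.
  by rewrite ltr_wpDl ?N0.
- move=> m n /andP[m0 mn]; have n0 : (0 < n)%N by lia.
  rewrite !meshE//; apply: lerD.
    by rewrite ler_wpM2l// lef_pV2 ?posrE ?ltr0n ?ler_nat.
  by rewrite lef_pV2 ?posrE ?N0// ler_wsqrtr ?ler_nat.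
- have c : t / n%:R + (N n)^-1 @[n --> \oo] --> t * 0 + 0.
    apply: cvgD.
      apply: cvgM; first exact: cvg_cst.
      apply/gtr0_cvgV0; last exact: cvgr_idn.
      by near=> n; rewrite ltr0n; near: n; exact: nbhs_infty_gt.
    apply/gtr0_cvgV0; last exact: Noo.
    by near=> n; apply: N0; near: n; exact: nbhs_infty_gt.
  rewrite mulr0 addr0 in c; move: c; apply: cvg_trans; apply: near_eq_cvg.
  by near=> n; rewrite meshE//; near: n; exact: nbhs_infty_gt.
- by move=> m n /andP[m0 mn]; rewrite ler_wsqrtr ?ler_nat.
- exact: Noo.
Unshelve. all: by end_near. Qed.

End reference_partition.

Section integral_exists.
Context {R : realType} {d1 d2 : measure_display} {T1 : measurableType d1}
  {T2 : measurableType d2} (P1 : probability T1 R) (P2 : probability T2 R).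
Variables (H : R) (hH : 2^-1 < H < 1).
Variables (B : R -> {RV P2 >-> R}) (hB : fractional_brownian_motion H B).
Variables (xi : R -> T1 -> R) (X1 X2 : R -> {RV P1 >-> R}).
Hypothesis hxi : two_sided_levy_process xi X1 X2.
Local Notation Q := (P1 \x P2)%E.
Local Notation P := (product_prob P1 P2).

Lemma ae_product_prob1 (S : T1 -> Prop) :
  {ae P, forall w, S w.1} <-> {ae P1, forall w, S w}.
Proof.
split; first by move=> h; apply: (ae_prod1_inv (P2 := P2)); exact: ae_completed_inv h.
by move=> h; apply: ae_completed; exact: ae_prod1.
Qed.

Lemma riemann_sum_ae t u n : {ae P, forall w,
  rsum B X1 X2 t u n w = riemann_sum P1 P2 xi (fun t => B t) t u n w}.
Proof.
have : {ae P1, forall w, forall i : 'I_n.+1, xi (u n i) w = xi_version X1 X2 (u n i) w}.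
  by apply: filter_forall => i; exact: xi_version_ae.
move=> hu.
have h : {ae P1, forall w, xi t w = xi_version X1 X2 t w /\
    forall i : 'I_n.+1, xi (u n i) w = xi_version X1 X2 (u n i) w}.
  by apply: filterS2 (xi_version_ae hxi t) hu.
have := (ae_product_prob1 _).2 h; apply: (@filterS _ _ (ae_filter_ringOfSetsType P)) => w /= [E1 E2].
rewrite /rsum /incr_sum /riemann_sum; apply: eq_bigr => i _.
by rewrite /discount E1 (E2 (widen_ord (leqnSn n) i)).
Qed.

Lemma measurable_riemann_sum t u n :
  measurable_fun setT (riemann_sum P1 P2 xi (fun t => B t) t u n).
Proof.
exact: (measurable_completed_ae (@measurable_rsum _ _ _ _ _ P1 P2 B X1 X2 t u n) (riemann_sum_ae t u n)).
Qed.

Lemma levy_cvgy : {ae P, forall w, xi t w.1 @[t --> +oo] --> +oo} ->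
  {ae P1, forall w, X1 t w @[t --> +oo] --> +oo}.
Proof.
move=> /(ae_product_prob1 (fun w => xi t w @[t --> +oo] --> +oo)); apply: filterS => w.
apply: cvg_trans; apply: near_eq_cvg; near=> t.
by rewrite (two_sided_nonneg hxi)//; near: t; exact: nbhs_pinfty_ge.
Unshelve. all: by end_near. Qed.

Lemma product_prob_far (Z Z' Y Y' : T1 * T2 -> R) (e : R) :
  measurable_fun setT Z -> measurable_fun setT Y ->
  measurable_fun setT (Z' : product_space P1 P2 -> R) ->
  measurable_fun setT (Y' : product_space P1 P2 -> R) ->
  {ae P, forall w, Z w = Z' w} -> {ae P, forall w, Y w = Y' w} ->
  P [set w | e < `|Z' w - Y' w|] = Q [set w | e < `|Z w - Y w|].
Proof.
move=> mZ mY mZ' mY' EZ EY.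
have mA := measurable_far e mZ mY; rewrite -(completed_probE Q mA).
apply: ae_iff_measure.
- exact: (@measurable_far _ (product_space P1 P2)).
- exact: completed_measurable.
by apply: (@filterS2 _ _ (ae_filter_ringOfSetsType P)) EZ EY => w E1 E2 /=; rewrite E1 E2.
Qed.

Hypothesis X1oo : {ae P1, forall w, X1 t w @[t --> +oo] --> +oo}.

(** The limit along one sequence of partitions is the limit along any other by
    [rsum_close]. *)
Lemma backward_integral_exists t : 0 <= t ->
  exists Y : {RV P >-> R}, is_backward_integral P1 P2 xi (fun t => B t) t Y.
Proof.
move=> t0; have [N [u hu]] := partition_sequence_exists t0.
have mr u' n := @measurable_rsum _ _ _ _ _ P1 P2 B X1 X2 t u' n.
have [Y [phi [mY _ _ cY]]] := cauchy_in_probability_cvg (mr u)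
  (fun e dl e0 dl0 => rsum_close hH hB hxi X1oo t0 hu hu e0 dl0).
have mY' : measurable_fun setT (Y : product_space P1 P2 -> R) by exact: measurable_completed.
pose mix := isMeasurableFun.Build _ _ (product_space P1 P2) R Y mY'.
pose Y' : {RV P >-> R} := HB.pack (Y : product_space P1 P2 -> R) mix.
exists Y' => N' u' hu' e e0.
rewrite (_ : (fun n => _) = (fun n => Q [set w | e < `|rsum B X1 X2 t u' n w - Y w|])); last first.
  apply/funext => n; apply: product_prob_far => //.
  - exact: measurable_riemann_sum.
  - exact: riemann_sum_ae.
  - exact: aeW.
apply/ge0_cvge0P => // dl dl0; have e2 : 0 < e / 2 by rewrite divr_gt0.
have dl2 : 0 < dl / 2 by rewrite divr_gt0.
have [K HK] := rsum_close hH hB hxi X1oo t0 hu' hu e2 dl2.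
have c2 : \forall n \near \oo,
    (Q [set w | (e / 2 < `|rsum B X1 X2 t u n w - Y w|)%R] <= (dl / 2)%:E)%E.
  exact: (ge0_cvge0P (fun n => measure_ge0 _ _)).1 (cY _ e2) _ dl2.
near=> n.
apply: (le_trans (far_triangle _ _ (mr u' n) mY (mr u n))).
have -> : dl%:E = ((dl / 2)%:E + (dl / 2)%:E)%E by rewrite -EFinD; congr EFin; lra.
apply: leeD; last by near: n.
by apply: HK; near: n; exact: nbhs_infty_ge.
Unshelve. all: by end_near. Qed.

End integral_exists.

(** * Mean-square error of the step functions *)

Section decay.
Context {R : realType}.
Variables (a t : R).
Hypothesis a0 : a < 0.
Hypothesis t0 : 0 <= t.
Local Notation mu := (@lebesgue_measure R).

(** The norm in [L^2] of the integrand, with half of its rate for [a]. *)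
Definition decay (v : R) : R := expR ((t - v) * a) * \1_`]-oo, t] v.

Lemma decay_le v : v <= t -> decay v = expR ((t - v) * a).
Proof. by move=> vt; rewrite /decay indicE mem_set ?mulr1//= in_itv. Qed.

Lemma decay_gt v : t < v -> decay v = 0.
Proof. by move=> vt; rewrite /decay indicE memNset ?mulr0//= in_itv/= leNgt vt. Qed.

Lemma decay_ge0 v : 0 <= decay v. Proof. by rewrite mulr_ge0 ?expR_ge0// indicE. Qed.

Lemma decay_le1 v : decay v <= 1.
Proof.
have [vt|vt] := leP v t; last by rewrite decay_gt.
by rewrite decay_le// expR_le1 mulr_ge0_le0 ?subr_ge0// ltW.
Qed.

Lemma measurable_decay : measurable_fun setT decay.
Proof.
apply: measurable_funM; last exact: measurable_indic.
apply: measurableT_comp => //; apply: measurable_funM => //.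
exact: measurable_funB.
Qed.

Lemma decay_integral : exists D : R, 0 <= D /\ (\int[mu]_v (decay v)%:E <= D%:E)%E.
Proof.
have q0 : 0 <= expR a by exact: expR_ge0.
have q1 : expR a < 1 by rewrite expR_lt1.
have c0 (k : nat) : 0 <= expR (k%:R * a) by exact: expR_ge0.
have cb n : \sum_(k < n) expR (k%:R * a) <= (1 - expR a)^-1.
  under eq_bigr do rewrite expRM_natl.
  have q1' : 0 < 1 - expR a by rewrite subr_gt0.
  rewrite -[leRHS]mul1r ler_pdivlMr//.
  have := subrX1 (expR a) n; have := exprn_ge0 n q0.
  move: (expR a ^+ n) (\sum_(i < n) _) => x S x0 E.
  have -> : S * (1 - expR a) = - ((expR a - 1) * S) by ring.
  by rewrite -E opprB lerBlDr lerDl.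
have [h [mh hb hi ch]] := step_majorant c0 cb.
exists ((1 - expR a)^-1 + t); split.
  by rewrite addr_ge0// invr_ge0 subr_ge0 ltW.
apply: (@le_trans _ _ (\int[mu]_v ((h v)%:E + (\1_`]0, t] v)%:E))%E).
  apply: ge0_le_integral => //.
  - by move=> v _; rewrite lee_fin decay_ge0.
  - by apply/measurable_EFinP; exact: measurable_decay.
  - apply: emeasurable_funD; apply/measurable_EFinP => //; exact: measurable_indic.
  - move=> v _; rewrite -EFinD lee_fin; have /andP[h0 _] := hb v.
    have [vt|vt] := leP v t; last by rewrite decay_gt// addr_ge0// indicE.
    have [v0|v0] := ltP 0 v.
      rewrite indicE mem_set/=; last by rewrite in_itv/= v0.
      by rewrite ler_wpDl// decay_le1.
    rewrite ler_wpDr ?indicE// decay_le//.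
    have /truncn_itv/andP[k1 k2] : 0 <= - v by rewrite oppr_ge0.
    apply: (@le_trans _ _ (expR ((Num.truncn (- v))%:R * a))); last first.
      by apply: ch; apply/andP; split; [rewrite ltrNl|rewrite lerNr].
    rewrite ler_expR ler_wnM2r ?(ltW a0)//; apply: (le_trans k1).
    by rewrite lerDr.
rewrite ge0_integralD//; last 3 first.
- by move=> v _; rewrite lee_fin; case/andP: (hb v).
- by apply/measurable_EFinP.
- by apply/measurable_EFinP; exact: measurable_indic.
rewrite EFinD leeD// integral_indic// setIT.
rewrite [leLHS](lebesgue_measure_itv `]0, t]) /= lte_fin.
by case: ifPn => _; rewrite ?sube0// lee_fin.
Qed.

End decay.

Section step_moments.
Context {R : realType} {d : measure_display} {T : measurableType d} (P : probability T R).
Variables (xi : R -> T -> R) (X1 X2 : R -> {RV P >-> R}).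
Hypothesis hxi : two_sided_levy_process xi X1 X2.
Hypothesis X1lt1 : (exp_moment X1 2 1 < 1)%E.
Let L1 : levy_process X1. Proof. by case: hxi. Qed.
Local Notation ip := (ip P).
Local Notation sqint := (sqint P).

Let rho : R := rate X1 2 / 2.
Let theta : R := `|rate X1 1|.

Lemma half_rate_lt0 : rho < 0.
Proof. by rewrite pmulr_llt0 ?invr_gt0//; exact: (rate2_lt0 X1lt1). Qed.

Definition discount_step (t : R) (x : nat -> R) (n : nat) (v : R) (w : T) : R :=
  stepf n x (fun r => discount X1 X2 t r w) v.

Definition discount_lim (t v : R) (w : T) : R := if v <= t then discount X1 X2 t v w else 0.

Lemma discount_lim_le t v : v <= t -> discount_lim t v = discount X1 X2 t v.
Proof. by move=> vt; apply/funext => w; rewrite /discount_lim vt. Qed.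

Lemma discount_lim_gt t v : t < v -> discount_lim t v = cst 0.
Proof. by move=> tv; apply/funext => w; rewrite /discount_lim leNgt tv. Qed.

Variables (t : R) (t0 : 0 <= t).

Lemma discount_lim_sqint v : sqint (discount_lim t v).
Proof.
have [vt|tv] := leP v t; last by rewrite discount_lim_gt//; exact: sqint_cst.
by rewrite discount_lim_le//; exact: (discount_sqint hxi X1lt1).
Qed.

Let decayE r : r <= t -> expR ((t - r) * rate X1 2) = decay rho t r ^+ 2.
Proof. by move=> rt; rewrite decay_le// -expRM_natl; congr expR; rewrite /rho; field. Qed.

Lemma discount_lim_sqr v : ip (discount_lim t v) (discount_lim t v) <= decay rho t v ^+ 2.
Proof.
apply: ip_le; first exact: discount_lim_sqint.
have [vt|tv] := leP v t; first by rewrite discount_lim_le// (discount_sqr hxi X1lt1)// decayE.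
by rewrite discount_lim_gt//; under eq_integral do rewrite /= expr0n/=; rewrite integral0 lee_fin sqr_ge0.
Qed.

Variables (N : nat -> R) (u : nat -> nat -> R).
Hypothesis hu : partition_sequence t N u.

Lemma partition_le_last n i : (i <= n)%N -> (0 < n)%N -> u n i <= t.
Proof.
move=> i_n n0; rewrite -(partition_last hu n0); apply: (@grid_le _ n) => //.
by move=> k kn; exact: (partition_increasing hu).
Qed.

Lemma discount_step_sqint n v : sqint (discount_step t (u n) n v).
Proof.
case: n => [|n].
  rewrite (_ : discount_step _ _ _ _ = cst 0); first exact: sqint_cst.
  by apply/funext => w; rewrite /discount_step /stepf big_ord0.
rewrite (_ : discount_step _ _ _ _ = (fun w => \sum_(i < n.+1)
    \1_`]u n.+1 i, u n.+1 i.+1] v * discount X1 X2 t (u n.+1 i) w)); last first.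
  by apply/funext => w; apply: eq_bigr => i _; rewrite mulrC.
apply: sqint_sum => i; apply: sqintZ; apply: (discount_sqint hxi X1lt1) => //.
by apply: partition_le_last => //; exact: ltnW.
Qed.

(** A bound for the norm in [L^2] of the error made by freezing the integrand
    on the cells; before the first point [- N n] of the partition the whole
    integrand is lost. *)
Definition step_err (n : nat) (v : R) : R :=
  decay rho t v * (Num.sqrt (4 * mesh u n * theta) + \1_`]-oo, - N n] v).

Lemma mesh_ge0 n : 0 <= mesh u n.
Proof. by rewrite /mesh; apply: bigmax_ge_id. Qed.

Lemma mesh_le1 n : (0 < n)%N -> mesh u n <= mesh u 1.
Proof. by move=> n0; exact: (partition_mesh_nonincreasing hu). Qed.

Let sqrt_sqr n : Num.sqrt (4 * mesh u n * theta) ^+ 2 = 4 * mesh u n * theta.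
Proof. by rewrite sqr_sqrtr// mulr_ge0 ?normr_ge0// mulr_ge0// mesh_ge0. Qed.

Lemma step_err_ge0 n v : 0 <= step_err n v.
Proof. by rewrite mulr_ge0 ?decay_ge0// addr_ge0 ?sqrtr_ge0// indicE. Qed.

Lemma measurable_step_err n : measurable_fun setT (step_err n).
Proof.
apply: measurable_funM; first exact: measurable_decay.
by apply: measurable_funD => //; exact: measurable_indic.
Qed.

Let C : R := Num.sqrt (4 * mesh u 1 * theta) + 1.

Lemma step_err_le n v : (0 < n)%N -> step_err n v <= C * decay rho t v.
Proof.
move=> n0; rewrite [leLHS]mulrC ler_wpM2r ?decay_ge0//; apply: lerD; last by rewrite indicE lern1 leq_b1.
by rewrite ler_wsqrtr// ler_wpM2r ?normr_ge0// ler_wpM2l// mesh_le1.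
Qed.

Lemma step_err_cvg v : step_err n v @[n --> \oo] --> 0.
Proof.
have c : decay rho t v * (Num.sqrt (4 * mesh u n * theta) + \1_`]-oo, - N n] v) @[n --> \oo] -->
    decay rho t v * (Num.sqrt (4 * 0 * theta) + 0).
  apply: cvgM; first exact: cvg_cst.
  apply: cvgD.
    apply: continuous_cvg; first exact: sqrt_continuous.
    apply: cvgM; last exact: cvg_cst.
    apply: cvgM; first exact: cvg_cst.
    exact: (partition_mesh_cvg0 hu).
  apply: cvg_near_cst; near=> n.
  rewrite indicE memNset//= in_itv/=; apply/negP; rewrite -ltNge.
  by near: n; exact: (partition_near_bound hu).
by move: c; rewrite mulr0 mul0r sqrtr0 addr0 mulr0.
Unshelve. all: by end_near. Qed.

Lemma discount_step_err n v : (0 < n)%N ->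
  ip (fun w => discount_step t (u n) n v w - discount_lim t v w)
     (fun w => discount_step t (u n) n v w - discount_lim t v w) <= step_err n v ^+ 2.
Proof.
move=> n0; have [vt|tv] := leP v t; last first.
  rewrite (_ : (fun w => _) = cst 0).
    by rewrite /ip; under eq_integral do rewrite /= mulr0; rewrite integral0 sqr_ge0.
  by apply/funext => w; rewrite /discount_step (stepf_gt hu)// /discount_lim leNgt tv subr0.
have d0 := decay_ge0 rho t v.
have [[vout s0]|[vin [r [r1 r2 sE]]]] := partition_step hu v n0.
  have -> : (fun w => discount_step t (u n) n v w - discount_lim t v w) = (fun w => 0 - discount_lim t v w).
    by apply/funext => w; rewrite /discount_step s0.
  apply: (le_trans (ip_sub_bound (a := 0) (sqint_cst P 0) (discount_lim_sqint v) _ d0 _ (discount_lim_sqr v))) => //.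
    by rewrite /ip; under eq_integral do rewrite mulr0; rewrite integral0 expr0n.
  rewrite add0r lerXn2r ?nnegrE ?step_err_ge0// ler_peMr//.
  rewrite indicE mem_set ?ler_wpDl ?sqrtr_ge0//= in_itv/= leNgt; apply/negP => Nv.
  by rewrite Nv vt in vout.
have -> : (fun w => discount_step t (u n) n v w - discount_lim t v w) =
    (fun w => discount X1 X2 t r w - discount X1 X2 t v w).
  by apply/funext => w; rewrite /discount_step sE /discount_lim vt.
have rt : r <= t by rewrite (le_trans _ vt)// ltW.
apply: ip_le; first by apply: sqintB; exact: (discount_sqint hxi X1lt1).
apply: (le_trans (discount_diff hxi X1lt1 t0 (ltW r2) vt)); rewrite lee_fin decayE//.
rewrite /step_err [leRHS]exprMn [leRHS]mulrC ler_wpM2r ?sqr_ge0//.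
apply: (@le_trans _ _ (Num.sqrt (4 * mesh u n * theta) ^+ 2)).
  rewrite sqrt_sqr ler_wpM2r ?normr_ge0// ler_wpM2l//; lra.
by rewrite lerXn2r ?nnegrE ?addr_ge0 ?sqrtr_ge0 ?indicE// lerDl.
Qed.

Lemma discount_step_sqr n v : ip (discount_step t (u n) n v) (discount_step t (u n) n v) <= decay rho t v ^+ 2.
Proof.
have z : ip (cst 0) (cst 0) <= decay rho t v ^+ 2.
  by rewrite /ip; under eq_integral do rewrite /= mulr0; rewrite integral0 sqr_ge0.
case: n => [|n].
  rewrite (_ : discount_step _ _ _ _ = cst 0)//.
  by apply/funext => w; rewrite /discount_step /stepf big_ord0.
have [[vout s0]|[/andP[_ vt] [r [r1 r2 sE]]]] := partition_step hu v (ltn0Sn n).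
  by rewrite (_ : discount_step _ _ _ _ = cst 0)//; apply/funext => w; rewrite /discount_step s0.
rewrite (_ : discount_step _ _ _ _ = discount X1 X2 t r); last first.
  by apply/funext => w; rewrite /discount_step sE.
have rt : r <= t by rewrite (le_trans _ vt)// ltW.
apply: ip_le; first exact: (discount_sqint hxi X1lt1).
rewrite (discount_sqr hxi X1lt1)// lee_fin -decayE// ler_expR ler_wnM2r//.
  by rewrite ltW// (rate2_lt0 X1lt1).
by rewrite lerB// ltW.
Qed.

End step_moments.

(** * Mean-square convergence of the Riemann sums *)

Section mean_square.
Context {R : realType} {d1 d2 : measure_display} {T1 : measurableType d1}
  {T2 : measurableType d2} (P1 : probability T1 R) (P2 : probability T2 R).
Variables (H : R) (hH : 2^-1 < H < 1).
Variables (B : R -> {RV P2 >-> R}) (hB : fractional_brownian_motion H B).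
Variables (xi : R -> T1 -> R) (X1 X2 : R -> {RV P1 >-> R}).
Hypothesis hxi : two_sided_levy_process xi X1 X2.
Hypothesis X1lt1 : (exp_moment X1 2 1 < 1)%E.
Local Notation Q := (P1 \x P2)%E.
Local Notation mu := (@lebesgue_measure R).
Local Notation mu2 := (mu \x mu)%E.
Local Notation rsum := (rsum B X1 X2).
Local Notation ip := (ip P1).

Let rho : R := rate X1 2 / 2.

Section one_time.
Variables (t : R) (t0 : 0 <= t) (N : nat -> R) (u : nat -> nat -> R).
Hypothesis hu : partition_sequence t N u.

Lemma discount_node_sqint n (i : 'I_n) : sqint P1 (discount X1 X2 t (u n i)).
Proof.
apply: (discount_sqint hxi X1lt1) => //.
by apply: (partition_le_last hu); [exact: ltnW|exact: leq_ltn_trans (ltn_ord i)].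
Qed.

Lemma rsum_sqint n : sqint Q (rsum t u n).
Proof. by apply: (incr_sum_sqint hB) => i; exact: discount_node_sqint. Qed.

Lemma rsum_mean n : (\int[Q]_z (rsum t u n z)%:E = 0)%E.
Proof. by apply: (incr_sum_mean hB) => i; exact: discount_node_sqint. Qed.

Let cells_le n (i : 'I_n) : u n i <= u n i.+1.
Proof. by apply: ltW; exact: (partition_increasing hu). Qed.

(** The step function of the coefficients is an inner product of two random
    step functions, each of which is a difference of approximations of the
    same limit, with errors [step_err]. *)
Lemma rsum_diff_sqr_le n m : (0 < n)%N -> (0 < m)%N ->
  forall (E C D : R), 0 <= D -> 
  (\int[mu]_v (step_err X1 t N u n v + step_err X1 t N u m v)%:E <= E%:E)%E ->
  (forall v, step_err X1 t N u n v + step_err X1 t N u m v <= C * decay rho t v) -> 0 <= C ->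
  (\int[mu]_v (decay rho t v)%:E <= D%:E)%E ->
  (\int[Q]_z ((rsum t u n z - rsum t u m z) ^+ 2)%:E <= (2 * E * (C + C * D))%:E)%E.
Proof.
move=> n0 m0 E C D D0 iE eC C0 iD.
pose c := @rsum_diff_coef _ _ _ P1 X1 X2 t u u n m.
have sc k : sqint P1 (c k).
  case: k => [i|j]; first exact: discount_node_sqint.
  rewrite (_ : c _ = (fun w => -1 * discount X1 X2 t (u m j) w)).
    by apply: sqintZ; exact: discount_node_sqint.
  by apply/funext => w; rewrite mulN1r.
under eq_integral do rewrite rsum_diff expr2.
rewrite (incr_sum_mul hB _ _ _ _ sc sc) lee_fin.
set x := join_pt _ _; set y := join_ptS _ _.
pose e v := step_err X1 t N u n v + step_err X1 t N u m v.
have e0 v : 0 <= e v by rewrite addr_ge0// step_err_ge0.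
have xy k : x k <= y k by case: k => k; exact: cells_le.
apply: le_trans (ler_norm _) _.
apply: (@icov_form_bound R H hH _ _ (fun k k' => ip (c k) (c k')) x y x y e
  (fun v => C * decay rho t v)) => //.
- by apply: measurable_funD; exact: measurable_step_err.
- by apply: measurable_funM => //; exact: measurable_decay.
- by move=> v; rewrite mulr_ge0 ?decay_ge0//= ler_piMr// decay_le1// (half_rate_lt0 X1lt1).
- under eq_integral do rewrite EFinM.
  rewrite ge0_integralZl_EFin//.
  + by rewrite EFinM lee_wpmul2l// lee_fin.
  + by move=> v _; rewrite lee_fin decay_ge0.
  + by apply/measurable_EFinP; exact: measurable_decay.
move=> v v'.
pose dif v w := discount_step X1 X2 t (u n) n v w - discount_step X1 X2 t (u m) m v w.
have difE v0 w : dif v0 w = \sum_k \1_`]x k, y k] v0 * c k w.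
  rewrite /dif /discount_step -diff_step; apply: eq_bigr => k _.
  by rewrite mulrC.
have -> : \sum_k \sum_k' ip (c k) (c k') * (\1_`]x k, y k] v * \1_`]x k', y k'] v') =
    ip (dif v) (dif v').
  rewrite /ip; under [in RHS]eq_integral do rewrite !difE.
  rewrite ip_sum//=; apply: eq_bigr => k _; apply: eq_bigr => k' _.
  by rewrite mulrC.
have sd v0 : sqint P1 (dif v0) by apply: sqintB; exact: (discount_step_sqint hxi X1lt1 t0 hu).
have nd v0 : ip (dif v0) (dif v0) <= e v0 ^+ 2.
  have := ip_sub_bound
    (sqintB (discount_step_sqint hxi X1lt1 t0 hu n v0) (discount_lim_sqint hxi X1lt1 t0 v0))
    (sqintB (discount_step_sqint hxi X1lt1 t0 hu m v0) (discount_lim_sqint hxi X1lt1 t0 v0))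
    (step_err_ge0 X1 t N u n v0) (step_err_ge0 X1 t N u m v0)
    (discount_step_err hxi X1lt1 t0 hu v0 n0) (discount_step_err hxi X1lt1 t0 hu v0 m0).
  congr (ip _ _ <= _); apply/funext => w; rewrite /dif; ring.
apply: le_trans (ip_bound (sd v) (sd v') (e0 v) (e0 v') (nd v) (nd v')) _.
by apply: ler_wpM2l; [exact: e0|exact: eC].
Qed.

Lemma rsum_L2_cauchy (eta : R) : 0 < eta -> exists K : nat, forall n m, (K <= n)%N -> (K <= m)%N ->
  (\int[Q]_z ((rsum t u n z - rsum t u m z) ^+ 2)%:E <= eta%:E)%E.
Proof.
move=> eta0; have [D [D0 iD]] := decay_integral (half_rate_lt0 X1lt1) t0.
pose C := Num.sqrt (4 * mesh u 1 * `|rate X1 1|) + 1.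
have C0 : 0 <= C by rewrite addr_ge0// sqrtr_ge0.
(* The last term keeps this bound positive. *)
pose M := 4 * (2 * C + 2 * C * D) + 1.
have M0 : 0 < M by rewrite ltr_wpDl// mulr_ge0// addr_ge0// ?mulr_ge0.
have eM : 0 < eta / M by rewrite divr_gt0.
have [K _ HK] : \forall n \near \oo, (\int[mu]_v (step_err X1 t N u n.+1 v)%:E <= (eta / M)%:E)%E.
  apply: (@dominated_to0 R (fun n => step_err X1 t N u n.+1) (fun v => C * decay rho t v) (C * D)) => //.
  - by move=> n; exact: measurable_step_err.
  - by apply: measurable_funM => //; exact: measurable_decay.
  - by move=> n v; exact: step_err_ge0.
  - by move=> n v; exact: (step_err_le X1 hu).
  - under eq_integral do rewrite EFinM.
    rewrite ge0_integralZl_EFin//.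
    + by rewrite EFinM lee_wpmul2l// lee_fin.
    + by move=> v _; rewrite lee_fin decay_ge0.
    + by apply/measurable_EFinP; exact: measurable_decay.
  - by move=> v; rewrite (cvg_shiftS (fun n => step_err X1 t N u n v)); exact: (step_err_cvg X1 hu).
exists K.+1 => n m Kn Km.
have n0 : (0 < n)%N by exact: leq_trans Kn.
have m0 : (0 < m)%N by exact: leq_trans Km.
have bound k : (K < k)%N -> (\int[mu]_v (step_err X1 t N u k v)%:E <= (eta / M)%:E)%E.
  by case: k => // k Kk; exact: HK.
apply: (le_trans (@rsum_diff_sqr_le n m n0 m0 (2 * (eta / M)) (2 * C) D D0 _ _ _ iD)).
- under eq_integral do rewrite EFinD.
  rewrite ge0_integralD//; last 4 first.
  + by move=> v _; rewrite lee_fin step_err_ge0.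
  + by apply/measurable_EFinP; exact: measurable_step_err.
  + by move=> v _; rewrite lee_fin step_err_ge0.
  + by apply/measurable_EFinP; exact: measurable_step_err.
  rewrite mulr_natl mulr2n EFinD; apply: leeD; exact: bound.
- move=> v; rewrite -mulrA mulr_natl mulr2n; apply: lerD; exact: (step_err_le X1 hu).
- by rewrite mulr_ge0.
rewrite lee_fin.
have -> : 2 * (2 * (eta / M)) * (2 * C + 2 * C * D) = eta * (4 * (2 * C + 2 * C * D) / M) by ring.
by rewrite ger_pMr// ler_pdivrMr// mul1r /M lerDl.
Qed.

End one_time.

(** The covariance is the integral against the kernel of an inner product of
    step functions, dominated by a product of two functions [decay]. *)
Lemma rsum_cov_cvg (s t : R) (N N' : nat -> R) (u u' : nat -> nat -> R) :
  0 <= s -> 0 <= t -> partition_sequence s N u -> partition_sequence t N' u' ->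
  measurable_fun setT (fun z : R * R => ip (discount_lim X1 X2 s z.1) (discount_lim X1 X2 t z.2)) /\
  (\int[Q]_z (rsum s u n z * rsum t u' n z)%:E @[n --> \oo] -->
   \int[mu2]_z (ip (discount_lim X1 X2 s z.1) (discount_lim X1 X2 t z.2) * hkernel H z)%:E)%E.
Proof.
move=> s0 t0 hu hu'.
pose G n (z : R * R) := ip (discount_step X1 X2 s (u n) n z.1) (discount_step X1 X2 t (u' n) n z.2).
pose L (z : R * R) := ip (discount_lim X1 X2 s z.1) (discount_lim X1 X2 t z.2).
have a0 := half_rate_lt0 X1lt1.
have sG n v := discount_step_sqint hxi X1lt1 s0 hu n v.
have sG' n v := discount_step_sqint hxi X1lt1 t0 hu' n v.
have sL v := discount_lim_sqint hxi X1lt1 s0 v.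
have sL' v := discount_lim_sqint hxi X1lt1 t0 v.
have nodes := @discount_node_sqint s s0 _ _ hu.
have nodes' := @discount_node_sqint t t0 _ _ hu'.
have GE n z : G n z = \sum_(i < n) \sum_(j < n)
    ip (discount X1 X2 s (u n i)) (discount X1 X2 t (u' n j)) *
    (\1_`]u n i, u n i.+1] z.1 * \1_`]u' n j, u' n j.+1] z.2).
  rewrite /G /ip /discount_step /stepf.
  under [in LHS]eq_integral => w _.
    rewrite (eq_bigr _ (fun i _ => mulrC _ _)).
    rewrite [X in _ * X](eq_bigr _ (fun i _ => mulrC _ _)).
    over.
  rewrite ip_sum//=; apply: eq_bigr => i _; apply: eq_bigr => j _.
  by rewrite mulrC.
have mG n : measurable_fun setT (G n).
  rewrite (funext (GE n)).
  apply: measurable_sum => i; apply: measurable_sum => j.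
  apply: measurable_funM => //; apply: measurable_funM.
    by apply: measurableT_comp => //; exact: measurable_indic.
  by apply: measurableT_comp => //; exact: measurable_indic.
have Gbnd n z : `|G n z| <= decay rho s z.1 * decay rho t z.2.
  apply: ip_bound => //; rewrite ?decay_ge0//.
    exact: (discount_step_sqr hxi X1lt1 s0 hu).
  exact: (discount_step_sqr hxi X1lt1 t0 hu').
have GL z : G n z @[n --> \oo] --> L z.
  have c : step_err X1 s N u n z.1 * decay rho t z.2 + decay rho s z.1 * step_err X1 t N' u' n z.2
      @[n --> \oo] --> 0 * decay rho t z.2 + decay rho s z.1 * 0.
    apply: cvgD; apply: cvgM; try exact: cvg_cst.
      exact: (step_err_cvg X1 hu).
    exact: (step_err_cvg X1 hu').
  rewrite mul0r mulr0 addr0 in c.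
  apply/cvgrPdist_le => e e0; near=> n.
  rewrite distrC; apply: le_trans (_ : _ <= step_err X1 s N u n z.1 * decay rho t z.2 +
    decay rho s z.1 * step_err X1 t N' u' n z.2) _; last first.
    by near: n; exact: (cvgr_le _ c).
  have n0 : (0 < n)%N by near: n; exact: nbhs_infty_gt.
  apply: ip_diff_bound => //; rewrite ?decay_ge0 ?step_err_ge0//.
  - exact: (discount_step_err hxi X1lt1 s0 hu).
  - exact: (discount_step_sqr hxi X1lt1 t0 hu').
  - exact: (discount_lim_sqr hxi X1lt1 s0).
  - exact: (discount_step_err hxi X1lt1 t0 hu').
have mL : measurable_fun setT L.
  by apply: (measurable_fun_cvg (h := G)) => // z _; exact: GL.
split=> //.
have [D [D0 iD]] := decay_integral a0 s0.
have [D' [D'0 iD']] := decay_integral a0 t0.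
have mh := measurable_hkernel H.
have QE n : (\int[Q]_z (rsum s u n z * rsum t u' n z)%:E = \int[mu2]_z (G n z * hkernel H z)%:E)%E.
  rewrite (incr_sum_mul hB _ _ _ _ (nodes n) (nodes' n)).
  have [_ <-] := icov_form hH (fun i j : 'I_n => ip (discount X1 X2 s (u n i)) (discount X1 X2 t (u' n j)))
    (fun i : 'I_n => ltW (partition_increasing hu (ltn_ord i)))
    (fun i : 'I_n => ltW (partition_increasing hu' (ltn_ord i))).
  by apply: eq_integral => z _; rewrite GE.
under eq_fun do rewrite QE.
have [|||||_ _] := @dominated_convergence _ _ R mu2 setT measurableT
    (fun n z => (G n z * hkernel H z)%:E) (fun z => (L z * hkernel H z)%:E)
    (fun z => (decay rho s z.1 * decay rho t z.2 * hkernel H z)%:E) => //.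
- by move=> n; apply/measurable_EFinP; apply: measurable_funM; [exact: mG|exact: mh].
- by apply/measurable_EFinP; apply: measurable_funM; [exact: mL|exact: mh].
- apply: aeW => z _; apply: cvg_EFin; first exact: nearW.
  by apply: cvgM; [exact: GL|exact: cvg_cst].
- have md : measurable_fun setT (fun z : R * R => decay rho s z.1 * decay rho t z.2 * hkernel H z).
    apply: measurable_funM => //; apply: measurable_funM.
      by apply: measurableT_comp => //; exact: measurable_decay.
    by apply: measurableT_comp => //; exact: measurable_decay.
  apply/integrableP; split; first by apply/measurable_EFinP.
  apply: (@le_lt_trans _ _ (\int[mu2]_z (decay rho s z.1 * decay rho t z.2 * hkernel H z)%:E)%E).
    rewrite le_eqVlt; apply/orP; left; apply/eqP; apply: eq_integral => z _; rewrite gee0_abs// lee_fin.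
    by apply: mulr_ge0; [apply: mulr_ge0; exact: decay_ge0|exact: hkernel_ge0].
  apply: le_lt_trans (ltry (2 * D * (1 + D'))).
  apply: hkernel_bound => //.
  + exact: measurable_decay.
  + exact: measurable_decay.
  + by move=> v; exact: decay_ge0.
  + by move=> v; rewrite decay_ge0 decay_le1.
- apply: aeW => z n _.
  by rewrite abse_EFin lee_fin normrM (ger0_norm (hkernel_ge0 hH z)) ler_wpM2r ?hkernel_ge0.
Unshelve. all: by end_near. Qed.

End mean_square.

(** * Mean-square limits *)

Section mean_square_limit.
Context {d : measure_display} {T : measurableType d} {R : realType}.
Variable P : probability T R.

Lemma cvg_cauchy_in_probability (Z : nat -> T -> R) (Y : T -> R) :
  (forall n, measurable_fun setT (Z n)) -> measurable_fun setT Y ->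
  cvg_in_probability P Z Y -> cauchy_in_probability P Z.
Proof.
move=> mZ mY ZY e dl e0 dl0.
have e2 : 0 < e / 2 by rewrite divr_gt0.
have dl2 : 0 < dl / 2 by rewrite divr_gt0.
have [K _ HK] := (ge0_cvge0P (fun n => measure_ge0 P _)).1 (ZY _ e2) _ dl2.
exists K => n m Kn Km.
apply: (le_trans (far_triangle _ _ (mZ n) (mZ m) mY)).
have -> : dl%:E = ((dl / 2)%:E + (dl / 2)%:E)%E by rewrite -EFinD; congr EFin; lra.
apply: leeD; first exact: (HK n).
rewrite (_ : [set w | _] = [set w | e / 2 < `|Z m w - Y w|]); first exact: (HK m).
by apply/seteqP; split => w /=; rewrite distrC.
Qed.

(** Fatou's lemma along a subsequence that converges almost surely. *)
Lemma L2_cauchy_limit (Z : nat -> T -> R) (Y : T -> R) :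
  (forall n, sqint P (Z n)) -> measurable_fun setT Y ->
  (forall eta : R, 0 < eta -> exists K : nat, forall n m, (K <= n)%N -> (K <= m)%N ->
     (\int[P]_w ((Z n w - Z m w) ^+ 2)%:E <= eta%:E)%E) ->
  cvg_in_probability P Z Y ->
  sqint P Y /\
  ip P (fun w => Z n w - Y w) (fun w => Z n w - Y w) @[n --> \oo] --> 0.
Proof.
move=> sZ mY cZ ZY; have mZ n : measurable_fun setT (Z n) by case: (sZ n).
have [Y' [f [mY' kf fY' ZY']]] := cauchy_in_probability_cvg mZ (cvg_cauchy_in_probability mZ mY ZY).
have YY' := cvg_in_probability_unique mZ mY mY' ZY ZY'.
have fY : {ae P, forall w, Z (f k) w @[k --> \oo] --> Y w}.
  by apply: filterS2 fY' YY' => w + ->.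
have bound eta K : (forall n m, (K <= n)%N -> (K <= m)%N ->
     (\int[P]_w ((Z n w - Z m w) ^+ 2)%:E <= eta%:E)%E) ->
   forall n, (K <= n)%N -> (\int[P]_w ((Z n w - Y w) ^+ 2)%:E <= eta%:E)%E.
  move=> HK n Kn.
  pose g k w := ((Z n w - Z (f (k + K)%N) w) ^+ 2)%:E.
  have mg k : measurable_fun setT (g k).
    by apply/measurable_EFinP; apply: measurable_funX; exact: measurable_funB.
  have g0 k w : [set: T] w -> (0 <= g k w)%E by move=> _; rewrite lee_fin sqr_ge0.
  have := fatou P measurableT mg g0.
  rewrite (_ : \int[P]_w limn_einf (g ^~ w) = \int[P]_w ((Z n w - Y w) ^+ 2)%:E)%E; last first.
    apply: ae_eq_integral => //.
    - rewrite /limn_einf; apply: (measurableT_comp (f := -%E)) => //.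
      apply: measurable_fun_limn_esup => k; exact: (measurableT_comp (f := -%E)).
    - by apply/measurable_EFinP; apply: measurable_funX; exact: measurable_funB.
    apply: filterS fY => w fYw _.
    have c : g k w @[k --> \oo] --> ((Z n w - Y w) ^+ 2)%:E.
      apply: cvg_EFin; first exact: nearW.
      have c1 : Z (f (k + K)%N) w @[k --> \oo] --> Y w by rewrite (cvg_shiftn K (fun k => Z (f k) w)).
      have c2 : Z n w - Z (f (k + K)%N) w @[k --> \oo] --> Z n w - Y w.
        by apply: cvgB => //; exact: cvg_cst.
      exact: (cvgM c2 c2).
    by have [] := cvg_limn_einf_sup c.
  move=> /le_trans; apply; rewrite limn_einf_lim; apply: lime_le; first exact: is_cvg_einfs.
  apply: nearW => k; apply: (@le_trans _ _ (\int[P]_w g k w)%E).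
    by apply: ereal_inf_lbound; exists k => //=.
  by apply: HK => //; apply: leq_trans (kf _); exact: leq_addl.
have [K HK] := cZ 1 ltr01.
have sYK : sqint P (fun w => Z K w - Y w).
  split; first exact: measurable_funB.
  exact: le_lt_trans (bound 1 K HK K (leqnn K)) (ltry _).
have sY : sqint P Y.
  have := sqintB (sZ K) sYK; congr (sqint _ _).
  by apply/funext => w; rewrite subKr.
split => //; apply/cvgr0Pnorm_le => eta eta0.
have [L HL] := cZ eta eta0; exists L => // n /= Ln.
by rewrite ger0_norm ?ip_ge0//; apply: ip_le; [exact: sqintB|exact: bound HL _ Ln].
Qed.

Import HBNNSimple.
(** An integral is a supremum over the simple functions below the integrand,
    and these may be set to [0] on a null set. The function [f] will be built
    from left limits of paths, which need not be measurable. *)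
Lemma ge0_ae_eq_measurable_integral (f g : T -> \bar R) :
  (forall w, 0 <= f w)%E -> (forall w, 0 <= g w)%E -> measurable_fun setT g ->
  {ae P, forall w, f w = g w} -> (\int[P]_w f w = \int[P]_w g w)%E.
Proof.
move=> f0 g0 mg [N [mN N0 sN]].
have mI (h : T -> \bar R) : measurable_fun setT h -> measurable_fun setT (fun w => h w * (\1_(~` N) w)%:E)%E.
  move=> mh; apply: emeasurable_funM => //; apply/measurable_EFinP; apply: measurable_indic.
  exact: measurableC.
have eqI (h : T -> \bar R) : measurable_fun setT h ->
    (\int[P]_w h w = \int[P]_w (h w * (\1_(~` N) w)%:E))%E.
  move=> mh; apply: ae_eq_integral => //; first exact: mI.
  exists N; split => // w /= hw; apply: contrapT => nN; apply: hw => _.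
  by rewrite indicE mem_set// mule1.
have fgE w : ~ N w -> f w = g w by move=> nN; apply: contrapT => h; exact/nN/sN.
apply/eqP; rewrite eq_le; apply/andP; split.
  rewrite [leLHS]ge0_integralTE//; apply: ge_ereal_sup => _ [h hf <-].
  have mh : measurable_fun setT (EFin \o h) by exact: measurableT_comp.
  rewrite -integralT_nnsfun [leLHS]eqI// [leRHS]eqI//.
  apply: ge0_le_integral => //.
  - by move=> w _; apply: mule_ge0; rewrite lee_fin ?fun_ge0 ?indicE.
  - exact: mI.
  - exact: mI.
  move=> w _; rewrite indicE; case: (boolP (w \in ~` N)); last by rewrite !mule0.
  by rewrite inE => nN; rewrite !mule1 -fgE.
rewrite eqI// [leLHS]ge0_integralTE; last by move=> w; rewrite mule_ge0.
rewrite ge0_integralTE//; apply: ereal_sup_le => _ [h hf <-]; exists h => // w; apply: le_trans (hf w) _.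
rewrite indicE; case: (boolP (w \in ~` N)); last by rewrite mule0.
by rewrite inE => nN; rewrite mule1 fgE.
Qed.

End mean_square_limit.

Lemma integral_completed {d : measure_display} {T : measurableType d} {R : realType}
    (Q : probability T R) (f : T -> \bar R) : measurable_fun setT f ->
  (\int[completion Q]_w f w = \int[Q]_w f w)%E.
Proof.
move=> mf; rewrite [LHS]integralE [RHS]integralE; congr (_ - _)%E.
  by apply: ge0_integral_completed => //; exact: measurable_funepos.
by apply: ge0_integral_completed => //; exact: measurable_funeneg.
Qed.

(** * Moments of the integral *)

Section mean_square_integral.
Context {R : realType} {d1 d2 : measure_display} {T1 : measurableType d1}
  {T2 : measurableType d2} (P1 : probability T1 R) (P2 : probability T2 R).
Variables (H : R) (hH : 2^-1 < H < 1).
Variables (B : R -> {RV P2 >-> R}) (hB : fractional_brownian_motion H B).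
Variables (xi : R -> T1 -> R) (X1 X2 : R -> {RV P1 >-> R}).
Hypothesis hxi : two_sided_levy_process xi X1 X2.
Local Notation Q := (P1 \x P2)%E.
Local Notation P := (product_prob P1 P2).
Local Notation mu := (@lebesgue_measure R).
Local Notation mu2 := (mu \x mu)%E.
Local Notation rsum := (rsum B X1 X2).
Local Notation rie := (riemann_sum P1 P2 xi (fun t => B t)).

Lemma exp_moment_lt1 : ('E_P[fun w => expR (- 2 * xi 1 w.1)%R] < 1)%E -> (exp_moment X1 2 1 < 1)%E.
Proof.
rewrite unlock.
have mf : measurable_fun setT (fun w : T1 => (expR (- (2 * X1 1 w)))%:E).
  apply/measurable_EFinP; apply: measurableT_comp => //; apply: measurable_funN.
  exact: measurable_funM.
have -> : (\int[P]_w (expR (- 2 * xi 1 w.1))%:E = \int[P]_w (expR (- (2 * X1 1 w.1)))%:E)%E.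
  by apply: eq_integral => w _; rewrite (two_sided_nonneg hxi)// mulNr.
have mfst : measurable_fun setT (fun w : T1 * T2 => (expR (- (2 * X1 1 w.1)))%:E).
  by apply: (measurableT_comp (f := fun w : T1 => (expR (- (2 * X1 1 w)))%:E)).
have := @ge0_integral_completed _ _ _ Q _ mfst (fun x => _).
move=> /(_ (fun x => expR_ge0 _)) E; rewrite [X in (X < _)%E -> _]E.
rewrite fubini_tonelli1//.
congr (_ < _)%E; apply: eq_integral => w _.
by rewrite /fubini_F /= integral_prob_cst.
Qed.

Hypothesis X1lt1 : (exp_moment X1 2 1 < 1)%E.

Lemma rsum_sqint_completed t N u n : 0 <= t -> partition_sequence t N u ->
  sqint P (rsum t u n).
Proof.
move=> t0 hu; have [m i] := rsum_sqint hB hxi X1lt1 t0 hu n.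
split; first exact: measurable_completed.
rewrite (_ : (\int[P]_w (rsum t u n w ^+ 2)%:E = \int[Q]_w (rsum t u n w ^+ 2)%:E)%E)//.
apply: ge0_integral_completed; last by move=> w; rewrite lee_fin sqr_ge0.
by apply/measurable_EFinP; exact: measurable_funX.
Qed.

Section one_time.
Variables (t : R) (t0 : 0 <= t) (Y : {RV P >-> R}).
Hypothesis hY : is_backward_integral P1 P2 xi (fun t => B t) t Y.

Section one_partition.
Variables (N : nat -> R) (u : nat -> nat -> R).
Hypothesis hu : partition_sequence t N u.

Lemma rsum_L2_cvg : sqint P Y /\
  ip P (fun w => rsum t u n w - Y w) (fun w => rsum t u n w - Y w) @[n --> \oo] --> 0.
Proof.
have mr n : measurable_fun setT (rsum t u n : product_space P1 P2 -> R).
  by apply: measurable_completed; exact: measurable_rsum.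
apply: L2_cauchy_limit => //.
- by move=> n; exact: rsum_sqint_completed hu.
- move=> eta eta0; have [K HK] := rsum_L2_cauchy hH hB hxi X1lt1 t0 hu eta0.
  exists K => n m Kn Km; apply: le_trans (HK n m Kn Km).
  rewrite le_eqVlt; apply/orP; left; apply/eqP.
  apply: ge0_integral_completed; last by move=> w; rewrite lee_fin sqr_ge0.
  by apply/measurable_EFinP; apply: measurable_funX; apply: measurable_funB; exact: measurable_rsum.
move=> e e0; rewrite (_ : (fun n => _) = (fun n => P [set w | e < `|rie t u n w - Y w|])); first exact: hY hu e e0.
apply/funext => n; apply: ae_iff_measure.
- exact: (@measurable_far _ (product_space P1 P2)).
- apply: (@measurable_far _ (product_space P1 P2)) => //; exact: (measurable_riemann_sum B hxi).
apply: (@filterS _ _ (ae_filter_ringOfSetsType P)) (riemann_sum_ae B hxi t u n) => w E /=.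
by rewrite E.
Qed.

Lemma riemann_sum_L2_error n :
  (\int[P]_w ((rie t u n w - Y w) ^+ 2)%:E =
   (ip P (fun w => rsum t u n w - Y w) (fun w => rsum t u n w - Y w))%:E)%E.
Proof.
have sd : sqint P (fun w => rsum t u n w - Y w).
  by apply: sqintB; [exact: rsum_sqint_completed hu|exact: (rsum_L2_cvg).1].
rewrite -(ipE sd sd); apply: ae_eq_integral => //.
- apply/measurable_EFinP; apply: measurable_funX; apply: measurable_funB => //.
  exact: (measurable_riemann_sum B hxi).
- by apply/measurable_EFinP; apply: measurable_funM; case: sd.
apply: (@filterS _ _ (ae_filter_ringOfSetsType P)) (riemann_sum_ae B hxi t u n) => w E /= _.
by rewrite E expr2.
Qed.

Lemma riemann_sum_Lfun n : rie t u n \in Lfun P 2%:E.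
Proof.
have [sY _] := rsum_L2_cvg.
apply: sqint_Lfun.
have sd : sqint P (fun w => rie t u n w - Y w).
  split; last by rewrite riemann_sum_L2_error ltry.
  by apply: measurable_funB => //; exact: (measurable_riemann_sum B hxi).
have := sqintD sd sY; congr (sqint _ _).
by apply/funext => w; rewrite subrK.
Qed.

Lemma riemann_sum_Lnorm_cvg :
  ('N[P]_2%:E[EFin \o (fun w => rie t u n w - Y w)%R])%E @[n --> \oo] --> 0%E.
Proof.
have E n : ('N[P]_2%:E[EFin \o (fun w => rie t u n w - Y w)%R] =
  (Num.sqrt (ip P (fun w => rsum t u n w - Y w) (fun w => rsum t u n w - Y w)))%:E)%E.
  by rewrite LnormE riemann_sum_L2_error poweR_EFin powR12_sqrt// ip_ge0.
under eq_fun do rewrite E.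
apply: cvg_EFin; first exact: nearW.
rewrite -(sqrtr0 R); apply: continuous_cvg; first exact: sqrt_continuous.
exact: (rsum_L2_cvg).2.
Qed.

End one_partition.

Lemma backward_integral_sqint : sqint P Y.
Proof.
by have [N [u hu]] := partition_sequence_exists t0; exact: (rsum_L2_cvg hu).1.
Qed.

Lemma backward_integral_mean : ('E_P[Y] = 0)%E.
Proof.
have [N [u hu]] := partition_sequence_exists t0.
have [sY cY] := rsum_L2_cvg hu.
have s1 := sqint_cst P 1.
have c1 : ip P (fun w => cst 1 w - cst 1 w) (fun w => cst 1 w - cst 1 w) @[n --> \oo] --> (0 : R).
  apply: cvg_near_cst; apply: nearW => n.
  by rewrite /ip; under eq_integral do rewrite subrr mulr0; rewrite integral0.
have := @ip_cvg _ _ _ P (rsum t u) (fun=> cst 1) Y (cst 1)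
  (fun n => rsum_sqint_completed n t0 hu) (fun=> s1) sY s1 cY c1.
have E n : ip P (rsum t u n) (cst 1) = 0.
  rewrite /ip; under eq_integral do rewrite mulr1.
  have mr := @measurable_rsum _ _ _ _ _ P1 P2 B X1 X2 t u n.
  have mr' : measurable_fun setT (EFin \o rsum t u n) by apply/measurable_EFinP.
  have -> : (\int[P]_w (rsum t u n w)%:E = \int[Q]_w (rsum t u n w)%:E)%E.
    exact: (integral_completed Q mr').
  by rewrite (rsum_mean hB hxi X1lt1 t0 hu).
under eq_fun do rewrite E.
move=> c; have {c} Y1 : ip P Y (cst 1) = 0.
  by apply: (cvg_unique _ c); [exact: norm_hausdorff|exact: cvg_cst].
rewrite unlock.
have -> : (\int[P]_w (Y w)%:E = \int[P]_w (Y w * cst 1 w)%:E)%E.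
  by apply: eq_integral => w _; rewrite mulr1.
by rewrite ipE// Y1.
Qed.

End one_time.

Section two_times.
Variables (s t : R) (s0 : 0 <= s) (t0 : 0 <= t) (Ys Yt : {RV P >-> R}).
Hypothesis hYs : is_backward_integral P1 P2 xi (fun t => B t) s Ys.
Hypothesis hYt : is_backward_integral P1 P2 xi (fun t => B t) t Yt.
Local Notation corr u v := (ip P1 (discount_lim X1 X2 s u) (discount_lim X1 X2 t v)).

Lemma backward_integral_cov :
  measurable_fun setT (fun z : R * R => corr z.1 z.2) /\
  ('E_P[fun w => (Ys w * Yt w)%R] = \int[mu2]_z (corr z.1 z.2 * hkernel H z)%:E)%E.
Proof.
have [N [u hu]] := partition_sequence_exists s0.
have [N' [u' hu']] := partition_sequence_exists t0.
have [mL c] := rsum_cov_cvg hH hB hxi X1lt1 s0 t0 hu hu'.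
split=> //.
have [sYs cs] := rsum_L2_cvg s0 hYs hu.
have [sYt ct] := rsum_L2_cvg t0 hYt hu'.
have sr n := rsum_sqint_completed n s0 hu.
have sr' n := rsum_sqint_completed n t0 hu'.
have c2 := ip_cvg sr sr' sYs sYt cs ct.
rewrite unlock ipE//.
apply: (cvg_unique _ _ c) => //.
rewrite (_ : (fun n => _) = (fun n => (ip P (rsum s u n) (rsum t u' n))%:E)); last first.
  apply/funext => n; rewrite -ipE//; apply/esym.
  apply: (integral_completed Q (f := fun w => (rsum s u n w * rsum t u' n w)%:E)).
  by apply/measurable_EFinP; apply: measurable_funM; exact: measurable_rsum.
by apply: cvg_EFin; [exact: nearW|exact: c2].
Qed.

Lemma discount_expectation u v : u <= s -> v <= t ->
  'E_P1[fun w1 => expR (- xi s w1 + left_limit (xi ^~ w1) u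
                        - xi t w1 + left_limit (xi ^~ w1) v)%R]%E = (corr u v)%:E.
Proof.
move=> us vt; rewrite unlock.
have su := discount_lim_sqint hxi X1lt1 s0 u; have sv := discount_lim_sqint hxi X1lt1 t0 v.
rewrite -(ipE su sv); apply: ge0_ae_eq_measurable_integral.
- by move=> w; rewrite lee_fin expR_ge0.
- by move=> w; rewrite lee_fin discount_lim_le// discount_lim_le// mulr_ge0 ?expR_ge0.
- by apply/measurable_EFinP; apply: measurable_funM; [case: su|case: sv].
apply: filterS2 (filterI (xi_version_ae hxi s) (xi_version_ae hxi t))
  (filterI (xi_left_limit_ae hxi u) (xi_left_limit_ae hxi v)) => w [E1 E2] [E3 E4].
rewrite discount_lim_le// discount_lim_le// /discount -expRD E1 E2 E3 E4; congr (expR _)%:E; ring.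
Qed.

Lemma corr_ge0 u v : 0 <= corr u v.
Proof.
apply: fine_ge0; apply: integral_ge0 => w _; rewrite lee_fin.
by rewrite /discount_lim; apply: mulr_ge0; case: ifPn => // _; exact: expR_ge0.
Qed.

(** Tonelli's theorem; the factors [discount_lim] vanish beyond [s] and [t],
    which restricts the domain of integration. *)
Lemma covariance_formula :
  ('E_P[fun w => (Ys w * Yt w)%R] =
      ((H * (2 * H - 1))%R%:E *
       \int[mu]_(u in `]-oo, s])
       \int[mu]_(v in `]-oo, t])
         ('E_P1[fun w1 => expR (- xi s w1 + left_limit (xi ^~ w1) u
                                - xi t w1 + left_limit (xi ^~ w1) v)%R]
          * (`|u - v| `^ (2 * H - 2))%R%:E)))%E.
Proof.
have [mL ->] := backward_integral_cov.
have cH0 : 0 <= H * (2 * H - 1) by move: hH => /andP[h1 h2]; rewrite mulr_ge0//; lra.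
pose K (z : R * R) := corr z.1 z.2 * `|z.1 - z.2| `^ (2 * H - 2).
have K0 z : 0 <= K z by rewrite mulr_ge0 ?corr_ge0 ?powR_ge0.
have hE z : corr z.1 z.2 * hkernel H z = H * (2 * H - 1) * K z.
  by rewrite /hkernel /K; ring.
have mK : measurable_fun setT K.
  apply: measurable_funM => //.
  apply: (measurableT_comp (f := fun x : R => `|x| `^ (2 * H - 2))).
    by have := measurable_norm_powR (0 : R) (2 * H - 2); under eq_fun do rewrite subr0.
  exact: measurable_funB.
under eq_integral do rewrite hE EFinM.
have mK' : measurable_fun setT (fun z : R * R => (K z)%:E) by apply/measurable_EFinP.
rewrite ge0_integralZl_EFin//; last by move=> z _; rewrite lee_fin.
rewrite fubini_tonelli1//.
congr (_ * _)%E.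
rewrite [RHS]integral_mkcond; apply: eq_integral => u _; rewrite /fubini_F patchE.
case: ifPn => [|]; rewrite ?inE ?notin_setE /= in_itv/=.
  move=> us; rewrite [RHS]integral_mkcond; apply: eq_integral => v _; rewrite patchE.
  case: ifPn => [|]; rewrite ?inE ?notin_setE /= in_itv/=.
    by move=> vt; rewrite discount_expectation.
  move=> /negP; rewrite -ltNge => tv; rewrite /K /= (discount_lim_gt X1 X2 tv).
  by rewrite /ip; under eq_integral do rewrite mulr0; rewrite integral0 mul0r.
move=> /negP; rewrite -ltNge => su; rewrite integral0_eq// => v _.
rewrite /K /= discount_lim_gt//.
by rewrite /ip; under eq_integral do rewrite mul0r; rewrite integral0 mul0r.
Qed.

End two_times.

End mean_square_integral.

Theorem theorem3p1 (R : realType) (d1 d2 : measure_display)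
  (T1 : measurableType d1) (T2 : measurableType d2)
  (P1 : probability T1 R) (P2 : probability T2 R)
  (H : R) (hH : 2^-1 < H < 1)
  (B : R -> {RV P2 >-> R}) (hB : fractional_brownian_motion H B)
  (xi : R -> T1 -> R) (X1 X2 : R -> {RV P1 >-> R})
  (hxi : two_sided_levy_process xi X1 X2)
  (hlim : {ae product_prob P1 P2, forall w, xi t w.1 @[t --> +oo] --> +oo}) :
  let P := product_prob P1 P2 in
  let integral := is_backward_integral P1 P2 xi (fun t => B t) in
  (forall t, 0 <= t -> exists Y : {RV P >-> R}, integral t Y) /\
  (('E_P[fun w => expR (- 2 * xi 1 w.1)%R] < 1)%E ->
   forall Y : R -> {RV P >-> R},
   (forall t, 0 <= t -> integral t (Y t)) ->
   (forall t, 0 <= t ->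
      ((Y t : _ -> R) \in Lfun P 2%:E) /\
      forall (N : nat -> R) (u : nat -> nat -> R), partition_sequence t N u ->
      let Z := riemann_sum P1 P2 xi (fun t => B t) t u in
      (forall n, (0 < n)%N -> Z n \in Lfun P 2%:E) /\
      ('N[P]_2%:E[EFin \o (fun w => Z n w - Y t w)%R])%E @[n --> \oo] --> 0%E) /\
   (forall t, 0 <= t -> ('E_P[Y t] = 0)%E) /\
   (forall s t, 0 < s -> s <= t ->
      'E_P[fun w => (Y s w * Y t w)%R]%E =
      ((H * (2 * H - 1))%R%:E *
       \int[lebesgue_measure]_(u in `]-oo, s])
       \int[lebesgue_measure]_(v in `]-oo, t])
         ('E_P1[fun w1 => expR (- xi s w1 + left_limit (xi ^~ w1) u
                                - xi t w1 + left_limit (xi ^~ w1) v)%R]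
          * (`|u - v| `^ (2 * H - 2))%R%:E))%E)).
Proof.
move=> P integral; split.
  by move=> t t0; exact: (backward_integral_exists hH hB hxi (levy_cvgy hxi hlim) t0).
move=> /(exp_moment_lt1 hxi) X1lt1 Y hY; split; [|split].
- move=> t t0; have hYt := hY t t0; split.
    by apply: sqint_Lfun; exact: (backward_integral_sqint hH hB hxi X1lt1 t0 hYt).
  move=> N u hu Z; split.
    by move=> n _; exact: (riemann_sum_Lfun hH hB hxi X1lt1 t0 hYt hu).
  exact: (riemann_sum_Lnorm_cvg hH hB hxi X1lt1 t0 hYt hu).
- by move=> t t0; exact: (backward_integral_mean hH hB hxi X1lt1 t0 (hY t t0)).
move=> s t /ltW s0 st; have t0 := le_trans s0 st.
exact: (covariance_formula hH hB hxi X1lt1 s0 t0 (hY s s0) (hY t t0)).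
Qed.
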